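(* Let $t\ge1$, $n\ge1$, and let $\beta_n^{(t)}$ be the product Frobenius characteristic of the top homology $\tilde H_{n-2}(B_n^{(t)})$. For $\lambda\vdash n$ put $c_\lambda=(-1)^{n-\ell(\lambda)}\frac{\ell(\lambda)!}{\prod_i m_i(\lambda)!}$ and $Z_\lambda^{(t)}=\prod_{j=1}^t h_\lambda(X^j)$, $Z^{(t)}_m=\prod_{j=1}^t h_m(X^j)$. Then: (1) $\beta_n^{(t)}=\sum_{\lambda\vdash n}c_\lambda Z_\lambda^{(t)}$. (2) $\sum_{n\ge0}u^n\beta_n^{(t)}=\big(\sum_{n\ge0}u^n(-1)^nZ_n^{(t)}\big)^{-1}$ (with $\beta_0^{(t)}=Z_0^{(t)}=1$). (3) For a $t$-tuple $\boldsymbol\mu=(\mu^1,\ldots,\mu^t)$ of partitions of $n$, the multiplicity of the irreducible $\mathfrak{S}_n^{\times t}$-module indexed by $\boldsymbol\mu$ in $\tilde H_{n-2}(B_n^{(t)})$ equals $\sum_{\lambda\vdash n}c_\lambda\prod_{j=1}^tK_{\mu^j,\lambda}$. (4) For $\lambda\vdash n$, the multiplicity of the irreducible indexed by $(\mu^1,\ldots,\mu^t)$ in the (possibly virtual) $\mathfrak{S}_n^{\times t}$-module whose product Frobenius characteristic is $\Phi_t(s_\lambda)$ equals \[\sum_{\substack{\sigma\in\mathfrak{S}_{\ell(\lambda)}\\ \lambda_i-i+\sigma(i)\ge0\ \forall i}}\mathrm{sgn}(\sigma)\prod_{j=1}^tK_{\mu^j,\tilde\lambda_\sigma},\] where $\tilde\lambda_\sigma$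 is the partition of $n$ whose parts are the positive integers among $\lambda_i-i+\sigma(i)$, $1\le i\le\ell(\lambda)$; equivalently it equals $\sum_{\nu\vdash n}\mathcal{M}(s,h)_{\lambda,\nu}\prod_{j=1}^tK_{\mu^j,\nu}$.
   Context: $B_n^{(t)}$ is the poset of $t$-tuples $(A_1,\ldots,A_t)$ of subsets of $[n]$ with $|A_1|=\cdots=|A_t|$, ordered componentwise by inclusion, with $\mathfrak{S}_n^{\times t}$ acting coordinatewise; $\tilde H_{n-2}(B_n^{(t)})$ is the top reduced rational homology of the order complex of its proper part. $X^1,\ldots,X^t$ are disjoint sets of variables; the product Frobenius characteristic of a (virtual) $\mathfrak{S}_n^{\times t}$-module $\sum a_{\boldsymbol\mu}\chi^{\mu^1}\otimes\cdots\otimes\chi^{\mu^t}$ is $\sum a_{\boldsymbol\mu}\prod_j s_{\mu^j}(X^j)$, where $\chi^\mu$ is the irreducible character of $\mathfrak{S}_n$ indexed by $\mu$ and $s_\mu$ the Schur function; this identifies (virtual) modules with elements of $\bigotimes_j\Lambda^n(X^j)$. $\Phi_t:\Lambda(x)\to\bigotimes_j\Lambda(X^j)$ is the algebra homomorphism with $\Phi_t(h_m)=\prod_{j}h_m(X^j)$. For $\lambda\vdash n$: $\ell(\lambda)$ is the number of parts, $m_i(\lambda)$ the number of parts equal to $i$, $h_\lambda=\prod_i h_{\lambda_i}$; $K_{\mu,\nu}$ is the Kostka number (number of semistandard Young tableaux of shape $\mu$ and content $\nu$); $\mathcal{M}(s,h)$ is the transition matrix with $s_\lambda=\sum_\nu\mathcal{M}(s,h)_{\lambda,\nu}h_\nu$.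 *)

(* Defs.v *)
From HB Require Import structures.
From mathcomp Require Import all_boot all_order all_algebra.
From mathcomp Require Import all_fingroup all_solvable all_field all_character.
From mathcomp Require Import mpoly.
From mathcomp Require boolp.

Set Implicit Arguments.
Unset Strict Implicit.
Unset Printing Implicit Defensive.

Import GroupScope Order.TTheory GRing.Theory Num.Theory.
Local Open Scope ring_scope.

(* A partition of n is stored as its weakly decreasing sequence of parts, padded
   with zeros to length n; [parts la] lists the nonzero ones. *)
Definition is_intpart n (p : n.-tuple 'I_n.+1) : bool :=
  sorted geq (map val p) && (sumn (map val p) == n).

Definition intpart n : finType := {p : n.-tuple 'I_n.+1 | is_intpart p}.

Definition parts n (la : intpart n) : seq nat :=
  [seq x <- map val (val la) | (0 < x)%N].

Definition part n (la : intpart n) (i : nat) : nat := nth 0%N (parts la) i.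

Definition ell n (la : intpart n) : nat := size (parts la).

Definition mult n (la : intpart n) (i : nat) : nat := count_mem i (parts la).

Definition cell n (mu : intpart n) : finType :=
  {c : 'I_n * 'I_n | (c.2 < part mu c.1)%N}.

Definition crow n (mu : intpart n) (c : cell mu) : 'I_n := (val c).1.
Definition ccol n (mu : intpart n) (c : cell mu) : 'I_n := (val c).2.

(* Entries are numbered from 0. *)
Definition ssyt n (mu : intpart n) b (T : {ffun cell mu -> 'I_b}) : bool :=
  [forall c, forall c',
     ((crow c == crow c') && (ccol c < ccol c')%N ==> (T c <= T c')%N) &&
     ((ccol c == ccol c') && (crow c < crow c')%N ==> (T c < T c')%N)].

Definition kostka n (mu : intpart n) (nu : seq nat) : nat :=
  #|[set T : {ffun cell mu -> 'I_(size nu)} |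
      ssyt T & [forall k, #|[set c | T c == k]| == nth 0%N nu k]]|.

Section PermutationRepresentation.

Variables (F : fieldType) (gT : finGroupType) (T : finType).
Variable to : {action gT &-> T}.

Definition act_mx (g : gT) : 'M[F]_#|T| :=
  \matrix_(i, j) (enum_val j == to (enum_val i) g)%:R.

Lemma act_mxE m (M : 'M[F]_(#|T|, m)) g i j :
  (act_mx g *m M) i j = M (enum_rank (to (enum_val i) g)) j.
Proof.
rewrite mxE (bigD1 (enum_rank (to (enum_val i) g))) //= mxE enum_rankK eqxx mul1r.
rewrite big1 ?addr0 // => k nk; rewrite mxE; case: eqP => [e|_]; last by rewrite mul0r.
by rewrite -e enum_valK eqxx in nk.
Qed.

Lemma act_mxEr m (M : 'M[F]_(m, #|T|)) g i j :
  (M *m act_mx g) i j = M i (enum_rank (to (enum_val j) g^-1%g)).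
Proof.
rewrite mxE (bigD1 (enum_rank (to (enum_val j) g^-1%g))) //= mxE enum_rankK actKV.
rewrite eqxx mulr1 big1 ?addr0 // => k nk; rewrite mxE.
case: eqP => [e|_]; last by rewrite mulr0.
by rewrite e actK enum_valK eqxx in nk.
Qed.

Lemma act_mx_repr : mx_repr [set: gT] act_mx.
Proof.
split=> [|g h _ _]; apply/matrixP=> i j; last by rewrite act_mxE !mxE enum_rankK actM.
by rewrite !mxE act1 (inj_eq enum_val_inj) eq_sym.
Qed.

Definition act_repr := MxRepresentation act_mx_repr.

End PermutationRepresentation.

Section SpechtModule.

Variables (n : nat) (mu : intpart n).

(* A tabloid is the function sending an entry to the row that contains it. *)
Definition tabloid : finType :=
  {r : {ffun 'I_n -> 'I_n} | [forall i, #|[set x | r x == i]| == part mu i]}.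

Definition tableau : finType := {T : {ffun cell mu -> 'I_n} | injectiveb T}.

Lemma tabloid_act_subproof (r : tabloid) (g : 'S_n) :
  [forall i, #|[set x | [ffun x => val r ((g^-1)%g x)] x == i]| == part mu i].
Proof.
apply/forallP=> i; move/forallP: (valP r) => /(_ i) /eqP <-.
rewrite -(card_imset [set x | val r x == i] (@perm_inj _ g)); apply/eqP/eq_card=> x.
rewrite !inE ffunE; apply/idP/imsetP=> [h|[y]].
  by exists ((g^-1)%g x); rewrite ?inE ?permKV.
by rewrite inE => h ->; rewrite permK.
Qed.

Definition tabloid_act (r : tabloid) (g : 'S_n) : tabloid :=
  Sub [ffun x => val r ((g^-1)%g x)] (tabloid_act_subproof r g).

Lemma tabloid_act_is_action : is_action [set: 'S_n] tabloid_act.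
Proof.
split=> [g r r' /(congr1 val) /= e|r g h _ _].
  apply/val_inj/ffunP=> x; move/ffunP: e => /(_ (g x)).
  by rewrite !ffunE permK.
by apply/val_inj/ffunP=> x; rewrite /= !ffunE invMg permM.
Qed.

Definition tabloid_action := Action tabloid_act_is_action.

Definition tabloid_repr := act_repr algC tabloid_action.

Definition col_stab (T : tableau) : {set 'S_n} :=
  [set pi : 'S_n | [forall c, forall c',
     (pi (val T c) == val T c') ==> (ccol c == ccol c')]].

Definition is_tabloid_of (T : {ffun cell mu -> 'I_n}) (r : tabloid) : bool :=
  [forall c, val r (T c) == crow c].

(* Row T is the polytabloid \sum_(pi in C_T) sgn(pi) {pi T}. *)
Definition polytabloid_mx : 'M[algC]_(#|tableau|, #|tabloid|) :=
  \matrix_(T, r) \sum_(pi in col_stab (enum_val T))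
     (-1) ^+ pi * (is_tabloid_of [ffun c => pi (val (enum_val T) c)] (enum_val r))%:R.

Definition specht_mx : 'M[algC]_#|tabloid| := <<polytabloid_mx>>%MS.

Lemma tableau_act_subproof (T : tableau) (g : 'S_n) :
  injectiveb [ffun c => g (val T c)].
Proof.
apply/injectiveP=> c c'; rewrite !ffunE => /perm_inj.
by move/injectiveP: (valP T); apply.
Qed.

Definition tableau_act (T : tableau) (g : 'S_n) : tableau :=
  Sub [ffun c => g (val T c)] (tableau_act_subproof T g).

Lemma specht_module : mxmodule tabloid_repr specht_mx.
Proof.
apply/mxmoduleP=> g _; rewrite (eqmxMr _ (genmxE _)) genmxE.
apply/row_subP=> T; rewrite row_mul.
suff -> : row T polytabloid_mx *m tabloid_repr g =
          row (enum_rank (tableau_act (enum_val T) g)) polytabloid_mx by apply: row_sub.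
apply/rowP=> r; rewrite act_mxEr !mxE !enum_rankK.
rewrite [RHS](reindex_inj (conjg_inj g)) /=; apply: eq_big => [pi|pi _].
  rewrite !inE; apply: eq_forallb => c; apply: eq_forallb => c'.
  by rewrite /= !ffunE permJ (inj_eq perm_inj).
rewrite odd_permJ; congr (_ * (nat_of_bool _)%:R).
by apply: eq_forallb => c; rewrite /= !ffunE invgK permJ.
Qed.

Definition irrS : 'CF([set: 'S_n]) := cfRepr (submod_repr specht_module).

End SpechtModule.

Notation SnT n t := {dffun forall _ : 'I_t, 'S_n}.

Section ProductCharacter.

Variables (n t : nat).

Lemma irrST_subproof (mu : {ffun 'I_t -> intpart n}) :
  is_class_fun <<[set: SnT n t]>>
    [ffun g : SnT n t => \prod_(j < t) irrS (mu j) (g j)].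
Proof.
rewrite genGid; apply: intro_class_fun => [g h _ _|g]; last by rewrite inE.
apply: eq_bigr => j _.
have -> : (g ^ h)%g j = (g j ^ h j)%g by rewrite /conjg !dffunM !ffunE.
by rewrite cfunJgen // genGid inE.
Qed.

Definition irrST (mu : {ffun 'I_t -> intpart n}) : 'CF([set: SnT n t]) :=
  Cfun 0 (irrST_subproof mu).

End ProductCharacter.

Section SegreBoolean.

Variables (n t : nat).

Local Notation point := {ffun 'I_t -> {set 'I_n}}.

Definition in_B (A : point) : bool := [forall i, forall j, #|A i| == #|A j|].

Definition B_lt : rel point :=
  [rel A B : point | (A != B) && [forall j, A j \subset B j]].

Definition proper_part (A : point) : bool :=
  [&& in_B A, A != [ffun=> set0] & A != [ffun=> setT]].

Definition is_chain (c : seq point) : bool := all proper_part c && sorted B_lt c.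

(* [chain d] is the set of (d - 1)-dimensional faces of the order complex of the
   proper part; [chain 0] only contains the empty face. *)
Definition chain d : finType := {c : d.-tuple point | is_chain c}.

Definition pact (A : point) (g : SnT n t) : point := [ffun j => g j @: A j].

Lemma pact_inj g : injective (pact^~ g).
Proof.
move=> A B /ffunP e; apply/ffunP=> j; move: (e j); rewrite !ffunE.
by apply: imset_inj; apply: perm_inj.
Qed.

Lemma pact_eq g A B : (pact A g == pact B g) = (A == B).
Proof. exact: (inj_eq (@pact_inj g)). Qed.

Lemma pactM A g h : pact A (g * h)%g = pact (pact A g) h.
Proof.
apply/ffunP=> j; rewrite !ffunE -imset_comp; apply: eq_imset => x /=.
by rewrite permM.
Qed.

Lemma chain_act_subproof d (c : chain d) (g : SnT n t) :
  is_chain (map_tuple (pact^~ g) (val c)).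
Proof.
case/andP: (valP c) => pc sc; apply/andP; split.
  rewrite all_map; apply: sub_all pc => A /= /and3P[iA A0 AT]; apply/and3P; split.
  - apply/forallP=> i; apply/forallP=> j; rewrite !ffunE !card_imset; try exact: perm_inj.
    by move/forallP: iA => /(_ i) /forallP.
  - apply: contraNneq A0 => e; rewrite -(pact_eq g) e; apply/eqP/ffunP=> j.
    by rewrite !ffunE imset0.
  - apply: contraNneq AT => e; rewrite -(pact_eq g) e; apply/eqP/ffunP=> j.
    rewrite !ffunE; apply/setP=> x; rewrite inE; symmetry; apply/imsetP.
    by exists (((g j)^-1)%g x); rewrite ?inE ?permKV.
rewrite sorted_map; apply: sub_sorted sc => A B /= /andP[nAB sAB].
apply/andP; split; first by rewrite pact_eq.
apply/forallP=> j; rewrite !ffunE.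
by apply: imsetS; move/forallP: sAB.
Qed.

Definition chain_act d (c : chain d) (g : SnT n t) : chain d :=
  Sub (map_tuple (pact^~ g) (val c)) (chain_act_subproof c g).

Lemma chain_act_is_action d : is_action [set: SnT n t] (@chain_act d).
Proof.
split=> [g c c' /(congr1 val)/(congr1 val)/= e|c g h _ _].
  by apply/val_inj/val_inj; apply: (inj_map (@pact_inj g)).
do 2!apply: val_inj; rewrite /= -map_comp; apply: eq_map => A /=.
exact: pactM.
Qed.

Definition chain_action d := Action (chain_act_is_action d).

Definition chain_repr d := act_repr rat (chain_action d).

(* Entry of the simplicial boundary at c, c': the coefficient of c' in
   \sum_(i < d) (-1)^i (c with its i-th element removed). It vanishes for d = 0,
   so that the complex is the augmented one. *)
Definition incidence d (c : chain d) (c' : chain d.-1) : rat :=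
  \sum_(i < d) (-1) ^+ i *
     (val c' == take i (val c) ++ drop i.+1 (val c) :> seq point)%:R.

Definition boundary d : 'M[rat]_(#|chain d|, #|chain d.-1|) :=
  \matrix_(c, c') incidence (enum_val c) (enum_val c').

Lemma boundary_act d g :
  chain_repr d g *m boundary d = boundary d *m chain_repr d.-1 g.
Proof.
apply/matrixP=> c c'; rewrite act_mxE act_mxEr !mxE !enum_rankK.
apply: eq_bigr => i _; congr (_ * (nat_of_bool _)%:R).
rewrite /= -map_take -map_drop -map_cat.
rewrite -[RHS](inj_eq (inj_map (@pact_inj g))) -map_comp; congr (_ == _).
rewrite -[LHS]map_id; apply: eq_map => A /=.
rewrite -pactM mulVg; apply/ffunP=> j; rewrite !ffunE.
by rewrite (eq_imset _ (perm1 (T := _))) imset_id.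
Qed.

Definition cycles d : 'M[rat]_#|chain d| := kermx (boundary d).
Definition boundaries d : 'M[rat]_#|chain d| := <<boundary d.+1>>%MS.

Lemma cycles_module d : mxmodule (chain_repr d) (cycles d).
Proof.
apply/mxmoduleP=> g _; apply/sub_kermxP.
by rewrite -mulmxA boundary_act mulmxA mulmx_ker mul0mx.
Qed.

Lemma boundaries_module d : mxmodule (chain_repr d) (boundaries d).
Proof.
apply/mxmoduleP=> g _; rewrite (eqmxMr _ (genmxE _)) genmxE.
by rewrite -(boundary_act d.+1) submxMl.
Qed.

(* Reduced rational homology in degree d - 1. *)
Definition homology_repr d :=
  section_repr (boundaries_module d) (cycles_module d).

Definition homology_char d : 'CF([set: SnT n t]) :=
  cfRepr (map_repr (ratr : {rmorphism rat -> algC}) (homology_repr d)).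

Definition top_homology_char : 'CF([set: SnT n t]) := homology_char n.-1.

End SegreBoolean.

(* Series in t countable alphabets are given by their specializations to finitely
   many variables: f N is f in the first N variables of each alphabet. *)
Definition sfam t := forall N : nat, {mpoly algC[t * N]}.

HB.instance Definition _ t := boolp.gen_eqMixin (sfam t).
HB.instance Definition _ t := boolp.gen_choiceMixin (sfam t).

Section FamilyRing.

Variable t : nat.
Implicit Types f g h : sfam t.

Lemma sfamP f g : (forall N, f N = g N) -> f = g.
Proof. exact: boolp.functional_extensionality_dep. Qed.

Definition sfam_add f g : sfam t := fun N => f N + g N.
Definition sfam_opp f : sfam t := fun N => - f N.
Definition sfam_mul f g : sfam t := fun N => f N * g N.
Definition sfam_scale (a : algC) f : sfam t := fun N => a *: f N.

Lemma sfam_addA : associative sfam_add.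
Proof. by move=> f g h; apply: sfamP => N; apply: addrA. Qed.
Lemma sfam_addC : commutative sfam_add.
Proof. by move=> f g; apply: sfamP => N; apply: addrC. Qed.
Lemma sfam_add0 : left_id (fun N => 0 : {mpoly algC[t * N]}) sfam_add.
Proof. by move=> f; apply: sfamP => N; apply: add0r. Qed.
Lemma sfam_addN : left_inverse (fun N => 0 : {mpoly algC[t * N]}) sfam_opp sfam_add.
Proof. by move=> f; apply: sfamP => N; apply: addNr. Qed.

HB.instance Definition _ :=
  GRing.isZmodule.Build (sfam t) sfam_addA sfam_addC sfam_add0 sfam_addN.

Lemma sfam_mulA : associative sfam_mul.
Proof. by move=> f g h; apply: sfamP => N; apply: mulrA. Qed.
Lemma sfam_mulC : commutative sfam_mul.
Proof. by move=> f g; apply: sfamP => N; apply: mulrC. Qed.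
Lemma sfam_mul1 : left_id (fun N => 1 : {mpoly algC[t * N]}) sfam_mul.
Proof. by move=> f; apply: sfamP => N; apply: mul1r. Qed.
Lemma sfam_mulD : left_distributive sfam_mul +%R.
Proof. by move=> f g h; apply: sfamP => N; apply: mulrDl. Qed.
Lemma sfam_1neq0 : (fun N => 1 : {mpoly algC[t * N]}) != 0 :> sfam t.
Proof.
apply/eqP=> e; have : (1 : {mpoly algC[t * 0]}) = 0 by apply: (congr1 (fun f : sfam t => f 0%N) e).
by move/eqP; rewrite oner_eq0.
Qed.

HB.instance Definition _ := GRing.Zmodule_isComNzRing.Build (sfam t)
  sfam_mulA sfam_mulC sfam_mul1 sfam_mulD sfam_1neq0.

Lemma sfam_scaleA a b f : sfam_scale a (sfam_scale b f) = sfam_scale (a * b) f.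
Proof. by apply: sfamP => N; apply: scalerA. Qed.
Lemma sfam_scale1 : left_id 1 sfam_scale.
Proof. by move=> f; apply: sfamP => N; apply: scale1r. Qed.
Lemma sfam_scaleDr : right_distributive sfam_scale +%R.
Proof. by move=> a f g; apply: sfamP => N; apply: scalerDr. Qed.
Lemma sfam_scaleDl f : {morph sfam_scale^~ f : a b / a + b}.
Proof. by move=> a b; apply: sfamP => N; apply: scalerDl. Qed.

HB.instance Definition _ := GRing.Zmodule_isLmodule.Build algC (sfam t)
  sfam_scaleA sfam_scale1 sfam_scaleDr sfam_scaleDl.

Lemma sfam_scaleAl a f g : a *: (f * g) = a *: f * g.
Proof. by apply: sfamP => N; apply: scalerAl. Qed.

HB.instance Definition _ := GRing.Lmodule_isLalgebra.Build algC (sfam t) sfam_scaleAl.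
HB.instance Definition _ := GRing.Lalgebra_isComAlgebra.Build algC (sfam t).

(* The i-th variable of the j-th alphabet. *)
Definition xvar N (j : 'I_t) (i : 'I_N) : {mpoly algC[t * N]} :=
  'X_(mxvec_index j i).

Definition subst N k (M : 'M[{mpoly algC[k]}]_(t, N)) (p : {mpoly algC[t * N]}) :
    {mpoly algC[k]} :=
  p \mPo [tuple mxvec M 0 i | i < t * N].

(* [in_Lambda] cuts out Lambda(X^1) (x) .. (x) Lambda(X^t), the bounded-degree
   series symmetric in each alphabet separately; Lambda(x) is the case t = 1. *)
Record in_Lambda (f : sfam t) : Prop := InLambda {
  Lambda_sym : forall N (g : 'I_t -> 'S_N),
    subst (\matrix_(j, i) xvar j (g j i)) (f N) = f N;
  Lambda_stable : forall N,
    subst (\matrix_(j, i) oapp (xvar j) 0 (unlift ord_max i)) (f N.+1) = f N;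
  Lambda_bounded : exists d, forall N, (msize (f N) <= d)%N
}.

Definition hsym (j : 'I_t) (m : nat) : sfam t := fun N =>
  \sum_(w : 'X_{1..N < m.+1} | mdeg w == m) \prod_(i < N) xvar j i ^+ w i.

Definition hprod n (j : 'I_t) (la : intpart n) : sfam t :=
  \prod_(p <- parts la) hsym j p.

Definition schur n (j : 'I_t) (mu : intpart n) : sfam t := fun N =>
  \sum_(T : {ffun cell mu -> 'I_N} | ssyt T) \prod_c xvar j (T c).

Definition Zm (m : nat) : sfam t := \prod_(j < t) hsym j m.

Definition Zla n (la : intpart n) : sfam t := \prod_(j < t) hprod j la.

(* The irrST mu are the irreducible characters, so '[phi, irrST mu] is the
   multiplicity of the one indexed by mu in phi. *)
Definition product_frobenius n (phi : 'CF([set: SnT n t])) : sfam t :=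
  \sum_(mu : {ffun 'I_t -> intpart n})
     '[phi, irrST mu] *: \prod_(j < t) schur j (mu j).

Definition beta (n : nat) : sfam t :=
  if n is 0 then 1 else product_frobenius (top_homology_char n t).

End FamilyRing.

(* An algebra homomorphism on Lambda(x) is represented by a function on all
   families, of which only the values on Lambda(x) matter. *)
Record is_Phi t (Phi : sfam 1 -> sfam t) : Prop := IsPhi {
  Phi_in : forall f, in_Lambda f -> in_Lambda (Phi f);
  Phi1 : Phi 1 = 1;
  PhiD : forall f g, in_Lambda f -> in_Lambda g -> Phi (f + g) = Phi f + Phi g;
  PhiM : forall f g, in_Lambda f -> in_Lambda g -> Phi (f * g) = Phi f * Phi g;
  PhiZ : forall a f, in_Lambda f -> Phi (a *: f) = a *: Phi f;
  Phi_h : forall m, Phi (hsym ord0 m) = Zm t m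
}.

Definition is_transition_sh n (M : intpart n -> intpart n -> algC) : Prop :=
  forall la, schur ord0 la = \sum_(nu : intpart n) M la nu *: hprod ord0 nu :> sfam 1.

Definition cla n (la : intpart n) : algC :=
  (-1) ^+ (n - ell la) * (ell la)`!%:R / \prod_(1 <= i < n.+1) (mult la i)`!%:R.

Section FormalSeries.

Variable R : comNzRingType.

(* Formal power series in u, as coefficient sequences. *)
Definition fps_mul (a b : nat -> R) : nat -> R :=
  fun n => \sum_(k < n.+1) a k * b (n - k)%N.

Definition fps_one : nat -> R := fun n => (n == 0%N)%:R.

Definition fps_is_inverse (b a : nat -> R) : Prop :=
  fps_mul a b =1 fps_one /\ fps_mul b a =1 fps_one.

End FormalSeries.

Section JacobiTrudi.

Variables (n : nat) (la : intpart n).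

(* The shift in the numbering of i and sigma(i) cancels in la_i - i + sigma(i). *)
Definition jt_admissible (s : 'S_(ell la)) : bool :=
  [forall i : 'I_(ell la), (i <= part la i + s i)%N].

Definition jt_part (s : 'S_(ell la)) : seq nat :=
  sort geq [seq x <- [seq (part la i + s i - i)%N | i : 'I_(ell la)] | (0 < x)%N].

End JacobiTrudi.

(* Main.v *)
Require Import Defs.
From HB Require Import structures.
From mathcomp Require Import all_boot all_order all_algebra.
From mathcomp Require Import all_fingroup all_solvable all_field all_character.
From mathcomp Require Import mpoly zify ring.

Set Implicit Arguments.
Unset Strict Implicit.
Unset Printing Implicit Defensive.

Import GroupScope Order.TTheory GRing.Theory Num.Theory.
Local Open Scope ring_scope.

(* Proof idea. Write J for the matrix of signed Jacobi-Trudi coefficients, K for the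
   Kostka matrix and N for the matrix counting nonnegative integer matrices with
   prescribed margins. The Jacobi-Trudi identity s = J h gives K = J N by taking
   coefficients; N is symmetric and J, K are unitriangular for dominance, hence
   K J^T = J N J^T is the identity and h = K^T s. As N is also the Gram matrix of the
   tabloid characters, the combinations of these given by J are orthonormal, and a
   column-antisymmetrizer argument identifies them with the Specht characters: this is
   Young's rule. The proper part of B_n^(t) only has homology in the top degree, by
   induction over down-closed sets of atoms (a recursive atom ordering for the
   componentwise order on the labels); the Hopf trace formula then writes the top
   homology as an alternating sum over compositions of products of tabloid
   characters. *)

(** * Partitions and dominance *)

(** For t >= 2 and n >= 3 the poset is not a lattice: two atoms that agree in some but not all
    coordinates have several minimal upper bounds. Stars of atoms therefore meet in unions of
    smaller stars, which is why acyclicity is proved for all such unions at once, inside every upper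
    interval. It is proved for cochains, given as functions on arbitrary sequences: primitives can
    then be written by cases, and the dual statement about cycles is recovered through the cokernel
    of the boundary. Irreducibility of the Specht modules is not attacked directly. The combinations
    of tabloid characters are irreducible up to sign because they are virtual characters of norm 1;
    dominance then leaves the Specht module a single possible constituent, with multiplicity at most
    1 and, the module being nonzero, exactly 1. The symmetry of one counting matrix takes the place
    of the Cauchy identity and of the Hall inner product. *)

Section Partitions.

Variable n : nat.
Implicit Types la mu nu : intpart n.

Lemma sorted_geq_split (s : seq nat) : sorted geq s ->
  s = [seq x <- s | (0 < x)%N] ++ nseq (count_mem 0%N s) 0%N.
Proof.
elim: s => // x s IHs /= sxs.
case: (posnP x) => [x0|x_gt0]; last first.
  by rewrite {1}(IHs (path_sorted sxs)).
have s0 : s = nseq (size s) 0%N.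
  apply/all_pred1P/allP => y ys /=.
  have := sxs; rewrite path_sortedE; last by move=> a b c /= h1 h2; apply: leq_trans h2 h1.
  by case/andP=> /allP /(_ y ys); rewrite x0 /= leqn0.
by rewrite x0 s0 /= filter_nseq /= count_nseq /= mul1n.
Qed.

Lemma val_intpart la :
  map val (val la) = parts la ++ nseq (n - ell la) 0%N :> seq nat.
Proof.
case/andP: (valP la) => slas _.
rewrite {1}(sorted_geq_split slas); congr (_ ++ nseq _ _).
have := congr1 size (sorted_geq_split slas).
rewrite size_map size_tuple size_cat size_nseq -/(parts la) -/(ell la) => e.
by apply/eqP; rewrite -(eqn_add2l (ell la)) -e subnKC // {2}e leq_addr.
Qed.

Lemma parts_inj : injective (@parts n).
Proof.
move=> la mu e; do 2!apply/val_inj; apply: (inj_map val_inj).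
by rewrite !val_intpart /ell e.
Qed.

Lemma parts_sorted la : sorted geq (parts la).
Proof.
case/andP: (valP la) => slas _; apply: sorted_filter slas.
by move=> a b c /= h1 h2; apply: leq_trans h2 h1.
Qed.

Lemma parts_gt0 la : all (leq 1) (parts la).
Proof. exact: filter_all. Qed.

Lemma sumn_parts la : sumn (parts la) = n.
Proof.
case/andP: (valP la) => _ /eqP e; rewrite -[RHS]e.
by rewrite val_intpart sumn_cat sumn_nseq mul0n addn0.
Qed.

Lemma size_sumn (s : seq nat) : all (leq 1) s -> (size s <= sumn s)%N.
Proof. by elim: s => //= x s IHs /andP[x0 /IHs]; lia. Qed.

Lemma ell_le la : (ell la <= n)%N.
Proof. by have := size_sumn (parts_gt0 la); rewrite sumn_parts. Qed.

Lemma nth_leq_sumn (s : seq nat) i : (nth 0%N s i <= sumn s)%N.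
Proof. by elim: s i => [|x s IHs] [|i] //=; [lia | have := IHs i; lia]. Qed.

Lemma intpart_exists (s : seq nat) : sorted geq s -> all (leq 1) s -> sumn s = n ->
  {la : intpart n | parts la = s}.
Proof.
move=> ss s0 sn.
have szs : (size s <= n)%N by rewrite -sn size_sumn.
pose p := [tuple inord (nth 0%N s i) : 'I_n.+1 | i < n].
have vp : map val p = s ++ nseq (n - size s) 0%N.
  rewrite /= -map_comp; apply: (@eq_from_nth _ 0%N).
    by rewrite size_map size_enum_ord size_cat size_nseq subnKC.
  move=> i; rewrite size_map size_enum_ord => ltin.
  rewrite (nth_map (Ordinal ltin)) ?size_enum_ord //= nth_enum_ord // inordK.
    by rewrite nth_cat; case: ltnP => // h; rewrite nth_nseq if_same nth_default.
  by rewrite ltnS -sn nth_leq_sumn.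
have isp : is_intpart p.
  rewrite /is_intpart vp sumn_cat sumn_nseq mul0n addn0 sn eqxx andbT.
  have tr : transitive geq by move=> a b c /= h1 h2; apply: leq_trans h2 h1.
  rewrite sorted_pairwise // pairwise_cat -!sorted_pairwise // ss /=.
  apply/andP; split; first by apply/allrelP=> x y _ /nseqP[-> _].
  by elim: (n - size s)%N => // k; case: k.
exists (Sub p isp); rewrite /parts SubK vp filter_cat.
rewrite filter_nseq /= cats0; apply/all_filterP.
by apply: sub_all s0.
Qed.

Lemma part_default la i : (ell la <= i)%N -> part la i = 0%N.
Proof. exact: nth_default. Qed.

Lemma part_gt0 la i : (0 < part la i)%N = (i < ell la)%N.
Proof.
case: (ltnP i (ell la)) => h; last by rewrite part_default.
apply: (allP (parts_gt0 la)).
exact: mem_nth.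
Qed.

Lemma part_le la i : (part la i <= n)%N.
Proof. by have := nth_leq_sumn (parts la) i; rewrite sumn_parts. Qed.

Lemma part_anti la i j : (i <= j)%N -> (part la j <= part la i)%N.
Proof.
move=> lij; case: (ltnP j (ell la)) => [jl|jl]; last by rewrite part_default.
have tr : transitive geq by move=> a b c /= h1 h2; apply: leq_trans h2 h1.
have re : reflexive geq by move=> a /=.
exact: (sorted_leq_nth tr re 0%N (parts_sorted la)) (leq_ltn_trans lij jl) jl lij.
Qed.

Lemma part_inj la mu : (forall i, (i < n)%N -> part la i = part mu i) -> la = mu.
Proof.
move=> e.
have e' i : part la i = part mu i.
  by case: (ltnP i n) => [/e //|h]; rewrite !part_default ?(leq_trans (ell_le _) h).
have el : ell la = ell mu.
  apply/eqP; rewrite eqn_leq; apply/andP; split; rewrite leqNgt -part_gt0.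
    by rewrite e' part_default.
  by rewrite -e' part_default.
by apply/parts_inj/(@eq_from_nth _ 0%N) => // i _; apply: e'.
Qed.

Definition psum la k := (\sum_(i < k) part la i)%N.

Lemma psumE la k : (ell la <= k)%N -> psum la k = n.
Proof.
move=> h; rewrite -[RHS](sumn_parts la) sumnE (big_nth 0%N) big_mkord /psum.
rewrite (big_ord_widen_cond _ xpredT (fun i => nth 0 (parts la) i)%N h).
rewrite [RHS]big_mkcond /=; apply: eq_bigr => i _; case: ltnP => // h'.
by rewrite part_default.
Qed.

Definition dom mu nu := forall k, (psum nu k <= psum mu k)%N.

Lemma dom_anti mu nu : dom mu nu -> dom nu mu -> mu = nu.
Proof.
move=> h1 h2; apply: part_inj => i _.
have e k : psum mu k = psum nu k by apply/eqP; rewrite eqn_leq h1 h2.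
by have := e i.+1; rewrite /psum !big_ord_recr /= -!/(psum _ _) e => /addnI.
Qed.

Lemma dom_trans mu nu la : dom mu nu -> dom nu la -> dom mu la.
Proof. by move=> h1 h2 k; apply: leq_trans (h2 k) (h1 k). Qed.

(** * Cells and Kostka numbers *)

Lemma card_ord_lt m k : #|[set i : 'I_m | (i < k)%N]| = minn m k.
Proof.
have -> : minn m k = (\sum_(i < minn m k) 1)%N by rewrite sum1_card card_ord.
rewrite -sum1_card (big_ord_widen m (fun=> 1%N) (geq_minl m k)).
by apply: eq_bigl => i; rewrite inE leq_min ltn_ord.
Qed.

Lemma card_cells mu (P : pred 'I_n) :
  #|[set c : cell mu | P (crow c)]| = (\sum_(i | P i) part mu i)%N.
Proof.
rewrite cardsE -sum1_card.
rewrite -(big_sub_cond [pred c : 'I_n * 'I_n | (c.2 < part mu c.1)%N] (fun c => P c.1) (fun=> 1%N)).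
rewrite (eq_bigl (fun c : 'I_n * 'I_n => P c.1 && (c.2 < part mu c.1)%N)); last by move=> c; rewrite inE andbC.
rewrite -(pair_big_dep P (fun i j : 'I_n => (j < part mu i)%N) (fun _ _ => 1%N)) /=.
apply: eq_bigr => i Pi.
have := card_ord_lt n (part mu i); rewrite -sum1_card (minn_idPr (part_le _ _)) => h.
by rewrite -[RHS]h; apply: eq_bigl => j; rewrite inE.
Qed.

Lemma card_cells_lt mu k : #|[set c : cell mu | (crow c < k)%N]| = psum mu k.
Proof.
rewrite (card_cells mu (fun i => (i < k)%N)) /psum.
case: (leqP k n) => h; first by rewrite (big_ord_widen n (fun i => part mu i) h).
rewrite -/(psum mu k) psumE; last by rewrite (leq_trans (ell_le _)) // ltnW.
rewrite -[RHS](psumE (ell_le mu)); apply: eq_bigl => i.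
by rewrite (ltn_trans (ltn_ord i) h).
Qed.

Lemma card_cell mu : #|{: cell mu}| = n.
Proof.
rewrite -[RHS](psumE (ell_le mu)) -card_cells_lt -cardsT; apply: eq_card => c.
by rewrite !inE ltn_ord.
Qed.

Lemma cell_up mu (i j : 'I_n) (c : cell mu) :
  (i <= crow c)%N -> (j <= ccol c)%N -> {c' : cell mu | crow c' = i & ccol c' = j}.
Proof.
move=> hi hj; have h : (j < part mu i)%N.
  by apply: leq_ltn_trans hj (leq_trans (valP c) (part_anti mu hi)).
by exists (exist _ (i, j) h).
Qed.

Lemma cell_inj mu (c c' : cell mu) : crow c = crow c' -> ccol c = ccol c' -> c = c'.
Proof.
move=> h1 h2; apply/val_inj; move: h1 h2; rewrite /crow /ccol.
by case: (val c) (val c') => a b [a' b'] /= -> ->.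
Qed.

Lemma ssyt_colP mu b (T : {ffun cell mu -> 'I_b}) c c' : ssyt T ->
  ccol c = ccol c' -> (crow c < crow c')%N -> (T c < T c')%N.
Proof.
by move=> /forallP/(_ c)/forallP/(_ c')/andP[_ /implyP h] e h'; apply: h; rewrite e eqxx.
Qed.

(** Entries start at 0 and strictly increase down a column; [cell_up] supplies the cell just above
    any cell outside the top row. *)
Lemma ssyt_ge_row mu b (T : {ffun cell mu -> 'I_b}) c : ssyt T -> (crow c <= T c)%N.
Proof.
move=> sT; have [k] := ubnP (val (crow c)); elim: k c => // k IHk c hk.
case e: (val (crow c)) => [//|i].
have hi : (i < n)%N by rewrite (ltn_trans _ (ltn_ord (crow c))) // e.
have [||c' r' k'] := @cell_up mu (Ordinal hi) (ccol c) c; rewrite //= ?e //.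
apply: leq_ltn_trans (ssyt_colP sT k' _); last by rewrite r' e /=.
by have := IHk c'; rewrite r' /=; apply; rewrite e ltnS in hk.
Qed.

Lemma content_psum mu nu (T : {ffun cell mu -> 'I_(size (parts nu))}) k :
  [forall i, #|[set c | T c == i]| == nth 0%N (parts nu) i] ->
  #|[set c | (T c < k)%N]| = psum nu k.
Proof.
move=> /forallP ct.
have -> : #|[set c | (T c < k)%N]| =
    (\sum_(i < size (parts nu) | (i < k)%N) #|[set c | T c == i]|)%N.
  rewrite -sum1_card (partition_big (fun c => T c) (fun i => (i < k)%N)) /=; last first.
    by move=> c; rewrite inE.
  apply: eq_bigr => i hi; rewrite -sum1_card; apply: eq_bigl => c; rewrite !inE.
  by case: eqP => [->|]; rewrite ?hi ?andbF.
under eq_bigr => i _ do rewrite (eqP (ct i)) -/(part nu i).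
rewrite /psum; case: (leqP k (ell nu)) => h.
  by rewrite (big_ord_widen (ell nu) (fun i => part nu i) h).
rewrite -[RHS]/(psum nu k) (psumE (ltnW h)) -[RHS](psumE (leqnn (ell nu))).
by apply: eq_bigl => i; rewrite (ltn_trans _ h).
Qed.

(** By [ssyt_ge_row], the entries less than k all lie in the first k rows. *)
Lemma kostka_dom mu nu : kostka mu (parts nu) != 0%N -> dom mu nu.
Proof.
rewrite -lt0n => /card_gt0P[T]; rewrite inE => /andP[sT ct] k.
rewrite -(content_psum k ct) -card_cells_lt; apply/subset_leq_card/subsetP => c.
by rewrite !inE; apply: leq_ltn_trans (ssyt_ge_row c sT).
Qed.

Lemma crow_lt_ell mu (c : cell mu) : (crow c < ell mu)%N.
Proof. by rewrite -part_gt0 (leq_ltn_trans _ (valP c)). Qed.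

(** When shape and content agree, the inclusion behind [kostka_dom] is between sets of equal size:
    the entries less than k fill the first k rows exactly, so every entry is its row index. *)
Lemma kostka_diag mu : kostka mu (parts mu) = 1%N.
Proof.
apply/eqP/cards1P; exists [ffun c => Ordinal (crow_lt_ell c)]; apply/setP=> T.
rewrite !inE; apply/andP/eqP => [[sT ct]|->].
  apply/ffunP=> c; rewrite ffunE; apply/val_inj => /=.
  have := content_psum (crow c).+1 ct; rewrite -card_cells_lt => e.
  have /eqP/setP/(_ c) : [set c0 : cell mu | (T c0 < (crow c).+1)%N] ==
              [set c0 | (crow c0 < (crow c).+1)%N].
    rewrite eqEcard -e leqnn andbT; apply/subsetP=> c'; rewrite !inE.
    exact: leq_ltn_trans (ssyt_ge_row c' sT).
  rewrite !inE ltnSn => h; apply/eqP; rewrite eqn_leq (ssyt_ge_row c sT) andbT.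
  by rewrite -ltnS h.
split.
  apply/forallP=> c; apply/forallP=> c'; rewrite !ffunE /=.
  by apply/andP; split; apply/implyP => /andP[/eqP e h] //; rewrite e.
apply/forallP=> i.
have hi : (i < n)%N := leq_trans (ltn_ord i) (ell_le mu).
have := card_cells mu (pred1 (Ordinal hi)); rewrite big_pred1_eq /part /= => <-.
apply/eqP/eq_card => c; rewrite !inE ffunE /=.
by rewrite -val_eqE /= -val_eqE.
Qed.

End Partitions.

(** * Complete homogeneous polynomials *)

Section CompleteHomogeneous.

Variable R : comNzRingType.

(** [hsym] at arbitrary elements of any commutative ring, so that one Jacobi-Trudi identity serves
    both [{mpoly int[n]}], where coefficients are read off, and the alphabets of [sfam]. *)
Definition hc N (x : 'I_N -> R) (m : nat) : R :=
  \sum_(w : 'X_{1..N < m.+1} | mdeg w == m) \prod_(i < N) x i ^+ w i.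

(** A bound [B] independent of m puts the exponent vectors of all degrees up to [B] into one finite
    type, as the expansions of products of sums require. *)
Lemma hc_ffun N (x : 'I_N -> R) m B : (m <= B)%N ->
  hc x m = \sum_(f : {ffun 'I_N -> 'I_B.+1} | (\sum_i f i)%N == m) \prod_i x i ^+ f i.
Proof.
move=> lemB; rewrite /hc.
pose h (w : 'X_{1..N < m.+1}) : {ffun 'I_N -> 'I_B.+1} := [ffun i => inord (w i)].
pose h' (f : {ffun 'I_N -> 'I_B.+1}) : option 'X_{1..N < m.+1} :=
  insub [multinom (f i : nat) | i < N].
have hE w i : h w i = w i :> nat.
  rewrite ffunE inordK // ltnS (leq_trans _ lemB) // -ltnS (leq_ltn_trans _ (valP w)) //.
  by rewrite mdegE (bigD1 i) //= leq_addr.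
rewrite [RHS](reindex_omap h h') => [|f /eqP Pf].
  apply: eq_big => [w|w _]; last by apply: eq_bigr => i _; rewrite hE.
  have -> : h' (h w) = Some w.
    rewrite -[RHS]valK /h'; congr insub; apply/mnmP=> i.
    by rewrite mnmE hE.
  rewrite eqxx andbT mdegE; congr (_ == _); apply: eq_bigr => i _.
  by rewrite hE.
rewrite /h' insubT => [|H] /=; first by rewrite mdegE; under eq_bigr do rewrite mnmE; rewrite Pf.
congr Some; apply/ffunP=> i; apply/val_inj; rewrite /= hE /=.
by rewrite mnmE.
Qed.

(** The product of the geometric series 1/(1 - x_i X), each truncated at degree [B]; up to that
    degree it is the generating function of the complete homogeneous polynomials. *)
Definition hpol B N (x : 'I_N -> R) : {poly R} :=
  \prod_(i < N) \sum_(k < B.+1) x i ^+ k *: 'X^k.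

Lemma coef_hpol B N (x : 'I_N -> R) m : (m <= B)%N -> (hpol B x)`_m = hc x m.
Proof.
move=> lemB; rewrite (hc_ffun x lemB) /hpol bigA_distr_bigA coef_sum /= [RHS]big_mkcond /=.
apply: eq_bigr => f _; rewrite scaler_prod prodrXr coefZ coefXn eq_sym.
by case: ifP => // _; rewrite ?mulr1 ?mulr0.
Qed.

Lemma hc0 N (x : 'I_N -> R) : hc x 0 = 1.
Proof.
rewrite (hc_ffun x (leqnn 0)) (big_pred1 [ffun=> ord0]) => [|f].
  by rewrite big1 // => i _; rewrite ffunE expr0.
rewrite sum_nat_eq0; apply/forallP/eqP => [h|-> i]; last by rewrite ffunE.
by apply/ffunP=> i; rewrite ffunE; apply/val_inj/eqP/h.
Qed.

Lemma hc_nil (x : 'I_0 -> R) m : hc x m = (m == 0%N)%:R.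
Proof. by rewrite -(coef_hpol x (leqnn m)) /hpol big_ord0 coef1. Qed.

Lemma hc_recr N (x : 'I_N.+1 -> R) m :
  hc x m = \sum_(k < m.+1) x ord_max ^+ k * hc (fun i : 'I_N => x (widen_ord (leqnSn N) i)) (m - k).
Proof.
rewrite -(coef_hpol x (leqnn m)) /hpol big_ord_recr /= mulrC coefM.
apply: eq_bigr => k _; rewrite -/(hpol m (fun i => x (widen_ord (leqnSn N) i))).
rewrite coef_hpol ?leq_subr //; congr (_ * _).
rewrite coef_sum (bigD1 k) //= coefZ coefXn eqxx mulr1 big1 ?addr0 // => l ne.
by rewrite coefZ coefXn eq_sym (inj_eq val_inj) (negPf ne) mulr0.
Qed.

Lemma hc_perm N (x : 'I_N -> R) (g : 'S_N) m : hc (fun i => x (g i)) m = hc x m.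
Proof.
rewrite -!(coef_hpol _ (leqnn m)) /hpol.
by rewrite [in RHS](reindex_inj (@perm_inj _ g)).
Qed.

Lemma eq_hc N (x y : 'I_N -> R) m : x =1 y -> hc x m = hc y m.
Proof.
by move=> e; apply: eq_bigr => w _; apply: eq_bigr => i _; rewrite e.
Qed.

End CompleteHomogeneous.

Lemma rmorph_hc (R S : comNzRingType) (f : {rmorphism R -> S}) N (x : 'I_N -> R) m :
  f (hc x m) = hc (fun i => f (x i)) m.
Proof.
rewrite rmorph_sum; apply: eq_bigr => w _; rewrite rmorph_prod.
by apply: eq_bigr => i _; rewrite rmorphXn.
Qed.

(** * The Jacobi-Trudi identity *)

Section JacobiTrudiDeterminant.

Variables (R : comNzRingType) (x : nat -> R).

(** The index la_i - i + j of a Jacobi-Trudi entry can be negative, hence the integer argument. With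
    value 0 at negative indices, the recurrence [hzS] holds at every integer. *)
Definition hz N (z : int) : R :=
  if z is Posz m then hc (fun i : 'I_N => x i) m else 0.

Lemma hzS N z : hz N.+1 z = hz N z + x N * hz N.+1 (z - 1).
Proof.
case: z => [[|m]|m].
- by rewrite sub0r /= !hc0 mulr0 addr0.
- have -> : m.+1%:Z - 1 = m%:Z by rewrite -addn1 PoszD addrK.
  rewrite /= [LHS]hc_recr big_ord_recl expr0 mul1r subn0 /=; congr (_ + _).
  rewrite [in RHS]hc_recr big_distrr /=; apply: eq_bigr => k _.
  by rewrite /bump /= add1n subSS exprS mulrA.
- have -> : Negz m - 1 = Negz m.+1 by rewrite !NegzE; lia.
  by rewrite /= mulr0 addr0.
Qed.

(** [hzS] writes each term in N variables as a difference of terms in N + 1 variables, and the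
    weights x_N^(b - p) make the sum telescope. The two surviving terms are those of the row
    operation in [det_branch]. *)
Lemma hz_telescope N (a b : nat) (c : int) : (a <= b)%N ->
  \sum_(a <= p < b.+1) x N ^+ (b - p) * hz N (p%:Z + c) =
  hz N.+1 (b%:Z + c) - x N ^+ (b - a).+1 * hz N.+1 (a%:Z - 1 + c).
Proof.
elim: b => [|b IHb].
  rewrite leqn0 => /eqP ->; rewrite big_nat1 subnn expr0 mul1r hzS expr1.
  by rewrite [_ - 1 + c]addrAC addrK.
rewrite leq_eqVlt => /orP[/eqP <-|]; last rewrite ltnS => leab.
  rewrite big_nat1 subnn expr0 mul1r hzS expr1.
  by rewrite [_ - 1 + c]addrAC addrK.
rewrite big_nat_recr /=; last exact: leqW.
rewrite subnn expr0 mul1r (eq_big_nat _ _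
   (F2 := fun p => x N * (x N ^+ (b - p) * hz N (p%:Z + c)))); last first.
  by move=> p /andP[_ hp]; rewrite subSn // exprS mulrA.
rewrite -big_distrr IHb //= mulrBr [in RHS]hzS subSn // [in RHS]exprS.
have -> : b.+1%:Z + c - 1 = b%:Z + c by rewrite -addn1 PoszD addrAC addrK.
by rewrite -[in RHS]mulrA; ring.
Qed.

Definition jtmx N r (la : nat -> nat) : 'M[R]_r :=
  \matrix_(i, j) hz N ((la i)%:Z - i%:Z + j%:Z).

Definition ext r b (mu : {ffun 'I_r -> 'I_b.+1}) (k : nat) : nat :=
  oapp (fun i => val (mu i)) 0%N (insub k).

Lemma extE r b (mu : {ffun 'I_r -> 'I_b.+1}) (i : 'I_r) : ext mu i = mu i.
Proof. by rewrite /ext valK. Qed.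

Lemma ext_default r b (mu : {ffun 'I_r -> 'I_b.+1}) k : (r <= k)%N -> ext mu k = 0%N.
Proof. by move=> h; rewrite /ext insubF //; apply/negbTE; rewrite -leqNgt. Qed.

(** The skew shape la/mu is a horizontal strip, the region that the largest entry can occupy in a
    semistandard tableau. *)
Definition interlace r b (la : nat -> nat) (mu : {ffun 'I_r -> 'I_b.+1}) : bool :=
  [forall i : 'I_r, la i.+1 <= mu i <= la i]%N.

(* Subtracting x^(la_i - la_(i+1) + 1) times row i + 1 from row i truncates the
   expansion of h_m(x_0, .., x_N) in powers of x_N to the interlacing range. *)
Lemma det_branch N r b (la : nat -> nat) :
    (forall i, la i.+1 <= la i)%N -> la r = 0%N -> (forall i, la i <= b)%N ->
  \det (jtmx N.+1 r la) =
  \sum_(mu : {ffun 'I_r -> 'I_b.+1} | interlace la mu)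
     (\prod_(i < r) x N ^+ (la i - mu i)) * \det (jtmx N r (ext mu)).
Proof.
move=> la_anti la_r la_b.
pose U : 'M[R]_r := \matrix_(i, k) ((k == i)%:R
   - x N ^+ (la i - la i.+1).+1 * (k == i.+1 :> nat)%:R).
pose H' : 'M[R]_r := \matrix_(i, j)
   \sum_(p < b.+1 | (la i.+1 <= p <= la i)%N) x N ^+ (la i - p) * hz N (p%:Z - i%:Z + j%:Z).
have UH : U *m jtmx N.+1 r la = H'.
  apply/matrixP=> i j; rewrite !mxE.
  have -> : \sum_(p < b.+1 | (la i.+1 <= p <= la i)%N)
       x N ^+ (la i - p) * hz N (p%:Z - i%:Z + j%:Z) =
     \sum_(la i.+1 <= p < (la i).+1) x N ^+ (la i - p) * hz N (p%:Z + (j%:Z - i%:Z)).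
    rewrite -(big_mkord (fun p => la i.+1 <= p <= la i)%N
       (fun p => x N ^+ (la i - p) * hz N (p%:Z - i%:Z + j%:Z))).
    rewrite [RHS](big_nat_widen _ _ b.+1) //; last by rewrite ltnS.
    rewrite [RHS](big_nat_widenl _ 0) //.
    by apply: eq_big => [p|p _]; rewrite /= ?ltnS 1?andbC // addrAC addrA.
  rewrite hz_telescope //.
  under eq_bigr => k _ do rewrite !mxE mulrBl -mulrA.
  rewrite sumrB (bigD1 i) //= eqxx mul1r big1 ?addr0 => [|k /negPf ->]; last by rewrite mul0r.
  rewrite -big_distrr /=; congr (_ - _ * _); first by rewrite addrAC addrA.
  case: (ltnP i.+1 r) => hi; last first.
    rewrite big1 => [|k _]; last first.
      by rewrite (ltn_eqF (leq_trans (ltn_ord k) hi)) mul0r.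
    have -> : i.+1 = r by apply/eqP; rewrite eqn_leq hi ltn_ord.
    (* The last row has no row below it to subtract; its boundary term vanishes by itself because la
       r = 0 makes the index negative. *)
    rewrite la_r.
    have -> : 0%:Z - 1 + (j%:Z - i%:Z) = Negz (i - j).
      by have := ltn_ord j; rewrite NegzE; lia.
    by [].
  rewrite (bigD1 (Ordinal hi)) //= eqxx mul1r big1 ?addr0 => [|k].
    by congr hz; lia.
  by rewrite -val_eqE => /negPf /= ->; rewrite mul0r.
have detU : \det U = 1.
  rewrite -det_tr det_trig ?big1 // => [i _|].
    by rewrite !mxE eqxx (ltn_eqF (ltnSn i)) mulr0 subr0.
  apply/is_trig_mxP=> i j lij; rewrite !mxE -val_eqE (ltn_eqF lij).
  by rewrite (ltn_eqF (ltnW lij : (i < j.+1)%N)) mulr0 subr0.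
have -> : \det (jtmx N.+1 r la) = \det H' by rewrite -UH det_mulmx detU mul1r.
rewrite /determinant.
under eq_bigr => s _.
  rewrite (eq_bigr (fun i : 'I_r => \sum_(p < b.+1 | (la i.+1 <= p <= la i)%N)
      x N ^+ (la i - p) * hz N (p%:Z - i%:Z + (s i)%:Z))); last by move=> i _; rewrite mxE.
  rewrite (bigA_distr_big_dep (fun (i : 'I_r) (p : 'I_b.+1) => (la i.+1 <= p <= la i)%N)) big_distrr /=.
  over.
rewrite exchange_big /=; apply: eq_big => [mu|mu _].
  by apply/familyP/forallP => h i; have := h i; rewrite unfold_in.
rewrite big_distrr /=; apply: eq_bigr => s _; rewrite mulrCA big_split /=; congr (_ * (_ * _)).
by apply: eq_bigr => i _; rewrite mxE extE.
Qed.

End JacobiTrudiDeterminant.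

(** * The branching rule for semistandard tableaux *)

Section SemistandardBranching.

Variables (R : comNzRingType) (x : nat -> R) (n b : nat).

(** Removing a horizontal strip changes the size of a partition, so the recursion runs over shapes
    given as functions inside a fixed n by b box. For the shape [part la] and b = n these are
    definitionally the cells of [la]. *)
Definition gcell (la : nat -> nat) : finType := {c : 'I_n * 'I_b | (c.2 < la c.1)%N}.

Definition gssyt la N (T : {ffun gcell la -> 'I_N}) : bool :=
  [forall c : gcell la, forall c' : gcell la,
     (((val c).1 == (val c').1) && ((val c).2 < (val c').2)%N ==> (T c <= T c')%N) &&
     (((val c).2 == (val c').2) && ((val c).1 < (val c').1)%N ==> (T c < T c')%N)].

Definition gschur N la : R :=
  \sum_(T : {ffun gcell la -> 'I_N} | gssyt T) \prod_(c : gcell la) x (T c).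

Lemma down_closed_initial (d : pred nat) m :
    (forall j k, (j <= k)%N -> d k -> d j) -> (forall j, d j -> (j < m)%N) ->
  exists2 k, (k <= m)%N & forall j, d j = (j < k)%N.
Proof.
elim: m => [|m IHm] dd db; first by exists 0%N => // j; apply/negbTE/negP => /db.
have [dm|ndm] := boolP (d m).
  exists m.+1 => // j; apply/idP/idP => [/db //|]; rewrite ltnS => h; exact: dd h dm.
have [//|j dj|k lek kE] := IHm.
  by have := db j dj; rewrite ltnS leq_eqVlt => /orP[/eqP e|//]; rewrite -e dj in ndm.
by exists k => //; apply: leqW.
Qed.

Definition compat la N r (T : {ffun gcell la -> 'I_N.+1}) (mu : {ffun 'I_r -> 'I_b.+1}) :=
  [forall c : gcell la, (T c < N)%N == ((val c).2 < ext mu (val c).1)%N].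

Variables (r : nat) (la : nat -> nat).
Hypothesis (le_rn : (r <= n)%N) (la_anti : forall i, (la i.+1 <= la i)%N).
Hypothesis (la_r : forall i, (r <= i)%N -> la i = 0%N) (la_b : forall i, (la i <= b)%N).

Let la_mono i j : (i <= j)%N -> (la j <= la i)%N.
Proof. by move=> /subnK <-; elim: (j - i)%N => // k; apply: leq_trans (la_anti _). Qed.

Let gcell_at i j : (j < la i)%N -> {c : gcell la | val (val c).1 = i & val (val c).2 = j}.
Proof.
move=> h; have hi : (i < n)%N.
  by rewrite ltnNge; apply/negP => h'; move: h; rewrite la_r // (leq_trans le_rn).
have hj : (j < b)%N := leq_trans h (la_b i).
by exists (exist (fun c : 'I_n * 'I_b => (c.2 < la c.1)%N) (Ordinal hi, Ordinal hj) h).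
Qed.

Let gcell_inj (c c' : gcell la) :
  (val c).1 = (val c').1 :> nat -> (val c).2 = (val c').2 :> nat -> c = c'.
Proof.
move=> h1 h2; apply/val_inj; move: h1 h2.
by case: (val c) (val c') => u v [u' v'] /= /val_inj -> /val_inj ->.
Qed.

(** Weakly increasing rows make the entries less than N an initial segment of each row, whose length
    is then forced. Strictly increasing columns leave at most one entry N in a column, which is the
    interlacing condition. *)
Lemma compat_unique N (T : {ffun gcell la -> 'I_N.+1}) : gssyt T ->
  exists mu0 : {ffun 'I_r -> 'I_b.+1},
    forall mu, interlace la mu && compat T mu = (mu == mu0).
Proof.
move=> sT.
have row (c c' : gcell la) : (val c).1 = (val c').1 :> nat ->
    ((val c).2 <= (val c').2)%N -> (T c <= T c')%N.
  move=> e; rewrite leq_eqVlt => /orP[/eqP h|h]; first by rewrite (gcell_inj e h).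
  by have /forallP/(_ c)/forallP/(_ c')/andP[/implyP h' _] := sT; apply: h'; rewrite h andbT -val_eqE /= e.
have col (c c' : gcell la) : (val c).2 = (val c').2 :> nat ->
    ((val c).1 < (val c').1)%N -> (T c < T c')%N.
  move=> e h; have /forallP/(_ c)/forallP/(_ c')/andP[_ /implyP h'] := sT.
  by apply: h'; rewrite h andbT -val_eqE /= e.
pose d i j := [exists c : gcell la, [&& val (val c).1 == i, val (val c).2 == j & (T c < N)%N]].
have dP i : exists k : 'I_b.+1, forall j, d i j = (j < k)%N.
  have [j k lejk /existsP[c /and3P[/eqP ci /eqP cj hT]]|j|k lek kE] := @down_closed_initial (d i) b.
  - have [|c' ci' cj'] := @gcell_at i j.
      by rewrite -ci (leq_ltn_trans lejk) // -cj (valP c).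
    apply/existsP; exists c'; rewrite ci' cj' !eqxx /= (leq_ltn_trans _ hT) //.
    by apply: row; rewrite ?ci' ?cj' ?ci ?cj.
  - by case/existsP=> c /and3P[_ /eqP <- _]; apply: ltn_ord.
  by exists (Ordinal (lek : (k < b.+1)%N)).
have [f fE] := fin_all_exists (fun i : 'I_r => dP i).
have dE (c : gcell la) : d (val c).1 (val c).2 = (T c < N)%N.
  apply/existsP/idP => [[c' /and3P[/eqP e1 /eqP e2]]|h]; last by exists c; rewrite !eqxx.
  by rewrite (gcell_inj e1 e2).
have crow_r (c : gcell la) : ((val c).1 < r)%N.
  by rewrite ltnNge; apply/negP => /la_r h; have := valP c; rewrite /= h.
exists [ffun i => f i] => mu; apply/andP/eqP => [[/forallP im /forallP cm]|->].
  apply/ffunP=> i; rewrite ffunE; apply/val_inj/eqP; rewrite eqn_leq.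
  have /andP[_ lemu] := im i.
  apply/andP; split; rewrite leqNgt; apply/negP => h.
    have [c ci cj] := gcell_at (leq_trans h lemu).
    have := cm c; rewrite -dE ci cj extE h fE ltnn.
    by [].
  have := fE i (mu i); rewrite h => /existsP[c /and3P[/eqP ci /eqP cj hT]].
  by have := cm c; rewrite hT ci cj extE ltnn.
split; last first.
  apply/forallP=> c; rewrite -dE.
  by have := extE [ffun i => f i] (Ordinal (crow_r c)); rewrite /= => ->; rewrite ffunE -fE.
apply/forallP=> i; rewrite ffunE; apply/andP; split; last first.
  rewrite leqNgt; apply/negP=> h; have := fE i (la i); rewrite h => /existsP[c /and3P[/eqP ci /eqP cj _]].
  by have := valP c; rewrite /= ci cj ltnn.
rewrite leqNgt; apply/negP=> h; have [c ci cj] := gcell_at h.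
have := fE i (f i); rewrite ltnn => /existsP; apply.
have [|c' ci' cj'] := @gcell_at i (f i); first exact: leq_trans h (la_anti i).
exists c'; rewrite ci' cj' !eqxx /=.
have ltT : (T c' < T c)%N by apply: col; rewrite ?cj' ?ci' ?ci ?cj.
by apply: leq_trans ltT _; rewrite -ltnS ltn_ord.
Qed.

(** Filling the strip la/mu with N is a bijection from the tableaux of shape mu with entries less
    than N; interlacing is what keeps the result semistandard, and each cell of the strip
    contributes a factor x_N. *)
Lemma gschur_fiber N (mu : {ffun 'I_r -> 'I_b.+1}) : interlace la mu ->
  \sum_(T : {ffun gcell la -> 'I_N.+1} | gssyt T && compat T mu) \prod_c x (T c) =
  (\prod_(i < r) x N ^+ (la i - mu i)) * gschur N (ext mu).
Proof.
move=> im.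
have mu_le i : (ext mu i <= la i)%N.
  case: (ltnP i r) => h; last by rewrite ext_default.
  by have := extE mu (Ordinal h); rewrite /= => ->; have /forallP/(_ (Ordinal h))/andP[] := im.
have la_mu i j : (i < j)%N -> (la j <= ext mu i)%N.
  move=> ltij; case: (ltnP i r) => h; last first.
    by rewrite la_r // (leq_trans h) // ltnW.
  have := extE mu (Ordinal h); rewrite /= => ->; have /forallP/(_ (Ordinal h))/andP[/= h' _] := im.
  exact: leq_trans (la_mono ltij) h'.
have inj_sub (c : gcell (ext mu)) : ((val c).2 < la (val c).1)%N := leq_trans (valP c) (mu_le _).
pose io (c : gcell (ext mu)) : gcell la := exist _ (val c) (inj_sub c).
pose h (T : {ffun gcell (ext mu) -> 'I_N}) : {ffun gcell la -> 'I_N.+1} :=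
  [ffun c => if (insub (val c) : option (gcell (ext mu))) is Some c'
             then widen_ord (leqnSn N) (T c') else ord_max].
have hE1 T (c : gcell la) (H : ((val c).2 < ext mu (val c).1)%N) :
    h T c = widen_ord (leqnSn N) (T (exist _ (val c) H)).
  by rewrite ffunE insubT.
have hE2 T (c : gcell la) : ~~ ((val c).2 < ext mu (val c).1)%N -> h T c = ord_max.
  by move=> H; rewrite ffunE insubF //; apply: negbTE.
have h_inj : injective h.
  move=> T T' e; apply/ffunP=> c; have := congr1 (fun f : {ffun _ -> _} => val (f (io c))) e.
  rewrite !(hE1 _ (io c) (valP c)) /= => e'; apply/val_inj.
  by move: e'; rewrite (_ : exist _ _ _ = c) //; apply: val_inj.
transitivity (\sum_(T in h @: [set T | gssyt T]) \prod_c x (T c)).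
  apply: eq_bigl => T; apply/andP/imsetP => [[sT cT]|[T']]; last first.
    rewrite inE => sT' ->; split; last first.
      apply/forallP=> c; apply/eqP; have [H|H] := boolP ((val c).2 < ext mu (val c).1)%N.
        by rewrite (hE1 _ _ H) /= ltn_ord.
      by rewrite hE2 //= ltnn.
    apply/forallP=> c; apply/forallP=> c'; apply/andP; split; apply/implyP=> /andP[/eqP e lt].
      have [H|H] := boolP ((val c').2 < ext mu (val c').1)%N; last first.
        by rewrite (hE2 _ c') //= -ltnS ltn_ord.
      have H' : ((val c).2 < ext mu (val c).1)%N by rewrite e (ltn_trans lt H).
      rewrite (hE1 _ _ H) (hE1 _ _ H') /=.
      have /forallP/(_ (exist _ (val c) H'))/forallP/(_ (exist _ (val c') H))/andP[/implyP q _] := sT'.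
      by apply: q; rewrite /= e eqxx.
    have H' : ((val c).2 < ext mu (val c).1)%N.
      by rewrite e (leq_trans (valP c')) // la_mu.
    rewrite (hE1 _ _ H'); have [H|H] := boolP ((val c').2 < ext mu (val c').1)%N; last first.
      by rewrite (hE2 _ c') //= ltn_ord.
    rewrite (hE1 _ _ H) /=.
    have /forallP/(_ (exist _ (val c) H'))/forallP/(_ (exist _ (val c') H))/andP[_ /implyP q] := sT'.
    by apply: q; rewrite /= e eqxx.
  have lT (c : gcell (ext mu)) : (T (io c) < N)%N.
    by have /forallP/(_ (io c))/eqP -> := cT; apply: (valP c).
  exists [ffun c => Ordinal (lT c)].
    rewrite inE; apply/forallP=> c; apply/forallP=> c'; rewrite !ffunE /=.
    by have /forallP/(_ (io c))/forallP/(_ (io c')) := sT.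
  apply/ffunP=> c; apply/val_inj; have [H|H] := boolP ((val c).2 < ext mu (val c).1)%N.
    by rewrite (hE1 _ _ H) ffunE /=; congr (val (T _)); apply/val_inj.
  rewrite hE2 //=; have /forallP/(_ c)/eqP := cT; rewrite (negbTE H) => /negbT.
  by rewrite -leqNgt => h'; apply/eqP; rewrite eqn_leq h' -ltnS ltn_ord.
rewrite big_imset /=; last by move=> T T' _ _; apply: h_inj.
rewrite /gschur big_distrr /=; apply: eq_big => [T|T _]; first by rewrite inE.
rewrite (bigID (fun c : gcell la => (val c).2 < ext mu (val c).1)%N) /= mulrC; congr (_ * _); last first.
  rewrite (reindex_omap io (fun c => insub (val c))) => [|c H]; last first.
    by rewrite insubT /=; congr Some; apply/val_inj.
  apply: eq_big => [c|c H].
    by rewrite (valP c) (_ : insub _ = Some c) ?eqxx //= valK.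
  by rewrite (hE1 _ (io c) (valP c)) /=; congr (x (T _)); apply/val_inj.
rewrite (eq_bigr (fun=> x N)) => [|c H]; last by rewrite hE2.
rewrite -(big_sub_cond [pred c : 'I_n * 'I_b | (c.2 < la c.1)%N]
   (fun c => ~~ (c.2 < ext mu c.1)%N) (fun=> x N)).
rewrite -(pair_big_dep xpredT (fun (i : 'I_n) (j : 'I_b) => (j < la i)%N && ~~ (j < ext mu i)%N)
   (fun _ _ => x N)) /=.
transitivity (\prod_(i < n) x N ^+ (la i - ext mu i)).
  apply: eq_bigr => i _; rewrite prodr_const; congr (_ ^+ _).
  have <- : #|[set j : 'I_b | (j < la i)%N] :\: [set j : 'I_b | (j < ext mu i)%N]| = (la i - ext mu i)%N.
    rewrite cardsD card_ord_lt (minn_idPr (la_b i)) (setIidPr _).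
      by rewrite card_ord_lt (minn_idPr (leq_trans (mu_le i) (la_b i))).
    by apply/subsetP=> j; rewrite !inE => /leq_trans; apply.
  by apply: eq_card => j; rewrite !inE andbC.
under [RHS]eq_bigr => i _ do rewrite -extE.
rewrite (big_ord_widen n (fun i => x N ^+ (la i - ext mu i)) le_rn) [RHS]big_mkcond /=.
by apply: eq_bigr => i _; case: ltnP => // h'; rewrite la_r.
Qed.

Lemma gschur_branch N :
  gschur N.+1 la =
  \sum_(mu : {ffun 'I_r -> 'I_b.+1} | interlace la mu)
     (\prod_(i < r) x N ^+ (la i - mu i)) * gschur N (ext mu).
Proof.
under [RHS]eq_bigr => mu im do rewrite -gschur_fiber //.
rewrite (exchange_big_dep (@gssyt la N.+1)) /=; last by move=> mu T _ /andP[].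
apply: eq_bigr => T sT; have [mu0 mu0E] := compat_unique sT.
by rewrite (big_pred1 mu0) // => mu; rewrite /= -mu0E sT.
Qed.

End SemistandardBranching.

Section JacobiTrudiIdentity.

Variables (R : comNzRingType) (x : nat -> R) (n b r : nat).
Hypothesis le_rn : (r <= n)%N.

(** Tableaux and determinant obey the same recursion in the number of variables. With no variables
    h_m is 1 for m = 0 and 0 otherwise, so the matrix is the identity for the empty shape and has a
    zero first row for any other shape. *)
Theorem jacobi_trudi N (la : nat -> nat) :
    (forall i, la i.+1 <= la i)%N -> (forall i, (r <= i)%N -> la i = 0%N) ->
    (forall i, la i <= b)%N ->
  gschur x n b N la = \det (jtmx x N r la).
Proof.
elim: N la => [|N IHN] la la_anti la_r la_b.
  have la_mono i j : (i <= j)%N -> (la j <= la i)%N.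
    by move=> /subnK <-; elim: (j - i)%N => // k; apply: leq_trans (la_anti _).
  case: (posnP (la 0%N)) => [la0|la_gt0].
    have la0' i : la i = 0%N by apply/eqP; rewrite -leqn0 -la0 la_mono.
    have c0 : #|{: gcell n b la}| = 0%N.
      by apply: eq_card0 => c; have := valP c; rewrite la0'.
    rewrite /gschur (big_pred1 (ffun0 c0)) => [|T].
      rewrite big1 => [|c _]; last by have := valP c; rewrite la0'.
      rewrite (_ : jtmx _ _ _ _ = 1%:M) ?det1 //; apply/matrixP=> i j; rewrite !mxE la0' sub0r addrC.
      case: (leqP i j) => h.
        have -> : j%:Z - i%:Z = Posz (j - i)%N by lia.
        by rewrite /= hc_nil subn_eq0 -val_eqE eqn_leq h.
      have -> : j%:Z - i%:Z = Negz (i - j).-1 by rewrite NegzE; lia.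
      by rewrite /= -val_eqE gtn_eqF.
    have e : T = ffun0 c0 by apply/ffunP=> c; have := valP c; rewrite la0'.
    rewrite /= e eqxx; apply/forallP=> c; have := valP c.
    by rewrite la0'.
  have r0 : (0 < r)%N by rewrite lt0n; apply/negP => /eqP e; rewrite la_r ?e in la_gt0.
  have hn : (0 < n)%N := leq_trans r0 le_rn.
  have hb : (0 < b)%N := leq_trans la_gt0 (la_b _).
  rewrite /gschur big1 => [|T _].
    rewrite (expand_det_row _ (Ordinal r0)) big1 // => j _.
    rewrite [X in X * _](_ : _ = 0) ?mul0r // mxE.
    set z := (X in hz x 0 X); have -> : z = Posz (la 0%N + j) by rewrite /z /=; lia.
    by rewrite /= hc_nil addn_eq0 (gtn_eqF la_gt0).
  by case: (T (exist (fun c : 'I_n * 'I_b => (c.2 < la c.1)%N) (Ordinal hn, Ordinal hb) la_gt0)).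
rewrite (gschur_branch x le_rn la_anti la_r la_b) (det_branch _ _ la_anti (la_r _ (leqnn r)) la_b).
apply: eq_bigr => mu /forallP im; rewrite IHN // => i.
- case: (ltnP i.+1 r) => h; last by rewrite ext_default.
  have := extE mu (Ordinal h); rewrite /= => ->.
  have := extE mu (Ordinal (ltnW h)); rewrite /= => ->.
  have /andP[_ h1] := im (Ordinal h); have /andP[h2 _] := im (Ordinal (ltnW h)).
  exact: leq_trans h1 h2.
- exact: ext_default.
case: (ltnP i r) => h; last by rewrite ext_default.
have := extE mu (Ordinal h); rewrite /= => ->.
by rewrite -ltnS ltn_ord.
Qed.

End JacobiTrudiIdentity.

(** * Jacobi-Trudi coefficients as the inverse of the Kostka matrix *)

Section JacobiTrudiMatrix.

Variable n : nat.
Implicit Types la mu nu al be : intpart n.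

Definition sc (R : comNzRingType) N (x : 'I_N -> R) mu : R :=
  \sum_(T : {ffun cell mu -> 'I_N} | ssyt T) \prod_c x (T c).

Definition hp (R : comNzRingType) N (x : 'I_N -> R) la : R :=
  \prod_(p <- parts la) hc x p.

(** A permutation that is not admissible meets an entry of negative index and drops out of the
    determinant; an index 0 contributes h_0 = 1 and can be omitted, as [jt_part] does. *)
Lemma sc_jacobi_trudi (R : comNzRingType) N (x : 'I_N -> R) la :
  sc x la = \sum_(s : 'S_(ell la) | jt_admissible s)
     (-1) ^+ s * \prod_(p <- jt_part s) hc x p.
Proof.
pose y k := oapp x 0 (insub k : option 'I_N).
have yE (i : 'I_N) : y i = x i by rewrite /y valK.
transitivity (gschur y n n N (part la)).
  by apply: eq_bigr => T _; apply: eq_bigr => c _; rewrite yE.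
rewrite (jacobi_trudi y (ell_le la)); last first.
- by move=> i; apply: part_le.
- by move=> i; apply: part_default.
- by move=> i; apply: part_anti.
rewrite /determinant [RHS]big_mkcond /=; apply: eq_bigr => s _.
have [/forallP adm|/forallPn[i]] := boolP (jt_admissible s); last first.
  rewrite -ltnNge => lti; rewrite (bigD1 i) //= mxE.
  have -> : (part la i)%:Z - i%:Z + (s i)%:Z = Negz (i - (part la i + s i)).-1.
    by rewrite NegzE; lia.
  by rewrite /= mul0r mulr0.
congr (_ * _).
rewrite (perm_big _ (permEl (perm_sort _ _))) /= big_filter [RHS]big_mkcond /= big_map big_enum /=.
apply: eq_bigr => i _; rewrite mxE.
have -> : (part la i)%:Z - i%:Z + (s i)%:Z = Posz (part la i + s i - i)%N.
  by have := adm i; lia.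
rewrite /= (eq_hc _ yE); case: posnP => [->|//].
by rewrite hc0.
Qed.

Lemma sumn_filter_gt0 (s : seq nat) : sumn [seq x <- s | (0 < x)%N] = sumn s.
Proof. by elim: s => // -[|x] s /= ->. Qed.

Lemma sumn_codom (I : finType) (f : I -> nat) : sumn [seq f i | i : I] = (\sum_i f i)%N.
Proof. by rewrite sumnE big_map big_enum. Qed.

(** The shifts s(i) - i sum to zero, so the shifted parts still sum to n. *)
Lemma jt_intpart la (s : 'S_(ell la)) : jt_admissible s ->
  {al : intpart n | parts al = jt_part s}.
Proof.
move=> /forallP adm; apply: intpart_exists.
- by apply: sort_sorted => a b; apply: leq_total.
- by rewrite all_sort filter_all.
rewrite /jt_part (perm_sumn (permEl (perm_sort _ _))) sumn_filter_gt0 sumn_codom.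
have e : (\sum_(i < ell la) (part la i + s i - i) + \sum_(i < ell la) i =
          \sum_(i < ell la) part la i + \sum_i s i)%N.
  by rewrite -!big_split /=; apply: eq_bigr => i _; rewrite subnK.
have e2 : (\sum_i s i = \sum_(i < ell la) i)%N by rewrite [RHS](reindex_inj (@perm_inj _ s)).
by move: e; rewrite e2 => /addIn ->; apply: psumE.
Qed.

(** The inverse Kostka numbers, as [kostka_inverse] shows: the coefficient of h_al in the expansion
    of the determinant for s_la. *)
Definition jtcoef la al : int :=
  \sum_(s : 'S_(ell la) | jt_admissible s && (jt_part s == parts al)) (-1) ^+ s.

(** The function [G] is arbitrary because the regrouping is applied to products of complete
    homogeneous polynomials in [sc_jtcoef] and to products of Kostka numbers in [theorem4p10]. *)
Lemma jt_sum (R : comNzRingType) (G : seq nat -> R) la :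
  \sum_(s : 'S_(ell la) | jt_admissible s) (-1) ^+ s * G (jt_part s) =
  \sum_al (jtcoef la al)%:~R * G (parts al).
Proof.
under [RHS]eq_bigr => al _ do rewrite rmorph_sum mulr_suml /=.
rewrite (exchange_big_dep (@jt_admissible n la)) /=; last by move=> al s _ /andP[].
apply: eq_bigr => s adm; have [al0 alE] := jt_intpart adm.
rewrite (big_pred1 al0) => [|al]; first by rewrite alE rmorph_sign.
by rewrite /= adm -alE (inj_eq (@parts_inj n)) eq_sym.
Qed.

Lemma sc_jtcoef (R : comNzRingType) N (x : 'I_N -> R) la :
  sc x la = \sum_al (jtcoef la al)%:~R * hp x al.
Proof. by rewrite sc_jacobi_trudi (jt_sum (fun p => \prod_(i <- p) hc x i)). Qed.

(** The first k values of s are distinct, so they sum to at least 0 + ... + (k - 1). The comparison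
    is made on the truncated deficits k - s(i): summed over all i and reindexed by s, they total
    what the identity gives, where only the indices below k contribute. *)
Lemma perm_prefix_sum r (s : 'S_r) k : (k <= r)%N ->
  (\sum_(i < r | (i < k)%N) i <= \sum_(i < r | (i < k)%N) s i)%N.
Proof.
move=> lekr.
have h1 : (\sum_(i < r | (i < k)%N) k <= \sum_(i < r | (i < k)%N) s i + \sum_(i < r | (i < k)%N) (k - s i))%N.
  by rewrite -big_split /=; apply: leq_sum => i _; lia.
have h2 : (\sum_(i < r | (i < k)%N) (k - s i) <= \sum_(i < r | (i < k)%N) (k - i))%N.
  apply: (@leq_trans (\sum_(i < r) (k - s i))%N).
    by rewrite [X in (_ <= X)%N](bigID (fun i : 'I_r => (i < k)%N)) /= leq_addr.
  rewrite -(reindex_inj (@perm_inj _ s) (P := xpredT) (F := fun i : 'I_r => (k - i)%N)) /=.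
  rewrite [X in (X <= _)%N](bigID (fun i : 'I_r => (i < k)%N)) /= -[X in (_ <= X)%N]addn0 leq_add2l.
  by rewrite big1 // => i; rewrite -leqNgt -subn_eq0 => /eqP.
have h3 : (\sum_(i < r | (i < k)%N) k = \sum_(i < r | (i < k)%N) i + \sum_(i < r | (i < k)%N) (k - i))%N.
  by rewrite -big_split /=; apply: eq_bigr => i hi; rewrite subnKC // ltnW.
by rewrite h3 in h1; have := leq_trans h1 (leq_add (leqnn _) h2); rewrite leq_add2r.
Qed.

(* The k largest parts maximize sums of k terms: compare both sums with the
   threshold part al k. *)
Lemma psum_max al (I : finType) (a : I -> nat) (A : pred I) k :
    perm_eq [seq x <- [seq a i | i : I] | (0 < x)%N] (parts al) -> (#|A| <= k)%N ->
  (\sum_(i | A i) a i <= psum al k)%N.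
Proof.
move=> pa Ak; pose c := part al k.
have h1 : (\sum_(i | A i) a i <= k * c + \sum_i (a i - c))%N.
  apply: (@leq_trans (\sum_(i | A i) (c + (a i - c)))%N).
    by apply: leq_sum => i _; lia.
  rewrite big_split /= sum_nat_const leq_add ?leq_mul2r ?Ak ?orbT //.
  by rewrite [X in (_ <= X)%N](bigID A) /= leq_addr.
apply: leq_trans h1 _.
have -> : (\sum_i (a i - c) = \sum_(p <- parts al) (p - c))%N.
  rewrite -(perm_big _ pa) /= big_filter [RHS]big_mkcond /= big_map big_enum /=.
  by apply: eq_bigr => i _; case: posnP => // ->.
have -> : (\sum_(p <- parts al) (p - c) = \sum_(i < k) (part al i - c))%N.
  rewrite (big_nth 0%N) big_mkord -/(ell al).
  case: (leqP k (ell al)) => h.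
    rewrite (big_ord_widen (ell al) (fun i => part al i - c)%N h) [RHS]big_mkcond /=.
    by apply: eq_bigr => i _; case: ltnP => // h'; apply/eqP; rewrite subn_eq0 part_anti.
  rewrite (big_ord_widen k (fun i => nth 0 (parts al) i - c)%N (ltnW h)) [LHS]big_mkcond /=.
  by apply: eq_bigr => i _; case: ltnP => // h'; rewrite part_default.
have -> : (k * c = \sum_(i < k) c)%N by rewrite sum_nat_const card_ord.
rewrite -big_split /=; apply: leq_sum => i _.
by rewrite subnKC // part_anti // ltnW.
Qed.

(** The numbers la_i + s(i) - i with i < k are k of the values whose nonzero members are the parts
    of al, so [psum_max] bounds their sum. *)
Lemma jt_prefix la al (s : 'S_(ell la)) k : jt_admissible s -> jt_part s = parts al ->
  (k <= ell la)%N ->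
  (psum la k + \sum_(i < ell la | (i < k)%N) s i <=
     psum al k + \sum_(i < ell la | (i < k)%N) i)%N.
Proof.
move=> /forallP adm e lek.
rewrite {1}/psum (big_ord_widen (ell la) (fun i => part la i) lek) -big_split /=.
rewrite (eq_bigr (fun i : 'I_(ell la) => (part la i + s i - i + i)%N)) => [|i _]; last by rewrite subnK.
rewrite big_split leq_add2r; apply: psum_max.
  by rewrite -e /jt_part perm_sym; apply/permPl/perm_sort.
have := card_ord_lt (ell la) k; rewrite (minn_idPr lek) cardsE => h.
by rewrite -[X in (_ <= X)%N]h; apply: subset_leq_card; apply/subsetP.
Qed.

Lemma jtcoef_dom la al : jtcoef la al != 0 -> dom al la.
Proof.
move=> nz; have [s /andP[adm /eqP e]|none] :=
    pickP (fun s : 'S_(ell la) => jt_admissible s && (jt_part s == parts al)); last first.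
  by case/eqP: nz; apply: big_pred0.
move=> k; case: (leqP k (ell la)) => lek.
  have := leq_trans (leq_add (leqnn (psum la k)) (perm_prefix_sum s lek)) (jt_prefix adm e lek).
  by rewrite leq_add2r.
have := leq_trans (leq_add (leqnn (psum la (ell la))) (perm_prefix_sum s (leqnn _)))
   (jt_prefix adm e (leqnn _)).
rewrite leq_add2r (psumE (leqnn _)) (psumE (ltnW lek)) => h; apply: leq_trans h _.
by rewrite /psum (big_ord_widen k (fun i => part al i) (ltnW lek)) [X in (_ <= X)%N](bigID (fun i : 'I_k => (i < ell la)%N)) leq_addr.
Qed.

(** For al = la the two inequalities behind [jtcoef_dom] are equalities: s has the prefix sums of
    the identity, hence is the identity. *)
Lemma jtcoef_diag la : jtcoef la la = 1.
Proof.
rewrite /jtcoef (big_pred1 1%g) ?odd_perm1 // => s /=.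
apply/andP/eqP => [[adm /eqP e]|->].
  have pre k : (k <= ell la)%N ->
      (\sum_(i < ell la | (i < k)%N) s i = \sum_(i < ell la | (i < k)%N) i)%N.
    move=> lek; apply/eqP; rewrite eqn_leq (perm_prefix_sum s lek) andbT.
    by have := jt_prefix adm e lek; rewrite leq_add2l.
  apply/permP=> i; rewrite perm1; apply/val_inj.
  have split_i (f : 'I_(ell la) -> nat) : (\sum_(j < ell la | (j < i.+1)%N) f j =
      f i + \sum_(j < ell la | (j < i)%N) f j)%N.
    rewrite (bigD1 i) //=; congr (_ + _)%N; apply: eq_bigl => j.
    by rewrite -val_eqE /= ltnS ltn_neqAle andbC.
  by have := pre i.+1 (ltn_ord i); rewrite !split_i pre ?(ltnW (ltn_ord i)) // => /addIn.
split; first by apply/forallP=> i; rewrite perm1 leq_addl.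
rewrite /jt_part (_ : [seq _ | i : _] = parts la).
  rewrite (_ : [seq x <- _ | _] = parts la); last by apply/all_filterP; apply: sub_all (parts_gt0 la).
  apply/eqP/sorted_sort; last exact: parts_sorted.
  by move=> a b c /= h1 h2; apply: leq_trans h2 h1.
apply: (@eq_from_nth _ 0%N); first by rewrite size_map size_enum_ord.
move=> i; rewrite size_map size_enum_ord => hi.
by rewrite (nth_map (Ordinal hi)) ?size_enum_ord //= perm1 nth_enum_ord // addnK.
Qed.

(** Letting entries range over ['I_n] for every content puts all fillings into the type over which
    [sc] in n variables sums; the extra values occur 0 times. *)
Lemma kostka_pad mu nu : kostka mu (parts nu) =
  #|[set T : {ffun cell mu -> 'I_n} |
      ssyt T & [forall k : 'I_n, #|[set c | T c == k]| == part nu k]]|.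
Proof.
pose h (T : {ffun cell mu -> 'I_(size (parts nu))}) : {ffun cell mu -> 'I_n} :=
  [ffun c => widen_ord (ell_le nu) (T c)].
have h_inj : injective h.
  by move=> T T' /ffunP e; apply/ffunP=> c; have := congr1 val (e c); rewrite !ffunE /= => /val_inj.
rewrite /kostka -(card_imset _ h_inj); apply: eq_card => T; rewrite !inE.
apply/imsetP/andP => [[T']|[sT /forallP cT]].
  rewrite inE => /andP[sT' /forallP cT'] ->; split.
    apply/forallP=> c; apply/forallP=> c'; rewrite !ffunE /=.
    by have /forallP/(_ c)/forallP/(_ c') := sT'.
  apply/forallP=> k; case: (ltnP k (ell nu)) => hk.
    have := cT' (Ordinal hk) => /eqP; rewrite -/(part nu k) => <-.
    by apply/eqP/eq_card => c; rewrite !inE ffunE -!val_eqE.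
  rewrite part_default // cards_eq0; apply/eqP/setP=> c; rewrite !inE ffunE -val_eqE /=.
  by rewrite ltn_eqF // (leq_trans (ltn_ord _) hk).
have lT c : (T c < ell nu)%N.
  rewrite ltnNge; apply/negP=> hk; have := cT (T c); rewrite part_default // cards_eq0.
  by move/eqP/setP/(_ c); rewrite !inE eqxx.
exists [ffun c => Ordinal (lT c)].
  rewrite inE; apply/andP; split.
    apply/forallP=> c; apply/forallP=> c'; rewrite !ffunE /=.
    by have /forallP/(_ c)/forallP/(_ c') := sT.
  apply/forallP=> k; have := cT (widen_ord (ell_le nu) k) => /eqP; rewrite /part /= => <-.
  by apply/eqP/eq_card => c; rewrite !inE ffunE -!val_eqE.
by apply/ffunP=> c; rewrite !ffunE; apply/val_inj.
Qed.

Definition margins (al nu : intpart n) (f : {ffun 'I_n -> {ffun 'I_n -> 'I_n.+1}}) : bool :=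
  [forall i, (\sum_j f i j)%N == part al i] && [forall j, (\sum_i f i j)%N == part nu j].

Definition nmat al nu : nat := #|[set f | margins al nu f]|.

Lemma nmat_sym al nu : nmat al nu = nmat nu al.
Proof.
pose tr (f : {ffun 'I_n -> {ffun 'I_n -> 'I_n.+1}}) := [ffun i => [ffun j => f j i]].
have trK : involutive tr by move=> f; apply/ffunP=> i; apply/ffunP=> j; rewrite !ffunE.
have trm a b f : margins a b (tr f) = margins b a f.
  rewrite /margins andbC; congr (_ && _); apply: eq_forallb => i; congr (_ == _);
  by apply: eq_bigr => j _; rewrite !ffunE.
rewrite /nmat -(card_imset _ (inv_inj trK)); apply: eq_card => f; rewrite inE.
apply/imsetP/idP => [[g]|h]; first by rewrite inE => h ->; rewrite trm.
by exists (tr f); rewrite ?trK // inE trm.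
Qed.

Let mon nu : 'X_{1..n} := [multinom part nu i | i < n].

Lemma coef_sc mu nu : (sc (fun i => 'X_i : {mpoly int[n]}) mu)@_(mon nu) = (kostka mu (parts nu))%:R.
Proof.
rewrite kostka_pad -sum1_card natr_sum /sc raddf_sum /= big_mkcond /= [RHS]big_mkcond /=.
apply: eq_bigr => T _; rewrite inE; case: ifP => //= _.
rewrite mprodXE mcoeffX.
have -> : ((\sum_c U_(T c))%MM == mon nu) = [forall k : 'I_n, #|[set c | T c == k]| == part nu k].
  have cE k : (\sum_c U_(T c))%MM k = #|[set c | T c == k]|.
    rewrite mnm_sumE -sum1_card [RHS]big_mkcond /=; apply: eq_bigr => c _.
    by rewrite mnm1E inE; case: eqP.
  apply/eqP/forallP => [/mnmP e k|e]; first by rewrite -cE e mnmE.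
  by apply/mnmP=> k; rewrite cE mnmE; apply/eqP.
by case: forallP.
Qed.

Lemma hp_pad (R : comNzRingType) N (x : 'I_N -> R) al :
  hp x al = \prod_(i < n) hc x (part al i).
Proof.
rewrite /hp (big_nth 0%N) big_mkord -/(ell al).
rewrite (big_ord_widen n (fun i => hc x (nth 0%N (parts al) i)) (ell_le al)) big_mkcond /=.
by apply: eq_bigr => i _; case: ltnP => // h; rewrite part_default // hc0.
Qed.

(** Choosing a monomial of degree al_i from the i-th factor is choosing row i of a matrix; the
    product of the choices is x^nu exactly when the column sums are nu. *)
Lemma coef_hp al nu : (hp (fun i => 'X_i : {mpoly int[n]}) al)@_(mon nu) = (nmat al nu)%:R.
Proof.
rewrite hp_pad (eq_bigr _ (fun (i : 'I_n) _ => hc_ffun _ (part_le al i))).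
rewrite (bigA_distr_big_dep (fun (i : 'I_n) (f : {ffun 'I_n -> 'I_n.+1}) => (\sum_j f j)%N == part al i)).
rewrite raddf_sum /= /nmat -sum1_card natr_sum big_mkcond /= [RHS]big_mkcond /=.
apply: eq_bigr => f _; rewrite inE.
rewrite (_ : [forall i, _] = [forall i, (\sum_(j < n) f i j)%N == part al i]); last first.
  exact: eq_forallb.
rewrite [in X in _ = if X then _ else _]inE /margins; case: ifP => //= _.
under eq_bigr => i _ do rewrite mprodXnE.
rewrite mprodXE mcoeffX.
have -> : ((\sum_i \sum_j U_(j) *+ f i j)%MM == mon nu) = [forall j, (\sum_i f i j)%N == part nu j].
  have cE k : (\sum_i \sum_j U_(j) *+ f i j)%MM k = (\sum_i f i k)%N.
    rewrite mnm_sumE; apply: eq_bigr => i _; rewrite mnm_sumE (bigD1 k) //= mulmnE mnm1E eqxx mul1n.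
    by rewrite big1 ?addn0 // => j /negPf ne; rewrite mulmnE mnm1E ne.
  apply/eqP/forallP => [/mnmP e k|e]; first by rewrite -cE e mnmE.
  by apply/mnmP=> k; rewrite cE mnmE; apply/eqP.
by case: forallP.
Qed.

Lemma kostka_jtcoef la nu :
  (kostka la (parts nu))%:R = \sum_al jtcoef la al * (nmat al nu)%:R :> int.
Proof.
rewrite -coef_sc sc_jtcoef raddf_sum /=; apply: eq_bigr => al _.
by rewrite mulrzl raddfMz /= coef_hp -mulrzl intz.
Qed.

(* With K = J N for the symmetric matrix N, K J^T = J N J^T is both symmetric and
   unitriangular for dominance, hence the identity. *)
Lemma kostka_inverse mu la :
  \sum_al jtcoef la al * (kostka mu (parts al))%:R = (la == mu)%:R.
Proof.
pose D mu la := \sum_al jtcoef la al * (kostka mu (parts al))%:R.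
have Dsym mu' la' : D mu' la' = D la' mu'.
  rewrite /D; under eq_bigr => al _ do rewrite kostka_jtcoef big_distrr /=.
  under [RHS]eq_bigr => al _ do rewrite kostka_jtcoef big_distrr /=.
  rewrite exchange_big /=; apply: eq_bigr => be _; apply: eq_bigr => al _.
  by rewrite nmat_sym mulrCA.
have Ddom mu' la' : D mu' la' != 0 -> dom mu' la'.
  move=> nz; have [al nzal|none] := pickP (fun al => jtcoef la' al * (kostka mu' (parts al))%:R != 0).
    move: nzal; rewrite mulf_eq0 negb_or pnatr_eq0 => /andP[/jtcoef_dom h1 /kostka_dom h2].
    exact: dom_trans h2 h1.
  by case/eqP: nz; rewrite /D big1 // => al _; apply/eqP; move/negbFE: (none al).
rewrite -/(D mu la); case: eqP => [->|ne]; last first.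
  apply/eqP/negPn/negP => nz; apply: ne; apply: dom_anti (Ddom _ _ nz).
  by apply: Ddom; rewrite Dsym.
rewrite /D (bigD1 mu) //= jtcoef_diag kostka_diag mul1r big1 ?addr0 // => al ne.
apply/eqP; rewrite mulf_eq0 pnatr_eq0; apply/negPn/negP; rewrite negb_or.
case/andP=> /jtcoef_dom h1 /kostka_dom h2; case/eqP: ne.
exact: dom_anti.
Qed.

(** A one-sided inverse of a finite square matrix is two-sided. *)
Lemma kostka_inverse_tr al be :
  \sum_la jtcoef la al * (kostka la (parts be))%:R = (al == be)%:R.
Proof.
pose A : 'M[int]_#|{: intpart n}| := \matrix_(i, j) (kostka (enum_val i) (parts (enum_val j)))%:R.
pose B : 'M[int]_#|{: intpart n}| := \matrix_(i, j) jtcoef (enum_val j) (enum_val i).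
have AB : A *m B = 1%:M.
  apply/matrixP=> i j; rewrite !mxE.
  rewrite -(inj_eq enum_val_inj) eq_sym -(kostka_inverse (enum_val i)) [RHS](big_enum_val _ (A := {: intpart n})) /=.
  by apply: eq_bigr => k _; rewrite !mxE mulrC.
have := congr1 (fun M : 'M_ _ => M (enum_rank al) (enum_rank be)) (mulmx1C AB).
rewrite /= !mxE (inj_eq enum_rank_inj) => <-.
rewrite (big_enum_val _ (A := {: intpart n})) /=.
by apply: eq_bigr => k _; rewrite !mxE !enum_rankK.
Qed.

Lemma hp_kostka (R : comNzRingType) N (x : 'I_N -> R) al :
  hp x al = \sum_mu (kostka mu (parts al))%:R * sc x mu.
Proof.
under eq_bigr => mu _ do rewrite sc_jtcoef big_distrr /=.
rewrite exchange_big /= (bigD1 al) //=.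
have e be : \sum_mu (kostka mu (parts al))%:R * ((jtcoef mu be)%:~R * hp x be) = (be == al)%:R * hp x be.
  under eq_bigr => mu _ do rewrite mulrA.
  rewrite -mulr_suml; congr (_ * _).
  have := congr1 (fun z : int => z%:~R : R) (kostka_inverse_tr be al).
  rewrite rmorph_nat => <-; rewrite rmorph_sum; apply: eq_bigr => mu _.
  by rewrite rmorphM /= rmorph_nat mulrC.
rewrite e eqxx mul1r big1 ?addr0 // => be /negPf ne.
by rewrite e ne mul0r.
Qed.

End JacobiTrudiMatrix.

(** * Traces and permutation characters *)

(** In the basis made of the rows of [K] and of preimages [L] of the rows of [I], the matrix [R] is
    block triangular with diagonal blocks [A] and [B]. Taking bases rather than submodules as data
    lets the same statement serve submodules, quotients and sections. *)
Lemma mxtrace_exact (F : fieldType) m p k q (R : 'M[F]_m) (R' : 'M_p) (D : 'M_(m, p))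
    (K : 'M_(k, m)) (A : 'M_k) (I : 'M_(q, p)) (B : 'M_q) :
    R *m D = D *m R' ->
    row_free K -> (K :=: kermx D)%MS -> K *m R = A *m K ->
    row_free I -> (I :=: D)%MS -> I *m R' = B *m I ->
  \tr R = \tr A + \tr B.
Proof.
move=> RD fK eK KR fI eI IR.
have /submxP[L IL] : (I <= D)%MS by rewrite eI.
pose T := col_mx K L.
have fT : row_free T.
  apply: inj_row_free => v; rewrite -[v]hsubmxK mul_row_col => e.
  have KD : K *m D = 0 by apply/eqP; rewrite -sub_kermx eK.
  have : (lsubmx v *m K + rsubmx v *m L) *m D = 0 by rewrite e mul0mx.
  rewrite mulmxDl -!mulmxA KD mulmx0 add0r -IL => /eqP.
  rewrite mulmx_free_eq0 // => /eqP r0; move: e; rewrite r0 mul0mx addr0 => /eqP.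
  by rewrite mulmx_free_eq0 // => /eqP ->; rewrite row_mx0.
have sz : (k + q = m)%N.
  rewrite -(eqP fK) -(eqP fI) eK eI mxrank_ker subnK //.
  exact: rank_leq_row.
have fullT : row_full T by rewrite /row_full (eqP fT) sz.
have /row_fullP[S ST] := fullT.
have TS : T *m S = 1%:M.
  by apply: (row_free_inj fT); rewrite mul1mx -mulmxA ST mulmx1.
have /submxP[X LR] : (L *m R - B *m L <= K)%MS.
  rewrite eK sub_kermx mulmxBl -[L *m R *m D]mulmxA RD mulmxA -[B *m L *m D]mulmxA -IL IR.
  by rewrite subrr.
have TR : T *m R = block_mx A 0 X B *m T.
  rewrite /T mul_col_mx mul_block_col mul0mx addr0 KR; congr col_mx.
  by rewrite -LR subrK.
have -> : \tr R = \tr (S *m (T *m R)) by rewrite mulmxA ST mul1mx.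
by rewrite TR mulmxA mxtrace_mulC mulmxA TS mul1mx mxtrace_block.
Qed.

Section ModuleTraces.

Variables (F : fieldType) (gT : finGroupType) (G : {group gT}) (m : nat).
Variables (rG : mx_representation F G m) (U : 'M[F]_m) (Umod : mxmodule rG U).

Lemma val_submod1_free : row_free (val_submod (1%:M : 'M_(\rank U))).
Proof. by rewrite /row_free val_submod1. Qed.

Lemma val_submod1J x : x \in G ->
  val_submod (1%:M : 'M_(\rank U)) *m rG x = submod_repr Umod x *m val_submod 1%:M.
Proof. by move=> Gx; rewrite -(val_submodJ Umod) // mul1mx val_submodE. Qed.

Lemma in_factmod1J x : x \in G ->
  rG x *m in_factmod U (1%:M : 'M_m) = in_factmod U 1%:M *m factmod_repr Umod x.
Proof. by move=> Gx; rewrite -in_factmodE -in_factmodJ // mul1mx. Qed.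

Lemma mxtrace_sub_fact x : x \in G ->
  \tr (rG x) = \tr (submod_repr Umod x) + \tr (factmod_repr Umod x).
Proof.
move=> Gx; have rD : \rank (in_factmod U (1%:M : 'M_m)) = \rank (cokermx U).
  apply: (@addIn (\rank U)); rewrite mxrank_in_factmod mxrank_coker (addsmx_idPr (submx1 U)).
  by rewrite mxrank1 subnK ?rank_leq_row.
apply: (mxtrace_exact (in_factmod1J Gx) val_submod1_free _ (val_submod1J Gx)
          (I := 1%:M) _ _ (B := factmod_repr Umod x)).
- apply: eqmx_trans (val_submod1 U) _; apply/eqmxP/andP; split.
    by rewrite sub_kermx -in_factmodE in_factmod_eq0.
  by rewrite -in_factmod_eq0 in_factmodE; apply/eqP/mulmx_ker.
- by rewrite row_free_unit unitmx1.
- by apply/eqmx_sym/eqmxP; rewrite submx1 sub1mx /row_full rD eqxx.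
by rewrite mul1mx mulmx1.
Qed.

(** In the top degree, homology is the quotient of the cycles by zero. That quotient is only
    isomorphic to the cycle module, and [mxtrace_exact] with zero kernel transfers the trace. *)
Lemma mxtrace_section0 (V : 'M[F]_m) (Vmod : mxmodule rG V) x : x \in G -> U = 0 ->
  \tr (section_repr Umod Vmod x) = \tr (submod_repr Vmod x).
Proof.
move=> Gx U0.
have DE : val_submod (1%:M : 'M_(\rank V)) *m in_factmod U 1%:M =
          in_factmod U (val_submod (1%:M : 'M_(\rank V))) by rewrite -in_factmodE.
have K0 : kermx (val_submod (1%:M : 'M_(\rank V)) *m in_factmod U 1%:M) = 0.
  apply/eqP; rewrite -mxrank_eq0 mxrank_ker subn_eq0 DE.
  have := mxrank_in_factmod U (val_submod (1%:M : 'M_(\rank V))).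
  rewrite U0 mxrank0 addn0 => ->; rewrite adds0mx.
  by rewrite val_submod1.
rewrite -[LHS]add0r; symmetry.
have -> : 0 = \tr (0 : 'M[F]_0) by rewrite raddf0.
apply: (mxtrace_exact (D := val_submod 1%:M *m in_factmod U 1%:M) (K := 0)
          (I := val_submod (1%:M : 'M_(\rank <<in_factmod U V>>%MS)))
          (R' := factmod_repr Umod x)).
- rewrite -[RHS]mulmxA -in_factmod1J // [LHS]mulmxA [RHS]mulmxA; congr (_ *m _).
  by rewrite -(val_submodJ Vmod) // mul1mx [RHS]val_submodE.
- by rewrite /row_free mxrank0.
- by rewrite K0; apply/eqmxP; rewrite !sub0mx.
- by rewrite mulmx0 mul0mx.
- by rewrite /row_free val_submod1.
- apply: eqmx_trans (val_submod1 _) _; apply: eqmx_trans (genmxE _) _.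
  by rewrite in_factmodE; apply/eqmx_sym/eqmxMr/val_submod1.
by rewrite -(val_submodJ (section_module Umod Vmod)) // mul1mx val_submodE.
Qed.

End ModuleTraces.

Lemma mxtrace_act (F : fieldType) (gT : finGroupType) (T : finType)
    (to : {action gT &-> T}) g :
  \tr (act_mx F to g) = #|[set x | to x g == x]|%:R.
Proof.
rewrite -sum1_card natr_sum [RHS]big_mkcond /= [RHS](big_enum_val _ (A := T)) /=.
apply: eq_bigr => i _; rewrite mxE inE eq_sym.
by case: eqP.
Qed.

Lemma card_imset_eq (T T1 T2 : finType) (f : T -> T1) (h : T -> T2) (A : {set T}) :
    {in A &, forall x y, (f x == f y) = (h x == h y)} ->
  #|f @: A| = #|h @: A|.
Proof.
wlog suff W : T1 T2 f h / {in A &, forall x y, (f x == f y) = (h x == h y)} ->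
    (#|f @: A| <= #|h @: A|)%N.
  move=> e; apply/eqP; rewrite eqn_leq W //.
  by apply: W => x y xA yA; rewrite e.
move=> e; have [->|[x0 x0A]] := set_0Vmem A; first by rewrite !imset0 !cards0.
pose k z := f (odflt x0 [pick x in A | h x == z]).
apply: leq_trans (leq_imset_card k _); apply/subset_leq_card/subsetP=> y /imsetP[x xA ->].
apply/imsetP; exists (h x); first exact: imset_f.
rewrite /k; case: pickP => [x' /andP[x'A hx]|/(_ x)]; last by rewrite xA eqxx.
by apply/eqP; rewrite e // eq_sym.
Qed.

Lemma card_nth_eq n (T : eqType) (y : 'I_n -> T) (s : seq T) z : size s = n ->
  #|[set i : 'I_n | nth (y i) s i == z]| = count_mem z s.
Proof.
move=> sz; rewrite -sum1_card -sum1_count.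
case: s sz => [|a s] sz.
  by rewrite big_nil big1 // => i _; have := ltn_ord i; rewrite -[X in (_ < X)%N]sz.
rewrite (big_nth a) sz big_mkord; apply: eq_bigl => i; rewrite inE /=.
by rewrite (set_nth_default a) // sz.
Qed.

(** * Inner products of tabloid characters *)

Section TabloidCharacters.

Variable n : nat.
Implicit Types la mu nu al rho : intpart n.

Definition tabchar nu : 'CF([set: 'S_n]) := cfRepr (tabloid_repr nu).

Lemma tabcharE nu g : tabchar nu g = #|[set r : tabloid nu | tabloid_act r g == r]|%:R.
Proof. by rewrite cfunE inE mulr1n mxtrace_act. Qed.

Lemma tabchar_char nu : tabchar nu \is a character.
Proof. exact: cfRepr_char. Qed.

Section Gram.

Variables al nu : intpart n.

Let pairact (p : tabloid al * tabloid nu) (g : 'S_n) :=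
  (tabloid_act p.1 g, tabloid_act p.2 g).

Let pairact_is_action : is_action [set: 'S_n] pairact.
Proof.
have [i1 m1] := tabloid_act_is_action al; have [i2 m2] := tabloid_act_is_action nu.
split=> [g [r r'] [q q'] e|[r r'] g h Gg Gh].
  by congr (_, _); [apply: (i1 g _ _ (congr1 fst e)) | apply: (i2 g _ _ (congr1 snd e))].
by rewrite /pairact /= m1 ?m2.
Qed.

Let pairaction := Action pairact_is_action.

Let cmx (p : tabloid al * tabloid nu) : {ffun 'I_n -> {ffun 'I_n -> 'I_n.+1}} :=
  [ffun i => [ffun j => inord #|[set x | (val p.1 x == i) && (val p.2 x == j)]|]].

Let cmxE p i j : cmx p i j = #|[set x | (val p.1 x == i) && (val p.2 x == j)]| :> nat.
Proof. by rewrite !ffunE inordK // ltnS -[X in (_ <= X)%N](card_ord n) max_card. Qed.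

Let card_fiber1 (r r' : {ffun 'I_n -> 'I_n}) i :
  #|[set x | r x == i]| = (\sum_j #|[set x | (r x == i) && (r' x == j)]|)%N.
Proof.
rewrite -sum1_card (partition_big r' xpredT) //=; apply: eq_bigr => j _.
by rewrite -sum1_card; apply: eq_bigl => x; rewrite !inE.
Qed.

(** Equal matrices mean that the two lists of pairs of row indices, one pair for each entry, agree
    up to order; a permutation matching the lists carries one pair of tabloids to the other. *)
Let orbit_cmx p q : (orbit pairaction [set: 'S_n] p == orbit pairaction [set: 'S_n] q) = (cmx p == cmx q).
Proof.
apply/eqP/eqP => [/orbit_eqP/orbitP[g _ <-]|e].
  apply/ffunP=> i; apply/ffunP=> j; apply/val_inj; rewrite /= !cmxE.
  rewrite -[RHS](card_imset _ (@perm_inj _ g)); apply: eq_card => x; rewrite !inE /pairact /= !ffunE.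
  apply/idP/imsetP => [h|[y]]; first by exists (g^-1 x)%g; rewrite ?inE ?permKV.
  by rewrite inE => h ->; rewrite permK.
pose f (u : tabloid al * tabloid nu) : n.-tuple ('I_n * 'I_n) := [tuple (val u.1 x, val u.2 x) | x < n].
have cf u z : count_mem z (f u) = cmx u z.1 z.2.
  rewrite cmxE -(@card_nth_eq n _ (fun=> z)) ?size_tuple //; apply: eq_card => x; rewrite !inE.
  by rewrite -tnth_nth tnth_mktuple -pair_eqE.
have /tuple_permP[s sE] : perm_eq (f q) (f p).
  by apply/allP=> z _ /=; rewrite !cf e.
have fE x : (val q.1 x, val q.2 x) = (val p.1 (s x), val p.2 (s x)).
  have := congr1 (fun t => nth (x, x) t x) sE.
  by rewrite -!tnth_nth !tnth_mktuple.
apply/orbit_eqP/orbitP; exists s; rewrite ?inE //.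
rewrite /pairaction /= /pairact; case: p q fE {e sE cf} => p1 p2 [q1 q2] /= fE.
congr (_, _); apply/val_inj/ffunP => x; rewrite /= ffunE; have := fE (s^-1 x)%g.
  by rewrite permKV => -[].
by rewrite permKV => -[].
Qed.

Let cmx_im : cmx @: setT = [set f | margins al nu f].
Proof.
apply/setP=> f; rewrite inE; apply/imsetP/andP => [[p _ ->]|[/forallP rf /forallP cf]].
  split; apply/forallP=> i.
    under eq_bigr => j _ do rewrite cmxE.
    by rewrite -card_fiber1; have /forallP := valP p.1.
  under eq_bigr => j _ do rewrite cmxE.
  have /forallP/(_ i)/eqP <- := valP p.2; rewrite (card_fiber1 _ (val p.1)).
  by apply/eqP/eq_bigr => j _; apply: eq_card => x; rewrite !inE andbC.
(* Each position (i, j) is listed f(i, j) times. The list has length n, and its x-th member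
   prescribes the rows of x in the two tabloids. *)
pose s := flatten [seq nseq (f z.1 z.2) z | z <- enum {: 'I_n * 'I_n}].
have cs z : count_mem z s = f z.1 z.2.
  rewrite count_flatten -map_comp sumnE big_map big_enum /= (bigD1 z) //= count_nseq /= eqxx mul1n.
  rewrite big1 ?addn0 // => z' ne; rewrite count_nseq /=.
  by rewrite (negPf ne) mul0n.
have sz : size s = n.
  rewrite size_flatten /shape -map_comp sumnE big_map big_enum /=.
  under eq_bigr => z _ do rewrite size_nseq.
  rewrite -(pair_big xpredT xpredT (fun i j => val (f i j))) /=.
  by rewrite (eq_bigr _ (fun (i : 'I_n) _ => eqP (rf i))); apply/psumE/ell_le.
pose r1 := [ffun x : 'I_n => (nth (x, x) s x).1].
pose r2 := [ffun x : 'I_n => (nth (x, x) s x).2].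
have r12 i j : #|[set x | (r1 x == i) && (r2 x == j)]| = f i j.
  rewrite -(cs (i, j)) -(card_nth_eq (fun x => (x, x)) (i, j) sz); apply: eq_card => x.
  by rewrite !inE !ffunE -pair_eqE.
have R1 : [forall i : 'I_n, #|[set x | r1 x == i]| == part al i].
  apply/forallP=> i; rewrite (card_fiber1 _ r2); under eq_bigr => j _ do rewrite r12.
  exact: rf.
have R2 : [forall i : 'I_n, #|[set x | r2 x == i]| == part nu i].
  apply/forallP=> i; rewrite (card_fiber1 _ r1) (eq_bigr (fun j => val (f j i))) ?cf // => j _.
  by transitivity (nat_of_ord (f j i)) => //; rewrite -r12; apply: eq_card => x; rewrite !inE andbC.
exists (exist _ r1 R1, exist _ r2 R2) => //.
by apply/ffunP=> i; apply/ffunP=> j; apply/val_inj; rewrite /= cmxE /= r12.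
Qed.

(** The product of the two characters counts fixed pairs of tabloids, so by Burnside's count the
    inner product is the number of orbits on pairs, and [orbit_cmx] identifies orbits with
    matrices. *)
Lemma cfdot_tabchar : '[tabchar al, tabchar nu] = (nmat al nu)%:R.
Proof.
have G0 : #|[set: 'S_n]|%:R != 0 :> algC by rewrite pnatr_eq0 -lt0n cardG_gt0.
rewrite cfdotE /nmat -cmx_im -(card_imset_eq (f := orbit pairaction [set: 'S_n])); last first.
  by move=> p q _ _; apply: orbit_cmx.
apply: (mulfI G0); rewrite mulVKf // -natrM mulnC -Frobenius_Cauchy; last first.
  by apply/actsP=> g _ p; rewrite !inE.
rewrite natr_sum; apply: eq_bigr => g _; rewrite !tabcharE rmorph_nat -natrM -cardsX.
congr _%:R; apply: eq_card => p; rewrite !inE /= /pairact.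
rewrite sub1set inE; case: p => a b /=.
by rewrite -pair_eqE.
Qed.

End Gram.

End TabloidCharacters.

(** * Specht modules *)

(** The trace of an idempotent is its rank: in the rank factorization of e, idempotence forces
    [row_base e *m col_base e] to be the identity. *)
Lemma idempotent_trace0 (d : nat) (e : 'M[algC]_d) : e *m e = e -> \tr e = 0 -> e = 0.
Proof.
move=> ee; rewrite -(mulmx_base e) mxtrace_mulC.
have -> : row_base e *m col_base e = 1%:M.
  apply: (row_free_inj (row_base_free e)); apply: (row_full_inj (col_base_full e)).
  rewrite mul1mx; have -> : col_base e *m (row_base e *m col_base e *m row_base e) =
      (col_base e *m row_base e) *m (col_base e *m row_base e) by rewrite !mulmxA.
  by rewrite mulmx_base ee.
rewrite mxtrace1 => /eqP; rewrite pnatr_eq0 mxrank_eq0 => /eqP ->.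
by rewrite mulmx_base.
Qed.

Section Specht.

Variables (n : nat) (mu : intpart n).
Implicit Types (T : tableau mu) (la nu al rho : intpart n).

Lemma tableau_inj T : injective (val T).
Proof. exact/injectiveP/(valP T). Qed.

Lemma tableau_bij T : bijective (val T).
Proof. by apply: inj_card_bij (@tableau_inj T) _; rewrite card_cell card_ord. Qed.

Lemma cell_of_exists T : {f : 'I_n -> cell mu | cancel f (val T) & cancel (val T) f}.
Proof.
have im x : x \in codom (val T).
  by have [f _ fK] := tableau_bij T; rewrite -(fK x) codom_f.
exists (fun x => iinv (im x)) => [x|c]; first by rewrite f_iinv.
by apply: (@tableau_inj T); rewrite f_iinv.
Qed.

Definition cell_of T : 'I_n -> cell mu := sval (sig_of_sig2 (cell_of_exists T)).

Lemma cell_ofK T : cancel (cell_of T) (val T).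
Proof. by rewrite /cell_of; case: (cell_of_exists T). Qed.

Lemma tableauK T : cancel (val T) (cell_of T).
Proof. by rewrite /cell_of; case: (cell_of_exists T). Qed.

Definition tcol T x := ccol (cell_of T x).
Definition trow T x := crow (cell_of T x).

Lemma trow_tcol_inj T x y : trow T x = trow T y -> tcol T x = tcol T y -> x = y.
Proof. by move=> h1 h2; apply: (can_inj (cell_ofK T)); apply: cell_inj. Qed.

Lemma col_stabP T (s : 'S_n) :
  reflect (forall x, tcol T (s x) = tcol T x) (s \in col_stab T).
Proof.
rewrite inE; apply: (iffP forallP) => [h x|h c].
  have /forallP/(_ (cell_of T (s x)))/implyP := h (cell_of T x).
  by rewrite !cell_ofK eqxx => /(_ isT)/eqP.
apply/forallP=> c'; apply/implyP=> /eqP e.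
by have := h (val T c); rewrite /tcol e !tableauK => ->.
Qed.

Lemma col_stabM T s u : s \in col_stab T -> u \in col_stab T -> (s * u)%g \in col_stab T.
Proof. by move=> /col_stabP hs /col_stabP hu; apply/col_stabP=> x; rewrite permM hu hs. Qed.

Lemma col_stabV T s : s \in col_stab T -> (s^-1)%g \in col_stab T.
Proof. by move=> /col_stabP hs; apply/col_stabP=> x; rewrite -hs permKV. Qed.

Lemma col_stab1 T : 1%g \in col_stab T.
Proof. by apply/col_stabP=> x; rewrite perm1. Qed.

Lemma mem_col_stabM T s u : s \in col_stab T -> ((s * u)%g \in col_stab T) = (u \in col_stab T).
Proof.
move=> hs; apply/idP/idP => [h|]; last exact: col_stabM.
by rewrite -[u](mulKg s); apply: col_stabM => //; apply: col_stabV.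
Qed.

Lemma mem_col_stabMr T s u : s \in col_stab T -> ((u * s)%g \in col_stab T) = (u \in col_stab T).
Proof.
move=> hs; apply/idP/idP => [h|h]; last exact: col_stabM.
by rewrite -[u](mulgK s); apply: col_stabM => //; apply: col_stabV.
Qed.

Definition antisym T d (rG : mx_representation algC [set: 'S_n] d) : 'M[algC]_d :=
  \sum_(s in col_stab T) (-1) ^+ s *: rG s.

Lemma antisym_sqr T d (rG : mx_representation algC [set: 'S_n] d) :
  antisym T rG *m antisym T rG = #|col_stab T|%:R *: antisym T rG.
Proof.
rewrite {1}/antisym mulmx_suml scaler_nat -sumr_const; apply: eq_bigr => s Cs.
rewrite /antisym mulmx_sumr [RHS](reindex_inj (mulgI s)) /=.
apply: eq_big => [u|u Cu]; first by rewrite mem_col_stabM.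
by rewrite -scalemxAl -scalemxAr scalerA -repr_mxM ?inE // odd_permM signr_addb.
Qed.

(** Divided by the order of the column stabilizer, the antisymmetrizer is idempotent, so it vanishes
    as soon as its trace does. This turns a statement about matrices into one about characters. *)
Lemma antisym_eq0 T d (rG : mx_representation algC [set: 'S_n] d) :
  \sum_(s in col_stab T) (-1) ^+ s * cfRepr rG s = 0 -> antisym T rG = 0.
Proof.
move=> tr0; pose c : algC := #|col_stab T|%:R.
have c0 : c != 0 by rewrite pnatr_eq0 -lt0n; apply/card_gt0P; exists 1%g; apply: col_stab1.
suff : c^-1 *: antisym T rG = 0.
  by move/eqP; rewrite scaler_eq0 invr_eq0 (negPf c0) => /eqP.
apply: idempotent_trace0.
  by rewrite -scalemxAl -scalemxAr antisym_sqr; congr (_ *: _); rewrite scalerA mulVf // scale1r.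
rewrite mxtraceZ /antisym raddf_sum /= (eq_bigr (fun s : 'S_n => (-1) ^+ s * cfRepr rG s)) ?tr0 ?mulr0 // => s _.
by rewrite mxtraceZ cfunE inE mulr1n.
Qed.

(** The count is made column by column. Entries of one column of T have distinct values under r, so
    at most k of these values are less than k; and a column of T either has k cells in the first k
    rows or lies entirely inside them. *)
Lemma col_dominance T rho (r : {ffun 'I_n -> 'I_n}) :
    [forall i : 'I_n, #|[set x | r x == i]| == part rho i] ->
    (forall x y, r x = r y -> tcol T x = tcol T y -> x = y) ->
  dom mu rho.
Proof.
move=> /forallP rr inj k.
have -> : psum rho k = #|[set x | (r x < k)%N]|.
  have -> : #|[set x | (r x < k)%N]| = (\sum_(i < n | (i < k)%N) #|[set x | r x == i]|)%N.
    rewrite -sum1_card (partition_big r (fun i => (i < k)%N)) /=; last by move=> x; rewrite inE.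
    apply: eq_bigr => i hi; rewrite -sum1_card; apply: eq_bigl => x; rewrite !inE.
    by case: eqP => [->|]; rewrite ?hi ?andbF.
  rewrite (eq_bigr _ (fun (i : 'I_n) _ => eqP (rr i))) -card_cells_lt.
  by rewrite (card_cells rho (fun i => (i < k)%N)).
have -> : psum mu k = #|[set x | (trow T x < k)%N]|.
  rewrite -card_cells_lt -(card_imset _ (@tableau_inj T)); apply: eq_card => x; rewrite !inE.
  apply/imsetP/idP => [[c]|h]; first by rewrite inE => h ->; rewrite /trow tableauK.
  by exists (cell_of T x); rewrite ?inE ?cell_ofK.
rewrite -!sum1_card (partition_big (tcol T) xpredT) //= [X in (_ <= X)%N](partition_big (tcol T) xpredT) //=.
apply: leq_sum => j _; rewrite !sum1_card.
have [/existsP[y /andP[/eqP ycol yk]]|/existsPn small] :=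
    boolP [exists y, (tcol T y == j) && (k <= trow T y)%N]; last first.
  apply/subset_leq_card/subsetP=> x /andP[_ /eqP xj]; apply/andP; split; last exact/eqP.
  by rewrite inE; have := small x; rewrite xj eqxx -ltnNge.
have lekn : (k <= n)%N := leq_trans yk (ltnW (ltn_ord _)).
apply: (@leq_trans k).
  pose D := [set x | (r x < k)%N && (tcol T x == j)].
  have rinj : {in D &, injective r}.
    move=> x x'; rewrite !inE => /andP[_ /eqP xj] /andP[_ /eqP x'j] e.
    by apply: inj e _; rewrite xj x'j.
  apply: (@leq_trans #|D|); first by apply/subset_leq_card/subsetP=> x /andP[]; rewrite !inE => -> ->.
  rewrite -(card_in_imset rinj); apply: (@leq_trans #|[set i : 'I_n | (i < k)%N]|).
    apply/subset_leq_card/subsetP=> i /imsetP[x]; rewrite !inE => /andP[h _] ->.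
    exact: h.
  by rewrite card_ord_lt geq_minr.
have cellk (i : 'I_k) : {c : cell mu | crow c = i :> nat & ccol c = j}.
  have [||c e1 e2] := @cell_up _ mu (widen_ord lekn i) j (cell_of T y).
  - by rewrite (leq_trans _ yk) //= ltnW.
  - by rewrite -ycol.
  by exists c; rewrite // e1.
pose h (i : 'I_k) := val T (s2val (cellk i)).
have h_inj : injective h.
  move=> i i' /(@tableau_inj T) e; apply/val_inj.
  by rewrite /= -(s2valP (cellk i)) -(s2valP (cellk i')) e.
rewrite -[X in (X <= _)%N](card_ord k) -(card_imset _ h_inj); apply/subset_leq_card/subsetP=> x /imsetP[i _ ->].
apply/andP; rewrite inE /trow /tcol /h tableauK (s2valP' (cellk i)) eqxx.
by rewrite (s2valP (cellk i)) ltn_ord.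
Qed.

(* A tabloid with two entries of one row in one column of T is fixed by a
   transposition of the column stabilizer, which cancels its contribution. *)
Lemma antisym_tabchar T rho :
  \sum_(s in col_stab T) (-1) ^+ s * tabchar rho s != 0 -> dom mu rho.
Proof.
move=> nz.
have [r nzr|none] := pickP (fun r : tabloid rho =>
    \sum_(s in col_stab T | tabloid_act r s == r) (-1) ^+ s != 0 :> algC); last first.
  case/eqP: nz; under eq_bigr => s _.
    rewrite tabcharE -sum1_card natr_sum big_mkcond mulr_sumr /=; over.
  rewrite exchange_big /= big1 // => r _.
  apply: etrans (eqP (negbFE (none r))); rewrite [RHS]big_mkcondr /=.
  by apply: eq_bigr => s _; rewrite inE; case: ifP; rewrite ?mulr1 ?mulr0.
apply: (col_dominance (T := T) (valP r)) => x y rxy cxy; apply/eqP/negPn/negP => nxy.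
case/eqP: nzr.
pose u := tperm x y.
have uC : u \in col_stab T.
  by apply/col_stabP=> z; rewrite /u; case: tpermP => // ->.
have ur : tabloid_act r u = r.
  apply/val_inj/ffunP=> z; rewrite /= ffunE tpermV.
  by case: tpermP => // ->.
set S := \sum_(s in _ | _) _.
have : S = - S.
  rewrite {1}/S (reindex_inj (mulgI u)) /= -sumrN; apply: eq_big => [s|s _].
    rewrite mem_col_stabM //; have [_ ->] := tabloid_act_is_action rho; rewrite ?inE //.
    by rewrite ur.
  by rewrite odd_permM odd_tperm nxy signr_addb expr1 mulN1r.
by move/eqP; rewrite -addr_eq0 -mulr2n mulrn_eq0 => /eqP.
Qed.

Lemma polytabloid_col T s : s \in col_stab T ->
  row (enum_rank T) (polytabloid_mx mu) *m tabloid_repr mu s =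
  (-1) ^+ s *: row (enum_rank T) (polytabloid_mx mu).
Proof.
move=> Cs; apply/rowP=> r; rewrite act_mxEr !mxE !enum_rankK big_distrr /=.
rewrite [RHS](reindex_inj (mulIg s)) /=; apply: eq_big => [u|u _]; first by rewrite mem_col_stabMr.
rewrite mulrA odd_permM signr_addb mulrCA -signr_addb addbb mulr1; congr (_ * (nat_of_bool _)%:R).
by apply: eq_forallb => c; rewrite !ffunE invgK permM.
Qed.

Lemma tableau_exists : tableau mu.
Proof.
have e : (#|{: cell mu}| <= n)%N by rewrite card_cell.
exists [ffun c => widen_ord e (enum_rank c)].
by apply/injectiveP=> c c'; rewrite !ffunE => /(congr1 val) /= /val_inj/enum_rank_inj.
Qed.

(** The tabloid of T has coefficient 1 in its own polytabloid, since a permutation that preserves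
    both the rows and the columns of T is the identity. *)
Lemma specht_neq0 : specht_mx mu != 0.
Proof.
pose T := tableau_exists.
have rT : [forall i : 'I_n, #|[set x | [ffun x => trow T x] x == i]| == part mu i].
  apply/forallP=> i; have := card_cells mu (pred1 i); rewrite big_pred1_eq => <-.
  rewrite -[X in _ == X](card_imset _ (@tableau_inj T)); apply/eqP/eq_card => x; rewrite !inE ffunE.
  apply/idP/imsetP => [h|[c]]; first by exists (cell_of T x); rewrite ?inE ?cell_ofK.
  by rewrite inE => h ->; rewrite /trow tableauK.
pose r : tabloid mu := exist (fun r : {ffun 'I_n -> 'I_n} =>
  [forall i : 'I_n, #|[set x | r x == i]| == part mu i]) _ rT.
rewrite -mxrank_eq0 genmxE mxrank_eq0; apply/eqP => /matrixP/(_ (enum_rank T) (enum_rank r)).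
rewrite !mxE !enum_rankK (bigD1 1%g) ?col_stab1 //= odd_perm1 mul1r big1 => [|s /andP[/col_stabP Cs ns]].
  rewrite addr0 (_ : is_tabloid_of _ _ = true) => [/eqP|]; first by rewrite oner_eq0.
  by apply/forallP=> c; rewrite !ffunE perm1 /trow tableauK.
case: (boolP (is_tabloid_of _ _)) => [/forallP h|_]; last by rewrite mulr0.
case/eqP: ns; apply/permP=> x; rewrite perm1; apply: (@trow_tcol_inj T); last exact: Cs.
by have := h (cell_of T x); rewrite !ffunE cell_ofK => /eqP.
Qed.

Lemma irrS_char : irrS mu \is a character.
Proof. exact: cfRepr_char. Qed.

Lemma irrS_neq0 : irrS mu != 0.
Proof.
rewrite -char1_eq0 ?irrS_char // cfRepr1 pnatr_eq0 mxrank_eq0.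
exact: specht_neq0.
Qed.

Lemma tabchar_sub_irrS : tabchar mu - irrS mu \is a character.
Proof.
rewrite (_ : _ - _ = cfRepr (factmod_repr (specht_module mu))) ?cfRepr_char //.
apply/cfunP=> g; rewrite !cfunE !inE !mulr1n (mxtrace_sub_fact (specht_module mu)) ?inE //.
by rewrite addrAC subrr add0r.
Qed.

(** A constituent splits off as a direct summand, and P is the projection onto it. *)
Lemma constt_intertwiner d (rG : mx_representation algC [set: 'S_n] d) i :
    '[cfRepr rG, 'chi_i] != 0 ->
  exists2 P : 'M_(d, irr_degree (socle_of_Iirr i)), P != 0 &
    forall g, rG g *m P = P *m 'Chi_i g.
Proof.
move=> nz.
have /(constt_charP i (cfRepr_char rG))[psi /char_reprP[rV ->] e] : i \in irr_constt (cfRepr rG).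
  by rewrite irr_consttE.
have /cfRepr_rsimP/mx_rsim_def[f12 [f21 fK fE]] :
    cfRepr rG == cfRepr (dadd_grepr (Representation 'Chi_i) rV).
  by rewrite cfRepr_dadd irrRepr e.
exists (f12 *m col_mx 1%:M 0) => [|g].
  apply/eqP => e0; have : f21 *m (f12 *m col_mx 1%:M 0) = 0 by rewrite e0 mulmx0.
  rewrite mulmxA fK mul1mx => /eqP; rewrite col_mx_eq0 => /andP[/eqP/(congr1 mxrank) h _].
  by move: h; rewrite mxrank1 mxrank0 /= => h; have := irr_degree_gt0 (socle_of_Iirr i); rewrite h.
rewrite fE ?inE // -!mulmxA [f21 *m _]mulmxA fK mul1mx /=; congr (_ *m _).
by rewrite mul_block_col mul_col_mx !mulmx1 !mulmx0 mul1mx !mul0mx !addr0.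
Qed.

(** The column stabilizer acts on the polytabloid of T by the sign, so [antisym T] multiplies its
    image under the intertwiner P by the order of the stabilizer. Were all these traces zero,
    [antisym_eq0] would make P kill every polytabloid, and these span the module. *)
Lemma specht_constt i : '[irrS mu, 'chi_i] != 0 ->
  exists T, \sum_(s in col_stab T) (-1) ^+ s * 'chi_i s != 0.
Proof.
move=> /constt_intertwiner[P nzP PE].
have [T nzT|none] := pickP (fun T => \sum_(s in col_stab T) (-1) ^+ s * 'chi_i s != 0).
  by exists T.
case/eqP: nzP.
have sub : (polytabloid_mx mu <= specht_mx mu)%MS by rewrite genmxE.
pose Q := in_submod (specht_mx mu) (polytabloid_mx mu).
have QE : val_submod Q = polytabloid_mx mu by rewrite in_submodK.
have QP : Q *m P = 0.
  apply/row_matrixP=> k; rewrite row0 row_mul; pose T := enum_val k.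
  have vs s : s \in col_stab T ->
      row k Q *m submod_repr (specht_module mu) s = (-1) ^+ s *: row k Q.
    move=> Cs; apply: (@val_submod_inj _ _ (specht_mx mu)); rewrite val_submodJ ?inE // linearZ /=.
    rewrite val_submodE -row_mul -val_submodE QE.
    by have := polytabloid_col Cs; rewrite /T enum_valK.
  have C0 : #|col_stab T|%:R != 0 :> algC.
    by rewrite pnatr_eq0 -lt0n; apply/card_gt0P; exists 1%g; apply: col_stab1.
  have : #|col_stab T|%:R *: (row k Q *m P) = row k Q *m P *m antisym T 'Chi_i.
    rewrite scaler_nat -sumr_const /antisym mulmx_sumr; apply: eq_bigr => s Cs.
    rewrite -scalemxAr -mulmxA -PE mulmxA vs // -scalemxAl scalerA -signr_addb addbb.
    by rewrite expr0 scale1r.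
  rewrite (antisym_eq0 (T := T)); last by rewrite irrRepr; apply/eqP/negbFE/none.
  by rewrite mulmx0 => /eqP; rewrite scaler_eq0 (negPf C0) => /eqP.
have /submxP[M ME] : (val_submod (1%:M : 'M_(\rank (specht_mx mu))) <= polytabloid_mx mu)%MS.
  by rewrite val_submod1 genmxE.
have MQ : M *m Q = 1%:M.
  by apply: (@val_submod_inj _ _ (specht_mx mu)); rewrite val_submodE -mulmxA -val_submodE QE -ME.
by rewrite -[P]mul1mx -MQ -mulmxA QP mulmx0.
Qed.

End Specht.

(** * Young's rule *)

Section YoungRule.

Variable n : nat.
Implicit Types la mu nu al rho : intpart n.

(** The Jacobi-Trudi expansion of s_mu with the tabloid character of al in place of h_al. *)
Definition chiS mu : 'CF([set: 'S_n]) := \sum_al (jtcoef mu al)%:~R *: tabchar al.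

Lemma cfdot_chiS_tabchar mu nu : '[chiS mu, tabchar nu] = (kostka mu (parts nu))%:R.
Proof.
have := congr1 (fun z : int => z%:~R : algC) (kostka_jtcoef mu nu).
rewrite rmorph_nat => ->; rewrite rmorph_sum cfdot_suml; apply: eq_bigr => al _.
by rewrite cfdotZl cfdot_tabchar rmorphM /= rmorph_nat.
Qed.

Lemma cfdot_chiS mu la : '[chiS mu, chiS la] = (mu == la)%:R.
Proof.
have := congr1 (fun z : int => z%:~R : algC) (kostka_inverse mu la).
rewrite rmorph_nat eq_sym => <-; rewrite rmorph_sum cfdot_sumr; apply: eq_bigr => al _.
by rewrite cfdotZr cfdot_chiS_tabchar rmorphM /= rmorph_nat rmorph_int.
Qed.

Lemma tabchar_chiS nu : tabchar nu = \sum_mu (kostka mu (parts nu))%:R *: chiS mu.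
Proof.
under eq_bigr => mu _ do rewrite scaler_sumr.
rewrite exchange_big /=.
have e al : \sum_mu (kostka mu (parts nu))%:R *: ((jtcoef mu al)%:~R *: tabchar al) =
    (al == nu)%:R *: tabchar al.
  under eq_bigr => mu _ do rewrite scalerA.
  rewrite -scaler_suml; congr (_ *: _).
  have := congr1 (fun z : int => z%:~R : algC) (kostka_inverse_tr al nu).
  rewrite rmorph_nat => <-; rewrite rmorph_sum; apply: eq_bigr => mu _.
  by rewrite rmorphM /= rmorph_nat mulrC.
rewrite (bigD1 nu) //= e eqxx scale1r big1 ?addr0 // => al /negPf ne.
by rewrite e ne scale0r.
Qed.

(** A virtual character of norm 1 is an irreducible one up to sign; the sign is + because the inner
    product with the genuine character [tabchar mu] is 1. *)
Lemma chiS_irr mu : chiS mu \in irr [set: 'S_n].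
Proof.
have vc : chiS mu \in 'Z[irr [set: 'S_n]].
  apply: rpred_sum => al _; rewrite scaler_int rpredMz // char_vchar //.
  exact: tabchar_char.
have [|b [i e]] := vchar_norm1P vc; first by rewrite cfdot_chiS eqxx.
have := cfdot_chiS_tabchar mu mu; rewrite kostka_diag e cfdotZl.
case: b e => e; last by rewrite expr0 scale1r => _; apply: mem_irr.
rewrite expr1 mulN1r cfdotC => /eqP; rewrite eqr_oppLR.
have := Cnat_cfdot_char (tabchar_char mu) (irr_char i).
by move=> /natrP[k ->]; rewrite rmorph_nat -(mulrN1 1) mul1r; move/eqP=> h;
   have := ler0n algC k; rewrite h oppr_ge0 lt_geF.
Qed.

(** A constituent of the Specht module occurs in [tabchar mu], so it is some [chiS rho] with nonzero
    K_{rho, mu}, and rho dominates mu. By [specht_constt] one of its antisymmetrized sums is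
    nonzero; expanding by J produces al with mu dominating al and al dominating rho. Hence rho = mu,
    and the multiplicity is at most the multiplicity 1 in [tabchar mu]. *)
Theorem irrS_chiS mu : irrS mu = chiS mu.
Proof.
have /irrP[i0 i0E] := chiS_irr mu.
have le_i i : '[irrS mu, 'chi_i] <= '[tabchar mu, 'chi_i].
  rewrite -subr_ge0 -cfdotBl.
  have /natrP[k ->] := Cnat_cfdot_char (tabchar_sub_irrS mu) (irr_char i).
  exact: ler0n.
have only i : '[irrS mu, 'chi_i] != 0 -> i = i0.
  move=> nz; have nzM : '[tabchar mu, 'chi_i] != 0.
    apply: contraNneq nz => z; have := le_i i; rewrite z.
    have /natrP[k ->] := Cnat_cfdot_char (irrS_char mu) (irr_char i).
    by rewrite -[X in _ <= X]/(0%:R) ler_nat leqn0 => /eqP ->.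
  have [rho /andP[K0 nzr]|none] := pickP (fun rho =>
      (kostka rho (parts mu) != 0%N) && ('[chiS rho, 'chi_i] != 0)); last first.
    case/eqP: nzM; rewrite tabchar_chiS cfdot_suml big1 // => rho _; rewrite cfdotZl.
    have := none rho; case: eqP => [->|_] /=; first by rewrite mul0r.
    by move/negbFE/eqP => ->; rewrite mulr0.
  have /irrP[j jE] := chiS_irr rho.
  have ij : chiS rho = 'chi_i.
    by move: nzr; rewrite jE cfdot_irr pnatr_eq0 eqb0 negbK => /eqP ->.
  have [T nzT] := specht_constt nz.
  suff e : rho = mu by apply: irr_inj; rewrite -ij e i0E.
  apply: dom_anti; first exact: kostka_dom.
  have [al /andP[J0 k0]|none] := pickP (fun al => (jtcoef rho al != 0) &&
      (\sum_(s in col_stab T) (-1) ^+ s * tabchar al s != 0)).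
    exact: dom_trans (antisym_tabchar k0) (jtcoef_dom J0).
  case/eqP: nzT; rewrite -ij.
  under eq_bigr => s _ do rewrite sum_cfunE mulr_sumr.
  rewrite exchange_big /= big1 // => al _.
  under eq_bigr => s _ do rewrite cfunE mulrCA.
  rewrite -big_distrr /=; have := none al; case: eqP => [->|_] /=; first by rewrite mul0r.
  by move/negbFE/eqP => ->; rewrite mulr0.
have e : irrS mu = '[irrS mu, 'chi_i0] *: 'chi_i0.
  rewrite {1}[irrS mu]cfun_sum_cfdot (bigD1 i0) //= big1 ?addr0 // => i ne.
  have [->|/only e] := eqVneq '[irrS mu, 'chi_i] 0; first by rewrite scale0r.
  by rewrite e eqxx in ne.
have M1 : '[tabchar mu, 'chi_i0] = 1.
  by rewrite -i0E cfdotC cfdot_chiS_tabchar kostka_diag rmorph1.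
have /natrP[k kE] := Cnat_cfdot_char (irrS_char mu) (irr_char i0).
have := le_i i0; have := irrS_neq0 mu; rewrite M1 kE {}e kE.
case: k {kE} => [|k]; first by rewrite scale0r eqxx.
by move=> _; rewrite -[X in _ <= X]/(1%:R) ler_nat ltnS leqn0 => /eqP ->; rewrite scale1r i0E.
Qed.

Lemma irrS_orthonormal mu la : '[irrS mu, irrS la] = (mu == la)%:R.
Proof. by rewrite !irrS_chiS cfdot_chiS. Qed.

Lemma young_rule mu nu : '[tabchar nu, irrS mu] = (kostka mu (parts nu))%:R.
Proof. by rewrite irrS_chiS cfdotC cfdot_chiS_tabchar rmorph_nat. Qed.

End YoungRule.

(** * Homology of the Segre power of the Boolean lattice *)

Section Coboundary.

Variable T : eqType.
Implicit Types (psi phi : seq T -> rat) (s : seq T).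

(** The alternating sum over deletions (see [cobdE]), in recursive form: either the head is deleted
    or it stays in front. This makes the square zero by a short induction and isolates the effect of
    coning by x on x :: s. *)
Fixpoint cobd psi s : rat :=
  if s is x :: s' then psi s' - cobd (fun u => psi (x :: u)) s' else 0.

Definition face i s : seq T := take i s ++ drop i.+1 s.

Lemma cobdE psi s : cobd psi s = \sum_(i < size s) (-1) ^+ i * psi (face i s).
Proof.
elim: s psi => [|x s IHs] psi /=; first by rewrite big_ord0.
rewrite big_ord_recl expr0 mul1r /face /= drop0 IHs -sumrN; congr (_ + _).
by apply: eq_bigr => i _; rewrite /bump /= add1n exprS mulN1r mulNr.
Qed.

Lemma eq_cobd psi phi s : (forall i, (i < size s)%N -> psi (face i s) = phi (face i s)) ->
  cobd psi s = cobd phi s.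
Proof. by move=> e; rewrite !cobdE; apply: eq_bigr => i _; rewrite e. Qed.

Lemma cobdB psi phi s : cobd (fun u => psi u - phi u) s = cobd psi s - cobd phi s.
Proof. by rewrite !cobdE -sumrB; apply: eq_bigr => i _; rewrite mulrBr. Qed.

Lemma cobdN psi s : cobd (fun u => - psi u) s = - cobd psi s.
Proof. by rewrite !cobdE -sumrN; apply: eq_bigr => i _; rewrite mulrN. Qed.

Lemma cobdD psi phi s : cobd (fun u => psi u + phi u) s = cobd psi s + cobd phi s.
Proof. by rewrite !cobdE -big_split; apply: eq_bigr => i _; rewrite mulrDr. Qed.

Lemma cobd_cobd psi s : cobd (cobd psi) s = 0.
Proof.
elim: s psi => //= x s IHs psi.
by rewrite cobdB IHs subr0 subrr.
Qed.

Lemma face_subseq i s : subseq (face i s) s.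
Proof.
rewrite -{2}(cat_take_drop i s) /face cat_subseq // -[i.+1]add1n -drop_drop.
exact: drop_subseq.
Qed.

Lemma size_face i s : (i < size s)%N -> size (face i s) = (size s).-1.
Proof. by move=> h; rewrite size_cat size_take h size_drop; lia. Qed.

End Coboundary.

(** * Acyclicity of unions of stars of atoms *)

Section SegreAcyclic.

Variables (n t : nat) (t_gt0 : (0 < t)%N).

Local Notation point := {ffun 'I_t -> {set 'I_n}}.
Local Notation label := {ffun 'I_t -> 'I_n}.
Implicit Types (A x y : point) (b c e : label) (s : seq point).

Let j0 : 'I_t := Ordinal t_gt0.
Let one : point := [ffun=> setT].

Definition ple A x := [forall j, A j \subset x j].
Definition prk A := #|A j0|.

Lemma ple_refl A : ple A A.
Proof. by apply/forallP=> j. Qed.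

Lemma ple_trans A x y : ple A x -> ple x y -> ple A y.
Proof. by move=> /forallP h1 /forallP h2; apply/forallP=> j; apply: subset_trans (h1 j) (h2 j). Qed.

Lemma ple_anti A x : ple A x -> ple x A -> A = x.
Proof.
move=> /forallP h1 /forallP h2; apply/ffunP=> j; apply/eqP.
by rewrite eqEsubset h1 h2.
Qed.

Lemma ple_one A : ple A one.
Proof. by apply/forallP=> j; rewrite ffunE subsetT. Qed.

Lemma B_lt_trans : transitive (@B_lt n t).
Proof.
move=> y x z /andP[nxy hxy] /andP[nyz hyz]; apply/andP; split; last exact: (@ple_trans x y z).
by apply: contraNneq nxy => e; rewrite -e in hyz; apply/eqP/ple_anti.
Qed.

Lemma in_B_card A i : in_B A -> #|A i| = prk A.
Proof. by move=> /forallP/(_ i)/forallP/(_ j0)/eqP. Qed.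

Lemma B_lt_prk A x : in_B A -> in_B x -> B_lt A x -> (prk A < prk x)%N.
Proof.
move=> iA ix /andP[ne /forallP h]; rewrite ltnNge; apply: contra ne => le.
apply/eqP/ffunP=> j; apply/eqP; rewrite eqEcard h.
by rewrite (in_B_card j iA) (in_B_card j ix).
Qed.

Lemma B_lt_diff A x j : in_B A -> in_B x -> B_lt A x -> exists u, (u \in x j) && (u \notin A j).
Proof.
move=> iA ix lt; have := B_lt_prk iA ix lt; rewrite -(in_B_card j iA) -(in_B_card j ix) => h.
have /subsetPn[u ux uA] : ~~ (x j \subset A j).
  by apply: contraL h => /subset_leq_card; rewrite -leqNgt.
by exists u; rewrite ux.
Qed.

Lemma in_B_one : in_B one.
Proof. by apply/forallP=> i; apply/forallP=> j; rewrite !ffunE. Qed.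

Lemma prk_one : prk one = n.
Proof. by rewrite /prk ffunE cardsT card_ord. Qed.

Definition addl A b : point := [ffun j => b j |: A j].
Definition avoid A b := [forall j, b j \notin A j].

Lemma addl_in_B A b : in_B A -> avoid A b -> in_B (addl A b).
Proof.
move=> iA /forallP av; apply/forallP=> i; apply/forallP=> j.
by rewrite !ffunE !cardsU1 !av !(in_B_card _ iA).
Qed.

Lemma prk_addl A b : avoid A b -> prk (addl A b) = (prk A).+1.
Proof. by move=> /forallP av; rewrite /prk ffunE cardsU1 av. Qed.

Lemma ple_addl A b : ple A (addl A b).
Proof. by apply/forallP=> j; rewrite ffunE subsetUr. Qed.

Lemma addl_neq A b : avoid A b -> A != addl A b.
Proof.
move=> /forallP/(_ j0) av; apply: contraNneq av => /ffunP/(_ j0) ->.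
by rewrite ffunE setU11.
Qed.

Lemma B_lt_addl A b : avoid A b -> B_lt A (addl A b).
Proof. by move=> av; apply/andP; split; [apply: addl_neq | apply: ple_addl]. Qed.

Lemma ple_addlP A b y : ple (addl A b) y = ple A y && [forall j, b j \in y j].
Proof.
apply/forallP/andP => [h|[/forallP h1 /forallP h2] j].
  split; apply/forallP=> j; have := h j; rewrite ffunE subUset sub1set; by case/andP.
by rewrite ffunE subUset sub1set h1 h2.
Qed.

Definition chn A s := path (@B_lt n t) A s && all (fun x => in_B x && (x != one)) s.

Lemma chn_subseq A s u : subseq u s -> chn A s -> chn A u.
Proof.
move=> su /andP[p a]; apply/andP; split; first exact: subseq_path B_lt_trans _ _ _ su p.
by apply/allP=> x xu; apply: (allP a); apply: mem_subseq su x xu.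
Qed.

Lemma chn_lt A x s : B_lt A x -> chn x s -> chn A s.
Proof.
move=> lt /andP[p a]; apply/andP; split=> //.
by case: s p {a} => //= y s /andP[h ->]; rewrite (B_lt_trans lt h).
Qed.

Lemma chn_cons A x s : chn A (x :: s) = [&& B_lt A x, in_B x, x != one & chn x s].
Proof. by rewrite /chn /=; case: (B_lt A x) => //=; rewrite andbCA !andbA. Qed.

Lemma chn_head A s : in_B A -> A != one -> chn A s -> B_lt A (head one s) /\ in_B (head one s).
Proof.
move=> iA nA; case: s => [|x s] /=; last by rewrite chn_cons => /and4P[].
by split; [rewrite /B_lt /= nA; apply: ple_one | apply: in_B_one].
Qed.

(** The union of the stars of the atoms of [A, 1] labelled by [Q], cut off below the top. The
    default [one] of [head] puts the empty chain in it exactly when [Q] is nonempty, as for an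
    augmented complex. *)
Definition inD A (Q : {set label}) s :=
  chn A s && [exists b in Q, ple (addl A b) (head one s)].

Lemma head_subseq A s u : chn A s -> subseq u s -> ple (head one s) (head one u).
Proof.
case: u => [|y u]; first by move=> *; apply: ple_one.
case: s => [|x s] //= /andP[/= /andP[_ p] _].
case: eqP => [-> _|_ su]; first exact: ple_refl.
have := order_path_min B_lt_trans p => /allP h.
by have /andP[] := h y (mem_subseq su (mem_head _ _)).
Qed.

Lemma inD_face A Q s i : inD A Q s -> inD A Q (face i s).
Proof.
move=> /andP[cs /exists_inP[b bQ lb]]; apply/andP; split.
  exact: chn_subseq (face_subseq i s) cs.
apply/exists_inP; exists b => //; apply: ple_trans lb _.
exact: head_subseq cs (face_subseq i s).
Qed.

Definition down_closed A (Q : {set label}) :=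
  (forall b, b \in Q -> avoid A b) /\
  (forall b c, b \in Q -> avoid A c -> (forall j, c j <= b j)%N -> c \in Q).

Lemma label_le_eq b c : (forall j, b j <= c j)%N -> (\sum_j c j <= \sum_j b j)%N -> b = c.
Proof.
move=> h le; apply/ffunP=> j; apply/val_inj/eqP; rewrite eqn_leq h /=.
rewrite leqNgt; apply/negP=> lt; move: le; rewrite leqNgt; case/negP.
rewrite (bigD1 j) //= [X in (_ < X)%N](bigD1 j) //= -addSn leq_add //.
by apply: leq_sum => i _.
Qed.

Definition below A b : {set label} := [set e | avoid (addl A b) e && [exists j, (e j < b j)%N]].

Lemma below_down_closed A b : down_closed (addl A b) (below A b).
Proof.
split=> [e|e c]; rewrite !inE => /andP[] // _ /existsP[j lt] -> le.
by apply/existsP; exists j; apply: leq_ltn_trans (le j) lt.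
Qed.

Section AddAtom.

Variables (A : point) (Q : {set label}) (b : label).
Hypothesis (iA : in_B A) (dQ : down_closed A Q) (bQ : b \in Q).
Hypothesis b_max : forall c, c \in Q -> (\sum_j c j <= \sum_j b j)%N.

Lemma remove_max_down_closed : down_closed A (Q :\ b).
Proof.
have [q1 q2] := dQ; split=> [c|c d]; rewrite !inE => /andP[nc cQ]; first exact: q1.
move=> av le; rewrite (q2 c) // andbT; apply: contraNneq nc => e.
by apply/eqP/esym/label_le_eq; [move=> j; rewrite -e | apply: b_max].
Qed.

(* The atoms below the maximal label b cut the star of addl A b in the union of
   the stars of the atoms of [addl A b, 1] with a label that descends from b. *)
Lemma inD_below s : addl A b != one -> chn (addl A b) s ->
  inD A (Q :\ b) s = inD (addl A b) (below A b) s.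
Proof.
move=> nx cs; have [q1 q2] := dQ.
have av := q1 b bQ; have ix := addl_in_B iA av.
have [lty iy] := chn_head ix nx cs; have /andP[_ /forallP lexy] := lty.
have leAy : ple A (head one s) by apply: ple_trans (ple_addl A b) _; apply/forallP.
rewrite /inD cs (chn_lt (B_lt_addl av) cs) /=.
apply/exists_inP/exists_inP => -[c].
  rewrite !inE => /andP[nc cQ]; rewrite ple_addlP => /andP[_ /forallP cy].
  have [j ltj] : exists j, (c j < b j)%N.
    apply/existsP; apply: contraNT nc => /existsPn h.
    apply/eqP/esym/label_le_eq; last exact: b_max.
    by move=> j; rewrite leqNgt h.
  have pick i : exists u, (u \in head one s i) && (u \notin addl A b i) by apply: B_lt_diff.
  have [f fP] := fin_all_exists pick.
  (* One descending coordinate is enough; the others take any element of the least member of the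
     chain that [addl A b] misses. *)
  exists [ffun i => if i == j then c j else f i].
    rewrite inE; apply/andP; split; last by apply/existsP; exists j; rewrite ffunE eqxx.
    apply/forallP=> i; rewrite [X in X \notin _]ffunE; case: eqP => [->|_]; last by have /andP[] := fP i.
    rewrite ffunE !inE negb_or -val_eqE (ltn_eqF ltj) /=.
    by have /forallP := q1 c cQ.
  rewrite ple_addlP; apply/andP; split; first exact/forallP.
  by apply/forallP=> i; rewrite ffunE; case: eqP => [->|_] //; have /andP[] := fP i.
rewrite inE => /andP[/forallP avc /existsP[j ltj]]; rewrite ple_addlP => /andP[_ /forallP cy].
(* The coordinatewise minimum of c and b lies below b, hence in [Q], and differs from b at j. *)
pose d : label := [ffun i => if (c i < b i)%N then c i else b i].
exists d; last first.
  rewrite ple_addlP leAy; apply/forallP=> i; rewrite ffunE; case: ifP => // _.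
  by apply: (subsetP (lexy i)); rewrite ffunE setU11.
rewrite !inE; apply/andP; split.
  by apply: contraTneq ltj => e; rewrite -leqNgt -e ffunE; case: ltnP.
apply: (q2 b) => // [|i]; last by rewrite ffunE; case: ltnP => // /ltnW.
apply/forallP=> i; rewrite ffunE; case: ifP => // _; last by have /forallP := av.
by have := avc i; rewrite ffunE !inE negb_or => /andP[].
Qed.

End AddAtom.

(** The induction is on the corank r of A and then on the size of [Q]. One atom x is split off: the
    remaining union is treated by the inner hypothesis, the star of x is a cone, and their
    intersection, a union of the same kind above x by [inD_below], is treated by the outer one. The
    three primitives are glued as in a Mayer-Vietoris argument. *)
Lemma segre_acyclic r : forall A (Q : {set label}) k (psi : seq point -> rat),
    in_B A -> n = (prk A + r)%N -> down_closed A Q -> (k < r)%N ->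
    (forall s, inD A Q s -> (size s <= k)%N -> cobd psi s = 0) ->
  exists theta, forall s, inD A Q s -> (size s < k)%N -> psi s = cobd theta s.
Proof.
elim: r => [//|r IHr] A Q k psi iA nE dQ kr; have [m] := ubnP #|Q|.
elim: m => // m IHm in Q psi dQ * => szQ cpsi.
case: k kr cpsi IHm => [|k] kr cpsi IHm; first by exists (fun=> 0).
have [Q0|[b0 b0Q]] := set_0Vmem Q.
  exists (fun=> 0) => s /andP[_ /exists_inP[b]].
  by rewrite Q0 inE.
(* The coordinate sum strictly refines the componentwise order, so removing a label of maximal sum
   keeps [Q] down-closed. *)
have [b bQ b_max] : exists2 b, b \in Q & forall c, c \in Q -> (\sum_j c j <= \sum_j b j)%N.
  by case: (@arg_maxnP _ b0 (mem Q) (fun c : label => \sum_j c j)%N b0Q) => b bQ bm; exists b.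
have [q1 q2] := dQ; have av := q1 b bQ.
have [||theta0 t0E] := IHm (Q :\ b) psi (remove_max_down_closed dQ b_max).
- by move: szQ; rewrite (cardsD1 b) bQ.
- move=> s /andP[cs /exists_inP[c]]; rewrite inE => /andP[_ cQ] h.
  by apply: cpsi; apply/andP; split=> //; apply/exists_inP; exists c.
pose psi1 s := psi s - cobd theta0 s.
have cpsi1 s : inD A Q s -> (size s <= k.+1)%N -> cobd psi1 s = 0.
  by move=> h1 h2; rewrite cobdB cobd_cobd subr0 cpsi.
have psi1_0 s : inD A (Q :\ b) s -> (size s < k.+1)%N -> psi1 s = 0.
  by move=> h1 h2; rewrite /psi1 t0E // subrr.
pose x := addl A b; have ix := addl_in_B iA av.
have rkx : n = (prk x + r)%N by rewrite /x prk_addl // nE addSnnS.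
have nx : x != one.
  by apply/eqP => e; move: rkx; rewrite e prk_one; case: (r) kr; lia.
have cone s : chn x s -> inD A Q (x :: s).
  move=> cs; rewrite /inD chn_cons B_lt_addl // ix nx cs /=.
  by apply/exists_inP; exists b; rewrite ?ple_refl.
(* Coning by x: the cocycle condition at x :: s says that [theta1] is a primitive of [psi1] on
   chains above x. *)
pose theta1 s := psi1 (x :: s).
have t1E s : chn x s -> (size s < k.+1)%N -> psi1 s = cobd theta1 s.
  move=> cs hs; have := cpsi1 (x :: s) (cone s cs) hs; rewrite /=.
  by move/eqP; rewrite subr_eq0 => /eqP.
have inDb := inD_below iA dQ bQ b_max nx.
have [||eta etaE] := IHr x (below A b) k theta1 ix rkx (below_down_closed A b).
- by rewrite -ltnS.
- move=> s hs szs; have cs : chn x s by case/andP: hs.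
  by rewrite -t1E // psi1_0 // inDb.
(* Subtracting the coboundary of [eta] makes the primitive vanish on the intersection with the other
   stars, so it extends by 0 to them; the value on x :: u compensates for this subtraction inside
   the star. *)
pose theta2 s := if chn x s then theta1 s - cobd eta s
                 else if s is y :: u then (if y == x then - eta u else 0) else 0.
exists (fun s => theta0 s + theta2 s) => s hs szs.
rewrite cobdD; apply/eqP; rewrite addrC -subr_eq; apply/eqP; rewrite -/(psi1 s).
have face_chn u i : chn x u -> chn x (face i u) by apply/chn_subseq/face_subseq.
have [cxs|ncxs] := boolP (chn x s).
  rewrite (eq_cobd (phi := fun u => theta1 u - cobd eta u)); last first.
    by move=> i _; rewrite /theta2 face_chn.
  by rewrite cobdB cobd_cobd subr0 t1E.
case: s hs szs ncxs => [//|y s] hs szs ncxs.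
have /andP[cs _] := hs.
have /and4P[ltAy iy ny cys] : [&& B_lt A y, in_B y, y != one & chn y s] by rewrite -chn_cons.
have [yx|nyx] := eqVneq y x.
  rewrite yx in cys *; rewrite /= {1}/theta2 cys.
  rewrite (eq_cobd (psi := fun u => theta2 (x :: u)) (phi := fun u => - eta u)); last first.
    move=> i _; rewrite /theta2 chn_cons /B_lt /= eqxx.
    by [].
  by rewrite cobdN opprK subrK.
have hs' : inD A (Q :\ b) (y :: s).
  case/andP: hs => _ /exists_inP[c cQ lc]; apply/andP; split=> //; apply/exists_inP; exists c => //.
  rewrite !inE cQ andbT; apply: contraNneq ncxs => e; rewrite chn_cons iy ny cys /B_lt /= eq_sym nyx.
  by rewrite e in lc; rewrite !andbT.
rewrite psi1_0 // cobdE big1 // => i _.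
suff -> : theta2 (face i (y :: s)) = 0 by rewrite mulr0.
rewrite /theta2; have [cf|_] := boolP (chn x _).
  rewrite etaE ?subrr //; first by rewrite -inDb // inD_face.
  by rewrite size_face //=; apply: szs.
case ef : (face i (y :: s)) => [//|z u]; case: eqP => // zx.
exfalso.
(* Only deleting the head y can leave a chain starting with x; then y would lie strictly between A
   and x, whose ranks differ by one. *)
case: (val i) ef => [|i'] /=; last by rewrite /face /= => -[e _]; rewrite e zx eqxx in nyx.
rewrite /face /= drop0 => es; rewrite es zx chn_cons in cys.
have /and4P[lyx _ _ _] := cys.
have h1 := B_lt_prk iA iy ltAy; have := B_lt_prk iy ix lyx; rewrite /x prk_addl // ltnS => h2.
by have := leq_trans h1 h2; rewrite ltnn.
Qed.

End SegreAcyclic.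

(** * Vanishing below the top degree and the Hopf trace formula *)

Section SegreHomology.

Variables (n t : nat) (t_gt0 : (0 < t)%N).

Local Notation point := {ffun 'I_t -> {set 'I_n}}.
Local Notation chain d := (chain n t d).
Local Notation G := [set: SnT n t].

Let zero : point := [ffun=> set0].

Lemma chn_zero (s : seq point) : chn zero s = is_chain s.
Proof.
have z_lt (x : point) : x != zero -> B_lt zero x.
  move=> nx; rewrite /B_lt /= eq_sym nx; apply/forallP=> j.
  by rewrite ffunE sub0set.
apply/andP/andP => [[p a]|[a p]]; split.
- apply/allP=> x xs; have /andP[ix nx] := allP a x xs.
  apply/and3P; split=> //; have := order_path_min (@B_lt_trans n t) p.
  by move/allP/(_ x xs)/andP; rewrite eq_sym => -[].
- exact: path_sorted p.
- rewrite path_min_sorted //; apply/allP=> x xs; apply: z_lt.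
  by have /and3P[] := allP a x xs.
by apply: sub_all a => x /and3P[-> _ ->].
Qed.

Lemma chain_inD (s : seq point) : (0 < n)%N -> is_chain s -> inD zero setT s.
Proof.
move=> n_gt0; rewrite -chn_zero => cs; rewrite /inD cs /=.
have iz : in_B zero by apply/forallP=> i; apply/forallP=> j; rewrite !ffunE.
have nz : zero != [ffun=> setT].
  apply/eqP=> /ffunP/(_ (Ordinal t_gt0)); rewrite !ffunE => /setP/(_ (Ordinal n_gt0)).
  by rewrite !inE.
have [lth ih] := chn_head iz nz cs.
have [f fP] := fin_all_exists (fun j => B_lt_diff t_gt0 j iz ih lth).
apply/exists_inP; exists [ffun j => f j]; rewrite ?inE // ple_addlP.
apply/andP; split; apply/forallP=> j; first by rewrite ffunE sub0set.
by rewrite ffunE; have /andP[] := fP j.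
Qed.

(** Extension by zero to all sequences; the sum has at most one term. *)
Definition cochain d (f : chain d -> rat) (s : seq point) : rat :=
  \sum_(c : chain d | (val (val c) : seq point) == s) f c.

Lemma cochainE d (f : chain d -> rat) c : cochain f (val (val c)) = f c.
Proof.
by rewrite /cochain (big_pred1 c).
Qed.

Lemma cochain_size d (f : chain d -> rat) s : size s != d -> cochain f s = 0.
Proof.
move=> ns; apply: big_pred0 => c; apply: contraNF ns => /eqP <-.
by rewrite size_tuple.
Qed.

Lemma is_chain_face i (s : seq point) : is_chain s -> is_chain (face i s).
Proof. by rewrite -!chn_zero; apply: chn_subseq; apply: face_subseq. Qed.

Lemma chain_of d (s : seq point) : is_chain s -> size s = d -> {c : chain d | val (val c) = s :> seq _}.
Proof.
move=> cs /eqP sz; have cs' : is_chain (Tuple sz) by [].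
by exists (exist _ (Tuple sz) cs').
Qed.

Lemma sum_incidence d (f : chain d.-1 -> rat) (c : chain d) :
  \sum_c' incidence c c' * f c' = cobd (cochain f) (val (val c)).
Proof.
rewrite cobdE size_tuple; under eq_bigr => c' _ do rewrite mulr_suml.
rewrite exchange_big /=; apply: eq_bigr => i _; rewrite mulr_sumr [RHS]big_mkcond /=.
apply: eq_bigr => c' _; rewrite -mulrA; case: eqP => _; first by rewrite mul1r.
by rewrite mul0r mulr0.
Qed.

(** Membership in the row space of a boundary is tested against its cokernel. The columns of the
    cokernel are cocycles, so [segre_acyclic] makes each of them [boundary n t d] times a vector,
    which the cycles annihilate. *)
Lemma homology_vanishing d : (d.+1 < n)%N -> (cycles n t d <= boundaries n t d)%MS.
Proof.
move=> dn; rewrite genmxE submxE; apply/eqP/matrixP=> i k; rewrite [RHS]mxE.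
pose K := cokermx (boundary n t d.+1).
pose f (c : chain d) := K (enum_rank c) k.
have cocycle s : inD zero setT s -> (size s <= d.+1)%N -> cobd (cochain f) s = 0.
  move=> /andP[cs _]; rewrite chn_zero in cs; rewrite leq_eqVlt => /orP[/eqP sz|sz]; last first.
    rewrite cobdE big1 // => l _; rewrite cochain_size ?mulr0 // size_face //.
    by case: (size s) sz l => [|m] //= h [l]; lia.
  have [c cE] := chain_of cs sz; rewrite -cE -(@sum_incidence d.+1 f c).
  have := congr1 (fun M : 'M_ _ => M (enum_rank c) k) (mulmx_coker (boundary n t d.+1)).
  rewrite /= !mxE => e; rewrite -[RHS]e (big_enum_val _ (A := chain d)) /=.
  by apply: eq_bigr => l _; rewrite mxE enum_rankK /f enum_valK.
have iz : in_B zero by apply/forallP=> u; apply/forallP=> v; rewrite !ffunE.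
have n0 : (0 < n)%N by apply: leq_trans dn.
have [||theta tE] := @segre_acyclic n t t_gt0 n zero setT d.+1 (cochain f) iz _ _ dn cocycle.
- by rewrite /prk ffunE cards0.
- split=> [b _|b c _ _ _]; rewrite ?inE //.
  by apply/forallP=> j; rewrite ffunE inE.
pose g : 'cV[rat]_#|chain d.-1| := \col_l theta (val (val (enum_val l))).
have fE : col k K = boundary n t d *m g.
  apply/colP=> l; rewrite mxE [RHS]mxE.
  have -> : K l k = f (enum_val l) by rewrite /f enum_valK.
  rewrite -(cochainE f) tE ?chain_inD ?(valP (enum_val l)) ?size_tuple //.
  rewrite cobdE size_tuple; under [RHS]eq_bigr => m _ do rewrite !mxE /incidence mulr_suml.
  rewrite exchange_big /=; apply: eq_bigr => j _.
  under [RHS]eq_bigr => m _ do rewrite -mulrA.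
  rewrite -mulr_sumr; congr (_ * _).
  have [||c cE] := @chain_of d.-1 (face j (val (val (enum_val l)))).
  - exact/is_chain_face/(valP (enum_val l)).
  - by rewrite size_face size_tuple.
  rewrite (bigD1 (enum_rank c)) //= enum_rankK cE eqxx mul1r big1 ?addr0 // => m ne.
  case: eqP => [e|_]; last by rewrite mul0r.
  case/eqP: ne; rewrite -[m]enum_valK; congr enum_rank; do 2!apply: val_inj.
  exact: etrans e (esym cE).
have -> : (cycles n t d *m K) i k = (cycles n t d *m col k K) i 0.
  by rewrite !mxE; apply: eq_bigr => l _; rewrite !mxE.
by rewrite fE mulmxA mulmx_ker mul0mx mxE.
Qed.

Lemma card_chain_top d : (n <= d)%N -> (0 < n)%N -> #|{: chain d}| = 0%N.
Proof.
move=> led n_gt0; apply: eq_card0 => c; exfalso.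
have : chn zero (val (val c)) by rewrite chn_zero (valP c).
have sz : size (val (val c)) = d by rewrite size_tuple.
have bound (s : seq point) (A : point) : in_B A -> chn A s -> A != [ffun=> setT] -> (prk t_gt0 A + size s < n)%N.
  elim: s A => [|x s IHs] A iA cs nA.
    rewrite addn0; have := B_lt_prk t_gt0 iA (in_B_one n t).
    rewrite prk_one; apply; rewrite /B_lt /= nA; exact: ple_one.
  move: cs; rewrite chn_cons => /and4P[lt ix nx cs].
  have := IHs x ix cs nx; have := B_lt_prk t_gt0 iA ix lt => /=; lia.
move=> /bound; rewrite sz => h; have iz : in_B zero by apply/forallP=> i; apply/forallP=> j; rewrite !ffunE.
have nz : zero != [ffun=> setT].
  apply/eqP=> /ffunP/(_ (Ordinal t_gt0)); rewrite !ffunE => /setP/(_ (Ordinal n_gt0)).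
  by rewrite !inE.
by have := h iz nz; lia.
Qed.

Definition cycle_trace d (g : SnT n t) : rat :=
  \tr (submod_repr (cycles_module n t d) g).

Lemma boundary_boundary d : boundary n t d.+1 *m boundary n t d = 0.
Proof.
apply/matrixP=> i k; rewrite !mxE.
pose phi (s : seq point) : rat := ((val (val (enum_val k)) : seq point) == s)%:R.
pose f (c : chain d) := incidence c (enum_val k).
transitivity (\sum_(c : chain d) @incidence n t d.+1 (enum_val i) c * f c).
  rewrite [RHS](big_enum_val _ (A := chain d)) /=.
  by apply: eq_bigr => l _; rewrite !mxE.
rewrite (@sum_incidence d.+1 f) -[RHS](cobd_cobd phi (val (val (enum_val i)))).
apply: eq_cobd => l; rewrite size_tuple => ltl.
have [||c cE] := @chain_of d (face l (val (val (enum_val i)))).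
- exact/is_chain_face/(valP (enum_val i)).
- by rewrite size_face size_tuple.
by rewrite -cE cochainE cobdE size_tuple.
Qed.

Lemma cycle_trace0 g : cycle_trace 0 g = \tr (chain_repr n t 0 g).
Proof.
rewrite /cycle_trace mxtrace_submod1 ?inE //.
apply/eqmxP; rewrite submx1 sub1mx /row_full mxrank_ker.
have -> : boundary n t 0 = 0 by apply/matrixP=> c c'; rewrite !mxE /incidence big_ord0.
by rewrite mxrank0 subn0 eqxx.
Qed.

(** By [homology_vanishing] the image of the boundary consists of all cycles one degree lower, so
    the chains are an extension of these by the cycles of their own degree. *)
Lemma cycle_traceS d g : (d.+1 < n)%N ->
  \tr (chain_repr n t d.+1 g) = cycle_trace d.+1 g + cycle_trace d g.
Proof.
move=> dn.
apply: (mxtrace_exact (D := boundary n t d.+1) (R' := chain_repr n t d g)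
   (K := val_submod (1%:M : 'M_(\rank (cycles n t d.+1))))
   (I := val_submod (1%:M : 'M_(\rank (cycles n t d))))).
- exact: (boundary_act d.+1).
- exact: val_submod1_free.
- exact: val_submod1.
- by rewrite -val_submod1J ?inE.
- exact: val_submod1_free.
- apply: eqmx_trans (val_submod1 _) _; apply/eqmxP/andP; split.
    by have := homology_vanishing dn; rewrite genmxE.
  by rewrite sub_kermx boundary_boundary.
by rewrite -val_submod1J ?inE.
Qed.

Lemma cycle_trace_sum d g : (d < n)%N ->
  cycle_trace d g = \sum_(e < d.+1) (-1) ^+ (d - e) * \tr (chain_repr n t e g).
Proof.
elim: d => [|d IHd] dn; first by rewrite big_ord1 subnn expr0 mul1r cycle_trace0.
rewrite big_ord_recr /= subnn expr0 mul1r cycle_traceS // [RHS]addrC -[LHS]addr0 -!addrA.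
congr (_ + _); apply/esym/eqP; rewrite addr_eq0 IHd ?(ltnW dn) // -sumrN.
apply/eqP/eq_bigr => e _; rewrite subSn; last by rewrite -ltnS ltn_ord.
rewrite exprS mulN1r mulNr opprK.
by [].
Qed.

Lemma top_homology_charE g : (0 < n)%N ->
  top_homology_char n t g =
  \sum_(d < n) (-1) ^+ (n.-1 - d) * #|[set c : chain d | chain_act c g == c]|%:R.
Proof.
move=> n_gt0.
(* Ranks strictly increase along a chain of the proper part, so it has at most n - 1 elements and
   nothing bounds in the top degree. *)
have U0 : boundaries n t n.-1 = 0.
  apply/eqP; rewrite -mxrank_eq0 genmxE -leqn0 (leq_trans (rank_leq_row _)) //.
  by rewrite (@card_chain_top n.-1.+1) ?prednK.
rewrite /top_homology_char /homology_char cfunE inE mulr1n map_reprE trace_map_mx.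
rewrite mxtrace_section0 ?inE // -/(cycle_trace n.-1 g) cycle_trace_sum ?prednK //.
rewrite rmorph_sum; apply: eq_bigr => d _.
by rewrite rmorphM rmorphXn rmorphN1 /= mxtrace_act rmorph_nat.
Qed.

End SegreHomology.

(** * Chains fixed by a permutation tuple *)

Section FixedFunctions.

Variable n : nat.

Definition fixfun m (a : 'I_m -> nat) (h : 'S_n) : {set {ffun 'I_n -> 'I_m}} :=
  [set r : {ffun 'I_n -> 'I_m} | [forall i, #|[set x | r x == i]| == a i] && [forall x, r (h x) == r x]].

(** Permuting block names so that the sizes become decreasing turns these functions into tabloids;
    the count thus depends on a composition only through the partition it sorts to. *)
Lemma card_fixfun_tabloid m (a : 'I_m -> nat) (h : 'S_n) (la : intpart n) :
    perm_eq [seq a i | i : 'I_m] (parts la) ->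
  #|fixfun a h| = #|[set r : tabloid la | tabloid_act r h == r]|.
Proof.
move=> pa.
have sz : m = ell la.
  by rewrite /ell -(perm_size pa) size_map size_enum_ord.
have [p pE] : exists p : 'I_m -> 'I_m, injective p /\ forall i, a i = part la (p i).
  have /tuple_permP[p e] : perm_eq [tuple a i | i < m] [tuple part la i | i < m].
    rewrite (_ : val [tuple part la i | i < m] = parts la) //.
    apply: (@eq_from_nth _ 0%N); first by rewrite size_tuple sz.
    move=> i; rewrite size_tuple => hi.
    by rewrite -[i]/(val (Ordinal hi)) -tnth_nth tnth_mktuple.
  exists p; split; first exact: perm_inj.
  move=> i; have := congr1 (fun s => nth 0%N s i) e.
  by rewrite -!tnth_nth !tnth_mktuple.
case: pE => p_inj pE.
have lemn : (m <= n)%N by rewrite sz ell_le.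
pose q i := widen_ord lemn (p i).
have q_inj : injective q by move=> i j /(congr1 val) /= /val_inj/p_inj.
pose H (r : {ffun 'I_n -> 'I_m}) : {ffun 'I_n -> 'I_n} := [ffun x => q (r x)].
have H_inj : injective H.
  by move=> r r' /ffunP e; apply/ffunP=> x; have := e x; rewrite !ffunE => /q_inj.
rewrite -(card_imset _ H_inj) -[RHS](card_imset _ val_inj); apply: eq_card => r.
apply/imsetP/imsetP => [[r']|[s]].
  rewrite inE => /andP[/forallP fib /forallP inv] rE.
  have isT : [forall i : 'I_n, #|[set x | r x == i]| == part la i].
    apply/forallP=> i; case: (pickP (fun k => q k == i)) => [k /eqP <-|none].
      have /eqP := fib k; rewrite pE -[part la (q k)]/(part la (p k)) => <-.
      by apply/eqP/eq_card => x; rewrite !inE rE ffunE (inj_eq q_inj).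
    rewrite (_ : [set x | _] = set0); last first.
      by apply/setP=> x; rewrite !inE rE ffunE none.
    rewrite cards0 eq_sym; apply/eqP; apply: part_default; rewrite -sz leqNgt; apply/negP=> lti.
    have := none (invF p_inj (Ordinal lti)).
    by rewrite -val_eqE /= f_invF eqxx.
  exists (exist (fun r : {ffun 'I_n -> 'I_n} => [forall i : 'I_n, #|[set x | r x == i]| == part la i]) r isT) => //.
  rewrite inE; apply/eqP/val_inj/ffunP=> x; rewrite /= ffunE rE !ffunE; congr q; apply/esym/eqP.
  by have := inv (h^-1 x)%g; rewrite permKV.
rewrite inE => /eqP inv rE.
have fib := valP s; move/forallP: fib => fib.
have lt x : (r x < m)%N.
  rewrite ltnNge sz; apply/negP=> /part_default e.
  have := fib (r x); rewrite e cards_eq0 => /eqP/setP/(_ x).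
  by rewrite !inE rE eqxx.
have Hr : H [ffun x => invF p_inj (Ordinal (lt x))] = r.
  by apply/ffunP=> x; rewrite !ffunE; apply/val_inj; rewrite /= f_invF.
exists [ffun x => invF p_inj (Ordinal (lt x))]; rewrite ?Hr // inE; apply/andP; split.
  apply/forallP=> i; rewrite pE; have := fib (q i); rewrite -[part la (q i)]/(part la (p i)) => /eqP <-.
  apply/eqP/eq_card => x; rewrite !inE ffunE -rE.
  by rewrite -(inj_eq p_inj) f_invF -!val_eqE.
apply/forallP=> x; rewrite !ffunE; apply/eqP; congr (invF p_inj _); apply/val_inj.
have := congr1 (fun s : tabloid la => val s (h x)) inv; rewrite /= ffunE permK => e.
by rewrite /= rE e.
Qed.

End FixedFunctions.

Lemma count_initial (T : eqType) (r : rel T) (a : pred T) (s : seq T) x0 i :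
    pairwise r s -> (forall x y, r x y -> a y -> a x) -> (i < size s)%N ->
  a (nth x0 s i) = (i < count a s)%N.
Proof.
move=> pr ra; elim: s pr i => //= x s IHs /andP[/allP xr pr] i lti.
have [ax|nax] := boolP (a x).
  by case: i lti => [|i] lti /=; rewrite ?ax // add1n ltnS IHs.
have na y : y \in s -> a y = false.
  by move=> ys; apply: contraNF nax; apply: ra; apply: xr.
have -> : count a s = 0%N.
  by apply/eqP; rewrite -leqn0 leqNgt -has_count; apply/hasPn=> y ys; rewrite na.
case: i lti => [|i] lti /=; first by rewrite (negPf nax).
by rewrite na // mem_nth.
Qed.

Section FixedChains.

Variables (n t : nat) (t_gt0 : (0 < t)%N) (n_gt0 : (0 < n)%N) (d : nat).

Local Notation point := {ffun 'I_t -> {set 'I_n}}.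
Local Notation code := {ffun 'I_t -> {ffun 'I_n -> 'I_d.+1}}.

Let j0 : 'I_t := Ordinal t_gt0.
Let zero : point := [ffun=> set0].
Let one : point := [ffun=> setT].

Definition full (c : seq point) : seq point := zero :: rcons c one.

Lemma zero_neq_one : zero != one.
Proof.
apply/eqP=> /ffunP/(_ j0); rewrite !ffunE => /setP/(_ (Ordinal n_gt0)).
by rewrite !inE.
Qed.

Lemma full_pairwise c : is_chain c -> pairwise (@B_lt n t) (full c).
Proof.
rewrite -chn_zero => /andP[p a]; rewrite -path_pairwise; last exact: B_lt_trans.
rewrite rcons_path p /=; apply/andP; split; last exact: ple_one.
have := mem_last zero c; rewrite inE => /orP[/eqP ->|h]; first exact: zero_neq_one.
by have /andP[] := allP a _ h.
Qed.

Lemma full_in_B c : is_chain c -> all (@in_B n t) (full c).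
Proof.
rewrite -chn_zero => /andP[_ a]; rewrite /full /= all_rcons.
rewrite (_ : in_B zero); last by apply/forallP=> i; apply/forallP=> j; rewrite !ffunE.
rewrite in_B_one /=.
by apply: sub_all a => x /andP[].
Qed.

Definition pos (c : seq point) (j : 'I_t) (e : 'I_n) : nat :=
  count (fun x : point => e \notin x j) c.

Lemma mem_full c k j e : is_chain c -> (k < (size c).+2)%N ->
  (e \in nth zero (full c) k j) = (pos c j e < k)%N.
Proof.
move=> cc lek.
have := @count_initial _ (@B_lt n t) (fun x : point => e \notin x j) (full c) zero k (full_pairwise cc).
rewrite /full /= size_rcons => /(_ _ lek) h; apply: negb_inj; rewrite h; last first.
  by move=> x y /andP[_ /forallP/(_ j)/subsetP s]; apply: contra; apply: s.
rewrite -cats1 count_cat /= ffunE inE !ffunE inE /= !addn0 add1n -leqNgt.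
by rewrite ltnS.
Qed.

(** In each coordinate a chain is a flag of d sets, recorded by the step at which every element
    enters: value i means that member i + 1 of [full] is the first to contain it. This is an ordered
    set partition into d + 1 blocks for each coordinate. *)
Definition enc (c : chain n t d) : code := [ffun j => [ffun e => inord (pos (val (val c)) j e)]].

Lemma encE c j e : enc c j e = pos (val (val c)) j e :> nat.
Proof. by rewrite !ffunE inordK // ltnS -[X in (_ <= X)%N](size_tuple (val c)) count_size. Qed.

Definition lev (R : code) j k : {set 'I_n} := [set e | (R j e < k)%N].
Definition fib (R : code) j (i : 'I_d.+1) : {set 'I_n} := [set e | R j e == i].

Lemma levS R j (i : 'I_d.+1) : #|lev R j i.+1| = (#|lev R j i| + #|fib R j i|)%N.
Proof.
have -> : lev R j i.+1 = lev R j i :|: fib R j i.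
  by apply/setP=> e; rewrite !inE ltnS leq_eqVlt orbC -val_eqE.
rewrite cardsU (_ : _ :&: _ = set0) ?cards0 ?subn0 //; apply/setP=> e; rewrite !inE.
by apply/negP=> /andP[lt /eqP ee]; rewrite ee ltnn in lt.
Qed.

Lemma lev_enc c j k : (k < d.+2)%N -> lev (enc c) j k = nth zero (full (val (val c))) k j.
Proof.
move=> h; apply/setP=> e; rewrite inE encE mem_full ?size_tuple //.
exact: (valP c).
Qed.

(** Block sizes common to all coordinates express the equal cardinalities required by [in_B], and
    nonempty blocks express strict inclusions. *)
Definition good (R : code) :=
  [forall j, forall i, (#|fib R j i| == #|fib R j0 i|) && (0 < #|fib R j i|)%N].

Lemma enc_good c : good (enc c).
Proof.
have cc : is_chain (val (val c)) := valP c.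
have iB k : (k < d.+2)%N -> in_B (nth zero (full (val (val c))) k).
  move=> h; apply: (allP (full_in_B cc)); apply: mem_nth.
  by rewrite /= size_rcons size_tuple.
have cl j k : (k < d.+2)%N -> #|lev (enc c) j k| = prk t_gt0 (nth zero (full (val (val c))) k).
  by move=> h; rewrite lev_enc // (in_B_card t_gt0) // iB.
have cf j (i : 'I_d.+1) : (prk t_gt0 (nth zero (full (val (val c))) i.+1) =
    prk t_gt0 (nth zero (full (val (val c))) i) + #|fib (enc c) j i|)%N.
  have h1 : (i.+1 < d.+2)%N by rewrite ltnS.
  have h2 : (i < d.+2)%N := leqW (ltn_ord i).
  by have := levS (enc c) j i; rewrite (cl j _ h1) (cl j _ h2).
apply/forallP=> j; apply/forallP=> i; apply/andP; split.
  by rewrite -(eqn_add2l (prk t_gt0 (nth zero (full (val (val c))) i))) -!cf.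
have := cf j i; have : (prk t_gt0 (nth zero (full (val (val c))) i) <
    prk t_gt0 (nth zero (full (val (val c))) i.+1))%N.
  have h1 : (i.+1 < d.+2)%N by rewrite ltnS.
  have h2 : (i < d.+2)%N := leqW (ltn_ord i).
  apply: B_lt_prk; [exact: iB | exact: iB |].
  have /(pairwiseP zero) h := full_pairwise cc.
  by apply: h; rewrite ?inE /= ?size_rcons ?size_tuple.
by move=> h1 h2; move: h1; rewrite h2 -{1}[prk _ _]addn0 ltn_add2l.
Qed.

Lemma enc_inj : injective enc.
Proof.
move=> c c' e; do 2!apply: val_inj; apply: (@eq_from_nth _ zero); first by rewrite !size_tuple.
move=> i; rewrite size_tuple => lti.
have nE (u : chain n t d) : nth zero (val (val u)) i = nth zero (full (val (val u))) i.+1.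
  by rewrite /= nth_rcons size_tuple lti.
rewrite !nE; apply/ffunP=> j; rewrite -!lev_enc ?e // !ltnS ltnW //.
Qed.

Lemma enc_surj R : good R -> exists c, enc c = R.
Proof.
move=> /forallP gR.
have gf j i : #|fib R j i| = #|fib R j0 i| by have /forallP/(_ i)/andP[/eqP] := gR j.
have gp j i : (0 < #|fib R j i|)%N by have /forallP/(_ i)/andP[] := gR j.
have gl j k : (k < d.+2)%N -> #|lev R j k| = #|lev R j0 k|.
  have l0 j' : lev R j' 0 = set0 by apply/setP=> e; rewrite !inE.
  elim: k => [_|k IHk lt]; first by rewrite !l0.
  have lt' : (k < d.+1)%N by rewrite -ltnS.
  by rewrite (levS _ _ (Ordinal lt')) (levS _ j0 (Ordinal lt')) /= IHk ?gf // ltnW.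
pose s : seq point := mkseq (fun i => [ffun j => lev R j i.+1]) d.
have nthE i : (i < d)%N -> nth zero s i = [ffun j => lev R j i.+1] by move=> h; rewrite nth_mkseq.
have szs : size s = d by rewrite size_mkseq.
have cs : is_chain s.
  apply/andP; split.
    apply/allP=> x /(nthP zero)[i]; rewrite szs => lti <-; rewrite nthE //; apply/and3P; split.
    - by apply/forallP=> j; apply/forallP=> j'; rewrite !ffunE (gl j) ?(gl j') // !ltnS ltnW.
    - apply/eqP=> /ffunP/(_ j0); rewrite !ffunE => e.
      have /card_gt0P[u] := gp j0 ord0; rewrite inE => /eqP eu.
      by move/setP: e => /(_ u); rewrite !inE eu.
    apply/eqP=> /ffunP/(_ j0); rewrite !ffunE => e.
    have /card_gt0P[u] := gp j0 ord_max; rewrite inE => /eqP eu.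
    by move/setP: e => /(_ u); rewrite !inE eu /= ltnS leqNgt lti.
  apply/(sortedP zero) => i; rewrite szs => lti; rewrite !nthE ?(ltnW lti) //.
  rewrite /B_lt /=; apply/andP; split; last first.
    by apply/forallP=> j; rewrite !ffunE; apply/subsetP=> e; rewrite !inE; apply: ltnW.
  apply/eqP=> /ffunP/(_ j0); rewrite !ffunE => e.
  have lti' : (i.+1 < d.+1)%N by rewrite ltnW.
  have /card_gt0P[u] := gp j0 (Ordinal lti'); rewrite inE => /eqP eu.
  by move/setP: e => /(_ u); rewrite !inE eu /= ltnn ltnSn.
have [c cE] := chain_of cs szs; exists c; apply/ffunP=> j; apply/ffunP=> e; apply/val_inj.
rewrite /= encE cE /pos count_map -sum1_count.
rewrite (_ : iota 0 d = index_iota 0 d) ?big_mkord; last by rewrite /index_iota subn0.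
rewrite (eq_bigl (fun i : 'I_d => (i < R j e)%N)); last first.
  by move=> i; rewrite /= ffunE inE -leqNgt.
have leR : (R j e <= d)%N by rewrite -ltnS ltn_ord.
have := card_ord_lt d (R j e); rewrite -sum1_card (minn_idPr leR) => h.
by rewrite -[RHS]h; apply: eq_bigl => i; rewrite inE.
Qed.

Lemma enc_act c (g : SnT n t) j e : enc (chain_act c g) j (g j e) = enc c j e.
Proof.
apply/val_inj; rewrite /= !encE /pos /= count_map; apply: eq_count => x /=.
by rewrite ffunE mem_imset //; apply: perm_inj.
Qed.

Lemma enc_fixed c (g : SnT n t) :
  (chain_act c g == c) = [forall j, forall e, enc c j (g j e) == enc c j e].
Proof.
apply/eqP/forallP => [e j|h].
  by apply/forallP=> u; rewrite -[X in _ == X](enc_act c g) e.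
apply: enc_inj; apply/ffunP=> j; apply/ffunP=> u.
have /forallP/(_ ((g j)^-1 u)%g)/eqP := h j; rewrite permKV => ->.
by rewrite -(enc_act c g) permKV.
Qed.

(** A chain is fixed exactly when its code is invariant under every g_j. Once the common block sizes
    al are prescribed, the coordinates become independent. A function al whose values do not sum to
    n contributes 0. *)
Lemma card_fixed_chains (g : SnT n t) :
  #|[set c : chain n t d | chain_act c g == c]| =
  (\sum_(al : {ffun 'I_d.+1 -> 'I_n.+1} | [forall i, 0 < al i])
     \prod_(j < t) #|fixfun (fun i => val (al i)) (g j)|)%N.
Proof.
have -> : #|[set c : chain n t d | chain_act c g == c]| =
    #|[set R : code | good R && [forall j, forall e, R j (g j e) == R j e]]|.
  rewrite -(card_imset _ enc_inj); apply: eq_card => R; rewrite inE.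
  apply/imsetP/andP => [[c]|[gR inv]].
    by rewrite inE enc_fixed => inv ->; rewrite enc_good.
  have [c cE] := enc_surj gR; exists c; rewrite ?cE // inE enc_fixed cE.
  exact: inv.
pose ty (R : code) : {ffun 'I_d.+1 -> 'I_n.+1} := [ffun i => inord #|fib R j0 i|].
have tyE R i : ty R i = #|fib R j0 i| :> nat.
  by rewrite ffunE inordK // ltnS -[X in (_ <= X)%N](card_ord n) max_card.
rewrite -sum1_card (partition_big ty (fun al : {ffun _ -> 'I_n.+1} => [forall i, 0 < al i]%N)) /=; last first.
  move=> R; rewrite inE => /andP[/forallP gR _]; apply/forallP=> i; rewrite tyE.
  by have /forallP/(_ i)/andP[] := gR j0.
apply: eq_bigr => al /forallP alp.
under [RHS]eq_bigr => j _ do rewrite -sum1_card.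
rewrite (bigA_distr_big_dep (fun (j : 'I_t) r => r \in fixfun (fun i => val (al i)) (g j))) /=.
rewrite [RHS](eq_bigr (fun=> 1%N)) => [|R _]; last by rewrite big1_eq.
apply: eq_bigl => R; rewrite inE.
apply/andP/familyP => [[/andP[/forallP gR /forallP inv] /eqP eal] j|h].
  rewrite inE; apply/andP; split; last exact: inv.
  apply/forallP=> i; have /forallP/(_ i)/andP[/eqP e _] := gR j.
  by rewrite -eal tyE -e.
have h' j i : #|fib R j i| = al i.
  by have := h j; rewrite inE => /andP[/forallP/(_ i)/eqP].
split; last by apply/eqP/ffunP=> i; apply/val_inj; rewrite /= tyE h'.
apply/andP; split; last by apply/forallP=> j; have := h j; rewrite inE => /andP[].
by apply/forallP=> j; apply/forallP=> i; rewrite !h' eqxx alp.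
Qed.

End FixedChains.

(** * Multiplicities in the top homology *)

Section Compositions.

Lemma sum_count_range (N : nat) (s : seq nat) : all (fun x => 0 < x <= N)%N s ->
  (\sum_(1 <= i < N.+1) count_mem i s = size s)%N.
Proof.
elim: s => [|x s IHs] /=; first by rewrite big1.
move=> /andP[/andP[x0 xN] hs]; rewrite big_split /= IHs // -[in RHS]add1n; congr (_ + _)%N.
rewrite (bigD1_seq x) ?iota_uniq ?mem_index_iota ?x0 ?ltnS //= eqxx big1 ?addn0 // => i.
by rewrite eq_sym => /negPf ->.
Qed.

(** The multinomial coefficient, by induction after splitting the arrangements according to their
    first letter. *)
Lemma size_permutations_fact (N : nat) (s : seq nat) : all (fun x => 0 < x <= N)%N s ->
  (size (permutations s) * \prod_(1 <= i < N.+1) (count_mem i s)`! = (size s)`!)%N.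
Proof.
have [m] := ubnP (size s); elim: m s => // m IHm s szs hs.
case: (eqVneq s [::]) => [->|ns].
  by rewrite big1 // => i _.
have s0 : (0 < size s)%N by case: s ns {szs hs}.
rewrite (perm_size (permutationsE s0)) size_allpairs_dep sumnE big_map big_distrl /=.
transitivity (\sum_(x <- undup s) count_mem x s * (size s).-1`!)%N.
  apply: eq_big_seq => x; rewrite mem_undup => xs.
  have /andP[x0 xN] := allP hs x xs.
  have px : perm_eq s (x :: rem x s) := perm_to_rem xs.
  have hr : all (fun x => 0 < x <= N)%N (rem x s) by apply/allP=> y /mem_rem; apply: (allP hs).
  have szr : size (rem x s) = (size s).-1 by rewrite size_rem.
  rewrite -szr -(IHm (rem x s)) ?szr //; last by rewrite prednK // -ltnS.
  rewrite mulnCA; congr (_ * _)%N.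
  rewrite (bigD1_seq x) ?iota_uniq ?mem_index_iota ?x0 ?ltnS //=.
  rewrite [in RHS](bigD1_seq x) ?iota_uniq ?mem_index_iota ?x0 ?ltnS //= mulnA.
  have cx : count_mem x s = (count_mem x (rem x s)).+1 by rewrite (seq.permP px) /= eqxx.
  congr (_ * _)%N; first by rewrite cx factS.
  apply: eq_bigr => i ne; rewrite (seq.permP px) /= eq_sym (negPf ne).
  by [].
rewrite -big_distrl /= -[in RHS](prednK s0) factS prednK //; congr (_ * _)%N.
rewrite -[RHS](sum_count_range hs) [RHS](bigID (fun i => i \in s)) /= [X in _ = (_ + X)%N]big1 ?addn0.
  rewrite -[RHS]big_filter; apply: perm_big; apply: uniq_perm; rewrite ?undup_uniq ?filter_uniq ?iota_uniq //.
  move=> x; rewrite mem_undup mem_filter mem_index_iota ltnS.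
  by case: (boolP (x \in s)) => // /(allP hs) ->.
by move=> i ni; apply/count_memPn.
Qed.

Variable n : nat.
Implicit Types la : intpart n.

Lemma parts_range la : all (fun x => 0 < x <= n)%N (parts la).
Proof.
apply/allP=> x xs; rewrite (allP (parts_gt0 la) x xs) /=.
by rewrite -(nth_index 0%N xs) part_le.
Qed.

Lemma claE la : cla la = (-1) ^+ (n - ell la) * (size (permutations (parts la)))%:R.
Proof.
rewrite /cla -(size_permutations_fact (parts_range la)) natrM -mulrA; congr (_ * _).
rewrite -mulrA -natr_prod divff ?mulr1 // pnatr_eq0 -lt0n.
by apply: prodn_gt0 => i; apply: fact_gt0.
Qed.

Lemma sort_intpart (s : seq nat) : all (leq 1) s -> sumn s = n ->
  {la : intpart n | perm_eq s (parts la)}.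
Proof.
move=> s0 sn; have [|||la laE] := @intpart_exists n (sort geq s).
- by apply: sort_sorted => a b; apply: leq_total.
- by rewrite all_sort.
- by rewrite (perm_sumn (permEl (perm_sort _ _))).
by exists la; rewrite laE perm_sym; apply/permPl/perm_sort.
Qed.

Lemma perm_parts_inj la la' (s : seq nat) :
  perm_eq s (parts la) -> perm_eq s (parts la') -> la = la'.
Proof.
move=> h1 h2; apply: parts_inj.
have tr : transitive geq by move=> a b c /= u v; apply: leq_trans v u.
have an : antisymmetric geq by move=> a b; rewrite /= andbC => /anti_leq.
apply: (sorted_eq tr an) => //; try exact: parts_sorted.
by rewrite -(permPl h1).
Qed.

Lemma card_ffun_perm m la :
  #|[set al : {ffun 'I_m -> 'I_n.+1} | perm_eq [seq val (al i) | i : 'I_m] (parts la)]| =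
  (if m == ell la then size (permutations (parts la)) else 0)%N.
Proof.
case: eqP => [em|ne]; last first.
  apply: eq_card0 => al; rewrite inE; apply/negP=> /perm_size.
  by rewrite size_map size_enum_ord.
set A := [set al | _].
pose f (al : {ffun 'I_m -> 'I_n.+1}) := [seq val (al i) | i : 'I_m].
have f_inj : injective f.
  move=> al be e; apply/ffunP=> i; apply/val_inj.
  by move/eq_in_map: e => /(_ i); rewrite mem_enum; apply.
rewrite cardE -(size_map f); apply: perm_size; apply: uniq_perm.
- by rewrite map_inj_uniq // enum_uniq.
- exact: permutations_uniq.
move=> s; rewrite mem_permutations; apply/mapP/idP => [[al]|ps].
  by rewrite mem_enum inE => h ->.
have sz : size s = m by rewrite (perm_size ps) em.
have bs i : (nth 0%N s i < n.+1)%N.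
  rewrite ltnS; case: (ltnP i (size s)) => h; last by rewrite nth_default.
  have := mem_nth 0%N h; rewrite (perm_mem ps) => /(allP (parts_range la)).
  by case/andP.
have fE : f [ffun i : 'I_m => Ordinal (bs i)] = s.
  apply: (@eq_from_nth _ 0%N); first by rewrite size_map size_enum_ord sz.
  move=> i; rewrite size_map size_enum_ord => hi.
  rewrite (nth_map (Ordinal hi)) ?size_enum_ord // ffunE /=.
  by rewrite nth_enum_ord.
exists [ffun i : 'I_m => Ordinal (bs i)]; rewrite ?fE // mem_enum inE.
by rewrite -/(f _) fE.
Qed.

End Compositions.

(** * The top homology character and its multiplicities *)

Section TopMultiplicity.

Variables (n t : nat) (t_gt0 : (0 < t)%N) (n_gt0 : (0 < n)%N).

Lemma sum_prod_fixfun d (g : SnT n t) :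
  ((\sum_(al : {ffun 'I_d.+1 -> 'I_n.+1} | [forall i, 0 < al i])
     \prod_(j < t) #|fixfun (fun i => val (al i)) (g j)|)%N)%:R =
  \sum_(la : intpart n | ell la == d.+1)
    (size (permutations (parts la)))%:R * \prod_(j < t) tabchar la (g j).
Proof.
pose P (al : {ffun 'I_d.+1 -> 'I_n.+1}) (la : intpart n) := perm_eq [seq val (al i) | i : 'I_d.+1] (parts la).
have -> : (\sum_(al : {ffun 'I_d.+1 -> 'I_n.+1} | [forall i, 0 < al i])
     \prod_(j < t) #|fixfun (fun i => val (al i)) (g j)| =
   \sum_(al : {ffun 'I_d.+1 -> 'I_n.+1}) \sum_(la : intpart n | P al la)
     \prod_(j < t) #|[set r : tabloid la | tabloid_act r (g j) == r]|)%N.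
  rewrite big_mkcond; apply: eq_bigr => al _; case: ifP => [/forallP alp|/negbT/forallPn[i]]; last first.
    rewrite -eqn0Ngt => /eqP ali; rewrite big_pred0 // => la; apply/negP=> /perm_mem pm.
    have : val (al i) \in parts la by rewrite -pm; apply: image_f.
    by move/(allP (parts_gt0 la)); rewrite /= ali.
  have [sn|nsn] := eqVneq (sumn [seq val (al i) | i : 'I_d.+1]) n.
    have [|la0 pla0] := sort_intpart _ sn; first by apply/allP=> x /mapP[i _ ->]; apply: alp.
    rewrite (big_pred1 la0) => [|la].
      by apply: eq_bigr => j _; apply: card_fixfun_tabloid.
    by apply/idP/eqP => [h|->] //; apply: perm_parts_inj h pla0.
  rewrite [RHS]big_pred0 => [|la]; last first.
    by apply: contraNF nsn => /perm_sumn ->; rewrite sumn_parts.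
  rewrite (bigD1 (Ordinal t_gt0)) //= (_ : #|_| = 0%N) ?mul0n //.
  apply: eq_card0 => r; rewrite inE; apply/negP=> /andP[/forallP fib _].
  case/eqP: nsn; rewrite sumn_codom -[RHS](card_ord n) -sum1_card (partition_big r xpredT) //=.
  by apply: eq_bigr => i _; rewrite -(eqP (fib i)) -sum1_card; apply: eq_bigl => x; rewrite inE.
rewrite (exchange_big_dep xpredT) //= natr_sum [RHS]big_mkcond /=.
apply: eq_bigr => la _; rewrite sum_nat_const natrM natr_prod.
have -> : #|[pred al | P al la]| = #|[set al | P al la]| by apply: eq_card => al; rewrite !inE.
rewrite card_ffun_perm eq_sym; case: ifP => _; last by rewrite mul0r.
by congr (_ * _); apply: eq_bigr => j _; rewrite tabcharE.
Qed.

(** Chains of d elements have d + 1 blocks, so la only meets d = ell la - 1, where the Hopf sign is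
    (-1)^(n - ell la). The number of orderings of the parts of la supplies the rest of [cla]. *)
Lemma top_homology_tabchar (g : SnT n t) :
  top_homology_char n t g = \sum_(la : intpart n) cla la * \prod_(j < t) tabchar la (g j).
Proof.
rewrite top_homology_charE //.
under eq_bigr => d _ do rewrite card_fixed_chains // sum_prod_fixfun mulr_sumr.
rewrite (exchange_big_dep xpredT) //=; apply: eq_bigr => la _.
have l0 : (0 < ell la)%N.
  rewrite lt0n; apply/negP=> /eqP/size0nil e; have := sumn_parts la; rewrite e /= => e0.
  by have := n_gt0; rewrite -e0.
have ltl : ((ell la).-1 < n)%N by rewrite prednK // ell_le.
rewrite (big_pred1 (Ordinal ltl)) => [|d]; last first.
  by rewrite /= -val_eqE /= -[in LHS](prednK l0) eqSS eq_sym.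
rewrite mulrA claE /=; congr (_ ^+ _ * _ * _).
by have := n_gt0; lia.
Qed.

Lemma sum_SnT_prod (R : comNzRingType) (F : 'I_t -> 'S_n -> R) :
  \sum_(g : SnT n t) \prod_(j < t) F j (g j) = \prod_(j < t) \sum_(h : 'S_n) F j h.
Proof.
rewrite bigA_distr_bigA /= [LHS](reindex (fun f : {ffun 'I_t -> 'S_n} => (f : SnT n t))) //=.
by exists (fun f : SnT n t => (f : {ffun 'I_t -> 'S_n})).
Qed.

Lemma cfdot_SnT (F H : 'I_t -> 'CF([set: 'S_n])) :
  #|[set: SnT n t]|%:R^-1 * (\sum_(g : SnT n t) (\prod_j F j (g j)) * (\prod_j H j (g j))^*) =
  \prod_j '[F j, H j].
Proof.
rewrite (eq_bigr (fun g : SnT n t => \prod_j (F j (g j) * (H j (g j))^*))) => [|g _]; last first.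
  by rewrite rmorph_prod -big_split.
rewrite (sum_SnT_prod (fun j h => F j h * (H j h)^*)).
have -> : #|[set: SnT n t]|%:R^-1 = \prod_(j < t) #|[set: 'S_n]|%:R^-1 :> algC.
  rewrite [RHS]prodfV; congr (_^-1).
  rewrite cardsT; transitivity (\sum_(g : SnT n t) \prod_(j < t) (1 : algC)).
    by rewrite (eq_bigr (fun=> 1)) ?sumr_const // => g _; rewrite big1_eq.
  by rewrite (sum_SnT_prod (fun _ _ => 1 : algC)); apply: eq_bigr => j _; rewrite cardsT sumr_const.
rewrite -big_split; apply: eq_bigr => j _; rewrite cfdotE; congr (_ * _).
by apply: eq_bigl => h; rewrite inE.
Qed.

Lemma irrSTE (mu : {ffun 'I_t -> intpart n}) g : irrST mu g = \prod_j irrS (mu j) (g j).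
Proof. by rewrite cfunE. Qed.

Lemma irrST_orthonormal (mu nu : {ffun 'I_t -> intpart n}) :
  '[irrST mu, irrST nu] = (mu == nu)%:R.
Proof.
rewrite cfdotE; transitivity (\prod_j '[irrS (mu j), irrS (nu j)]).
  rewrite -(cfdot_SnT (fun j => irrS (mu j)) (fun j => irrS (nu j))); congr (_ * _).
  by apply: eq_big => [g|g _]; rewrite ?inE // !irrSTE.
under eq_bigr => j _ do rewrite irrS_orthonormal.
case: eqP => [->|ne]; first by rewrite big1 // => j _; rewrite eqxx.
have [j nej|none] := pickP (fun j => mu j != nu j).
  by rewrite (bigD1 j) //= (negPf nej) mul0r.
by case: ne; apply/ffunP=> j; apply/eqP/negbFE/none.
Qed.

Theorem top_homology_multiplicity (mu : {ffun 'I_t -> intpart n}) :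
  '[top_homology_char n t, irrST mu] =
    \sum_(la : intpart n) cla la * \prod_(j < t) (kostka (mu j) (parts la))%:R.
Proof.
rewrite cfdotE (eq_bigl xpredT) => [|g]; last by rewrite inE.
under eq_bigr => g _ do rewrite top_homology_tabchar irrSTE mulr_suml.
rewrite exchange_big mulr_sumr /=; apply: eq_bigr => la _.
under eq_bigr => g _ do rewrite -mulrA.
rewrite -mulr_sumr mulrCA; congr (_ * _).
rewrite (cfdot_SnT (fun=> tabchar la) (fun j => irrS (mu j))).
by apply: eq_bigr => j _; rewrite young_rule.
Qed.

Lemma pull_mx_repr (j : 'I_t) d (rG : mx_representation algC [set: 'S_n] d) :
  mx_repr [set: SnT n t] (fun g : SnT n t => rG (g j)).
Proof.
split=> [|g h _ _].
  by rewrite ffunE repr_mx1.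
by rewrite dffunM /= repr_mxM ?inE.
Qed.

Lemma irrST_char (mu : {ffun 'I_t -> intpart n}) : irrST mu \is a character.
Proof.
pose rj j := MxRepresentation (pull_mx_repr j (submod_repr (specht_module (mu j)))).
have -> : irrST mu = \prod_j cfRepr (rj j).
  apply/cfunP=> g; rewrite irrSTE prod_cfunE ?inE //; apply: eq_bigr => j _.
  by rewrite !cfunE !inE.
by apply: rpred_prod => j _; apply: cfRepr_char.
Qed.

End TopMultiplicity.

(** * Schur functions in several alphabets *)

Section Families.

Variable t : nat.
Implicit Types f g : sfam t.

Lemma sfam_sumE (I : Type) (r : seq I) (P : pred I) (F : I -> sfam t) N :
  (\sum_(i <- r | P i) F i) N = \sum_(i <- r | P i) F i N.
Proof. by apply: (big_morph (fun f : sfam t => f N)). Qed.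

Lemma sfam_prodE (I : Type) (r : seq I) (P : pred I) (F : I -> sfam t) N :
  (\prod_(i <- r | P i) F i) N = \prod_(i <- r | P i) F i N.
Proof. by apply: (big_morph (fun f : sfam t => f N)). Qed.

Lemma hprodE n (j : 'I_t) (la : intpart n) N : hprod j la N = hp (fun i : 'I_N => xvar j i) la.
Proof. exact: sfam_prodE. Qed.

Lemma hsym0 (j : 'I_t) : hsym j 0 = 1.
Proof. by apply: sfamP => N; apply: hc0. Qed.

Lemma hprod_kostka n (j : 'I_t) (la : intpart n) :
  hprod j la = \sum_(mu : intpart n) (kostka mu (parts la))%:R *: schur j mu.
Proof.
apply: sfamP => N; rewrite hprodE hp_kostka sfam_sumE; apply: eq_bigr => mu _.
by rewrite -[RHS]/(_ *: schur j mu N) scaler_nat mulr_natl.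
Qed.

Lemma schur_jtcoef n (j : 'I_t) (la : intpart n) :
  schur j la = \sum_(al : intpart n) (jtcoef la al)%:~R *: hprod j al.
Proof.
apply: sfamP => N; rewrite sfam_sumE -[LHS]/(sc (fun i : 'I_N => xvar j i) la) sc_jtcoef.
apply: eq_bigr => al _; rewrite -[RHS]/(_ *: hprod j al N) hprodE.
by rewrite scaler_int mulrzl.
Qed.

Lemma Zla_prod n (la : intpart n) : Zla t la = \prod_(p <- parts la) Zm t p.
Proof. by rewrite /Zla /Zm /hprod exchange_big. Qed.

Lemma Zla_kostka n (la : intpart n) :
  Zla t la = \sum_(mu : {ffun 'I_t -> intpart n})
    (\prod_j (kostka (mu j) (parts la))%:R) *: \prod_j schur j (mu j).
Proof.
rewrite /Zla; under eq_bigr => j _ do rewrite hprod_kostka.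
by rewrite bigA_distr_bigA; apply: eq_bigr => mu _; rewrite scaler_prod.
Qed.

Section LinearIndependence.

Variable n : nat.

Definition content_count (mu : intpart n) (w : {ffun 'I_n -> 'I_n.+1}) : nat :=
  #|[set T : {ffun cell mu -> 'I_n} | ssyt T & [forall k, #|[set c | T c == k]| == w k]]|.

Lemma schur_content (j : 'I_t) (mu : intpart n) :
  schur j mu n = \sum_w (content_count mu w)%:R *: \prod_(i < n) xvar j i ^+ w i.
Proof.
pose ct (T : {ffun cell mu -> 'I_n}) : {ffun 'I_n -> 'I_n.+1} :=
  [ffun k => inord #|[set c | T c == k]|].
have ctE T k : ct T k = #|[set c | T c == k]| :> nat.
  rewrite ffunE inordK // ltnS -[X in (_ <= X)%N](card_cell mu).
  exact: max_card.
rewrite /schur (partition_big ct xpredT) //=; apply: eq_bigr => w _.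
rewrite /content_count -sum1_card natr_sum scaler_suml.
apply: eq_big => [T|T /andP[_ /eqP <-]].
  rewrite inE; congr (_ && _); apply/eqP/forallP => [<- k|h]; first by rewrite ctE.
  by apply/ffunP=> k; apply/val_inj/eqP; rewrite /= ctE.
rewrite scale1r (partition_big T xpredT) //=; apply: eq_bigr => k _.
rewrite (eq_bigr (fun=> xvar j k)) => [|c /eqP -> //].
rewrite prodr_const ctE; congr (_ ^+ _); apply: eq_card => c.
by rewrite inE.
Qed.

Definition bigmon (W : {ffun 'I_t -> {ffun 'I_n -> 'I_n.+1}}) : 'X_{1..t * n} :=
  (\sum_j \sum_i U_(mxvec_index j i) *+ W j i)%MM.

Lemma mxvec_index_inj (j j' : 'I_t) (i i' : 'I_n) :
  (mxvec_index j i == mxvec_index j' i') = (j == j') && (i == i').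
Proof.
apply/eqP/andP => [e|[/eqP -> /eqP ->]] //.
have [h hK _] := curry_mxvec_bij t n.
have := congr1 h e; have := hK (j, i); have := hK (j', i'); rewrite /= !inE => -> // -> // [-> ->].
by rewrite !eqxx.
Qed.

Lemma bigmonE W j i : bigmon W (mxvec_index j i) = W j i.
Proof.
rewrite /bigmon mnm_sumE (bigD1 j) //= mnm_sumE (bigD1 i) //= mulmnE mnm1E eqxx mul1n.
rewrite big1 => [|i' ne]; last by rewrite mulmnE mnm1E mxvec_index_inj (negPf ne) andbF.
rewrite addn0 big1 ?addn0 // => j' ne; rewrite mnm_sumE big1 // => i' _.
by rewrite mulmnE mnm1E mxvec_index_inj (negPf ne).
Qed.

Lemma bigmon_inj : injective bigmon.
Proof.
move=> W W' /mnmP e; apply/ffunP=> j; apply/ffunP=> i; apply/val_inj.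
by rewrite /= -!bigmonE e.
Qed.

Definition exponents (nu : {ffun 'I_t -> intpart n}) :
    {ffun 'I_t -> {ffun 'I_n -> 'I_n.+1}} :=
  [ffun j => [ffun i : 'I_n => inord (part (nu j) i)]].

Lemma coef_prod_schur (mu nu : {ffun 'I_t -> intpart n}) :
  ((\prod_j schur j (mu j)) n)@_(bigmon (exponents nu)) =
  \prod_j (kostka (mu j) (parts (nu j)))%:R.
Proof.
set W0 := exponents nu.
rewrite sfam_prodE; under eq_bigr => j _ do rewrite schur_content.
rewrite bigA_distr_bigA raddf_sum /=.
have monE (W : {ffun 'I_t -> {ffun 'I_n -> 'I_n.+1}}) :
   \prod_j ((content_count (mu j) (W j))%:R *: \prod_(i < n) xvar j i ^+ W j i) =
   (\prod_j (content_count (mu j) (W j))%:R) *: 'X_[bigmon W].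
  rewrite scaler_prod; congr (_ *: _); rewrite /bigmon -mprodXE; apply: eq_bigr => j _.
  by rewrite mprodXnE.
rewrite (bigD1 W0) //= [X in _ + X]big1 ?addr0 => [|W ne]; last first.
  by rewrite monE mcoeffZ mcoeffX (inj_eq bigmon_inj) (negPf ne) mulr0.
rewrite monE mcoeffZ mcoeffX eqxx mulr1.
apply: eq_bigr => j _; rewrite kostka_pad; congr (_%:R); apply: eq_card => T; rewrite !inE; congr (_ && _).
by apply: eq_forallb => k; rewrite /W0 !ffunE inordK // ltnS part_le.
Qed.

(** In n variables per alphabet, the coefficients at the monomials with exponents nu form the t-fold
    tensor power of the Kostka matrix, which the tensor power of J inverts. *)
Lemma schur_prod_free (a b : {ffun 'I_t -> intpart n} -> algC) :
  \sum_mu a mu *: (\prod_j schur j (mu j) : sfam t) = \sum_mu b mu *: \prod_j schur j (mu j) ->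
  a =1 b.
Proof.
move=> e la; pose K (m v : intpart n) : algC := (kostka m (parts v))%:R.
pose J (m v : intpart n) : algC := (jtcoef m v)%:~R.
have ce (nu : {ffun 'I_t -> intpart n}) : \sum_mu a mu * \prod_j K (mu j) (nu j) = \sum_mu b mu * \prod_j K (mu j) (nu j).
  have coefE (c : {ffun 'I_t -> intpart n} -> algC) :
      ((\sum_mu c mu *: (\prod_j schur j (mu j) : sfam t)) n)@_(bigmon (exponents nu)) =
      \sum_mu c mu * \prod_j K (mu j) (nu j).
    rewrite sfam_sumE raddf_sum /=; apply: eq_bigr => mu _.
    by rewrite -[X in X@__]/(c mu *: (\prod_j schur j (mu j) : sfam t) n) mcoeffZ coef_prod_schur.
  by rewrite -!coefE e.
have inv (c : {ffun 'I_t -> intpart n} -> algC) : c la =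
    \sum_(nu : {ffun 'I_t -> intpart n}) (\prod_j J (la j) (nu j)) * \sum_mu c mu * \prod_j K (mu j) (nu j).
  under [RHS]eq_bigr => nu _ do rewrite mulr_sumr.
  rewrite exchange_big /=.
  have KJ mu : \sum_(nu : {ffun 'I_t -> intpart n}) (\prod_j J (la j) (nu j)) * (c mu * \prod_j K (mu j) (nu j)) =
      c mu * (la == mu)%:R.
    under eq_bigr => nu _ do rewrite mulrCA -big_split.
    rewrite -mulr_sumr -(bigA_distr_bigA (fun j v => J (la j) v * K (mu j) v)) /=; congr (_ * _).
    rewrite (eq_bigr (fun j => (la j == mu j)%:R)) => [|j _]; last first.
      have := congr1 (fun z : int => z%:~R : algC) (kostka_inverse (mu j) (la j)).
      rewrite rmorph_nat => <-; rewrite rmorph_sum; apply: eq_bigr => v _.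
      by rewrite rmorphM /= rmorph_nat.
    case: eqP => [->|ne]; first by rewrite big1 // => j _; rewrite eqxx.
    have [j nej|none] := pickP (fun j => la j != mu j).
      by rewrite (bigD1 j) //= (negPf nej) mul0r.
    by case: ne; apply/ffunP=> j; apply/eqP/negbFE/none.
  rewrite (bigD1 la) //= KJ eqxx mulr1 big1 ?addr0 // => mu ne.
  by rewrite KJ eq_sym (negPf ne) mulr0.
by rewrite (inv a) (inv b); apply: eq_bigr => nu _; rewrite ce.
Qed.

End LinearIndependence.

Lemma subst_xvar N k (M : 'M[{mpoly algC[k]}]_(t, N)) j i : subst M (xvar j i) = M j i.
Proof. by rewrite /subst comp_mpolyXU -tnth_nth tnth_mktuple mxvecE. Qed.

Lemma subst_hsym N k (M : 'M[{mpoly algC[k]}]_(t, N)) j m :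
  subst M (hsym j m N) = hc (fun i => M j i) m.
Proof.
rewrite /subst -[hsym j m N]/(hc (fun i : 'I_N => xvar j i) m) rmorph_hc.
by apply: eq_hc => i; apply: subst_xvar.
Qed.

Lemma in_Lambda_hsym (j : 'I_t) m : in_Lambda (hsym j m).
Proof.
split=> [N g|N|].
- rewrite subst_hsym (eq_hc _ (y := fun i => xvar j (g j i))); last by move=> i; rewrite mxE.
  exact: (hc_perm (fun i => xvar j i)).
- rewrite subst_hsym hc_recr big_ord_recl expr0 mul1r subn0 big1 ?addr0 => [|k _]; last first.
    by rewrite mxE unlift_none /= expr0n mul0r.
  apply: eq_hc => i; rewrite mxE (_ : widen_ord _ i = lift ord_max i) ?liftK //.
  by apply/val_inj; rewrite /= /bump leqNgt ltn_ord.
exists m.+1 => N; apply: leq_trans (msize_sum _ _ _) _.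
apply/bigmax_leqP_seq => w _ /eqP dw.
rewrite mprodXnE msizeX ltnS -[X in (_ <= X)%N]dw mdeg_sum.
rewrite [X in (_ <= X)%N]mdegE; apply: leq_sum => i _.
by rewrite mdegMn mdeg1 mul1n.
Qed.

Lemma in_Lambda1 : in_Lambda (1 : sfam t).
Proof.
split=> [N g|N|]; try exact: rmorph1.
by exists 1%N => N; rewrite msize1.
Qed.

Lemma in_Lambda0 : in_Lambda (0 : sfam t).
Proof.
split=> [N g|N|]; try exact: rmorph0.
by exists 1%N => N; rewrite msize0.
Qed.

Lemma in_LambdaD f g : in_Lambda f -> in_Lambda g -> in_Lambda (f + g).
Proof.
case=> s1 t1 [d1 b1] [s2 t2 [d2 b2]]; split=> [N h|N|].
- by rewrite /subst rmorphD /= -!/(subst _ _) s1 s2.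
- by rewrite /subst rmorphD /= -!/(subst _ _) t1 t2.
exists (maxn d1 d2) => N; apply: leq_trans (msizeD_le _ _) _.
by rewrite geq_max !leq_max b1 b2 orbT.
Qed.

Lemma in_LambdaM f g : in_Lambda f -> in_Lambda g -> in_Lambda (f * g).
Proof.
case=> s1 t1 [d1 b1] [s2 t2 [d2 b2]]; split=> [N h|N|].
- by rewrite /subst rmorphM /= -!/(subst _ _) s1 s2.
- by rewrite /subst rmorphM /= -!/(subst _ _) t1 t2.
exists (d1 + d2).+1 => N; apply: leq_trans (msizeM_le _ _) _.
by rewrite ltnS leq_add.
Qed.

Lemma in_LambdaZ a f : in_Lambda f -> in_Lambda (a *: f).
Proof.
case=> s1 t1 [d1 b1]; split=> [N h|N|].
- by rewrite /subst comp_mpolyZ -/(subst _ _) s1.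
- by rewrite /subst comp_mpolyZ -/(subst _ _) t1.
by exists d1 => N; apply: leq_trans (msizeZ_le _ _) (b1 N).
Qed.

Lemma in_Lambda_hprod n (j : 'I_t) (la : intpart n) : in_Lambda (hprod j la).
Proof.
rewrite /hprod; elim: (parts la) => [|p s IHs]; first by rewrite big_nil; apply: in_Lambda1.
by rewrite big_cons; apply: in_LambdaM IHs; apply: in_Lambda_hsym.
Qed.

End Families.

(** * Images under the homomorphism Phi *)

Section PhiValues.

Variables (t : nat) (Phi : sfam 1 -> sfam t).
Hypothesis hPhi : is_Phi Phi.

(** Membership in Lambda is carried through the induction because Phi is multiplicative only
    there. *)
Lemma Phi_hprod n (la : intpart n) : Phi (hprod ord0 la) = Zla t la.
Proof.
rewrite Zla_prod /hprod.
suff [] : Phi (\prod_(p <- parts la) hsym ord0 p) = \prod_(p <- parts la) Zm t p /\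
          in_Lambda (\prod_(p <- parts la) hsym ord0 p : sfam 1) by [].
elim: (parts la) => [|p s [IHs Ls]].
  by rewrite !big_nil; split; [apply: (Phi1 hPhi) | apply: in_Lambda1].
rewrite !big_cons; split; last exact: in_LambdaM (in_Lambda_hsym _ _) Ls.
by rewrite (PhiM hPhi (in_Lambda_hsym _ _) Ls) IHs (Phi_h hPhi).
Qed.

Lemma Phi_sum_hprod n (c : intpart n -> algC) :
  Phi (\sum_al c al *: hprod ord0 al) = \sum_al c al *: Zla t al.
Proof.
suff [] : Phi (\sum_al c al *: hprod ord0 al) = \sum_al c al *: Zla t al /\
          in_Lambda (\sum_al c al *: hprod ord0 al : sfam 1) by [].
elim: (index_enum _) => [|al s [IHs Ls]].
  rewrite !big_nil; split; last exact: in_Lambda0.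
  (* The value of Phi at 0 comes from its compatibility with scaling by 0. *)
  by rewrite -(scale0r (0 : sfam 1)) (PhiZ hPhi _ (in_Lambda0 1)) scale0r.
have La : in_Lambda (c al *: hprod ord0 al : sfam 1) by apply/in_LambdaZ/in_Lambda_hprod.
rewrite !big_cons; split; last exact: in_LambdaD.
by rewrite (PhiD hPhi La Ls) IHs (PhiZ hPhi _ (in_Lambda_hprod _ _)) Phi_hprod.
Qed.

Lemma Phi_sum_kostka n (c : intpart n -> algC) :
  Phi (\sum_al c al *: hprod ord0 al) =
  \sum_(mu : {ffun 'I_t -> intpart n})
    (\sum_al c al * \prod_j (kostka (mu j) (parts al))%:R) *: \prod_j schur j (mu j).
Proof.
rewrite Phi_sum_hprod; under [RHS]eq_bigr => mu _ do rewrite scaler_suml.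
rewrite exchange_big /=; apply: eq_bigr => al _; rewrite Zla_kostka scaler_sumr.
by apply: eq_bigr => mu _; rewrite scalerA.
Qed.

End PhiValues.

Lemma product_frobenius_sum n t (c : {ffun 'I_t -> intpart n} -> algC) :
  product_frobenius (\sum_mu c mu *: irrST mu) = \sum_mu c mu *: \prod_j schur j (mu j).
Proof.
apply: eq_bigr => mu _; congr (_ *: _).
rewrite cfdot_suml (bigD1 mu) //= cfdotZl irrST_orthonormal eqxx mulr1 big1 ?addr0 // => nu ne.
by rewrite cfdotZl irrST_orthonormal (negPf ne) mulr0.
Qed.

(** * The generating function *)

(** The compositions of n, listed by first part. The remainder n - k is not a structural subterm, so
    the recursion is on the fuel [f], which suffices as soon as it is at least n. *)
Fixpoint comps_rec (f n : nat) : seq (seq nat) :=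
  if n is 0 then [:: [::]] else
  if f is f'.+1 then [seq k :: c | k <- iota 1 n, c <- comps_rec f' (n - k)] else [::].

Lemma comps_recE f n : comps_rec f.+1 n.+1 =
  [seq k :: c | k <- iota 1 n.+1, c <- comps_rec f (n.+1 - k)].
Proof. by []. Qed.

Lemma mem_comps f n c : (n <= f)%N -> (c \in comps_rec f n) = all (leq 1) c && (sumn c == n).
Proof.
elim: f n c => [|f IHf] [|n] c //.
- by move=> _; rewrite inE; case: c => //= x c; case: x => //= x; rewrite addSn andbF.
- by move=> _; rewrite inE; case: c => //= x c; case: x => //= x; rewrite addSn andbF.
rewrite ltnS => le; rewrite comps_recE; apply/allpairsPdep/idP => [[k [c' [kin cin ->]]]|].
  move: kin; rewrite mem_iota => /andP[k0 kn].
  move: cin; rewrite IHf ?leq_subLR; last by lia.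
  by move=> /andP[ac /eqP sc] /=; rewrite k0 ac sc /= subnKC // -ltnS.
case: c => [|k c] //= /andP[/andP[k0 ac] /eqP sc]; exists k, c; split=> //.
  by rewrite -[1%N :: iota 2 n]/(iota 1 n.+1) mem_iota k0 add1n ltnS -sc leq_addr.
rewrite IHf; last by lia.
by rewrite ac -sc addKn eqxx.
Qed.

Lemma comps_uniq f n : uniq (comps_rec f n).
Proof.
elim: f n => [|f IHf] [|n] //; rewrite comps_recE allpairs_uniq_dep ?iota_uniq //.
by move=> [k c] [k' c'] _ _ /= [-> ->].
Qed.

Lemma comps_perm f n : (n <= f)%N -> perm_eq (comps_rec f n) (comps_rec n n).
Proof.
move=> le; apply: uniq_perm; rewrite ?comps_uniq // => c.
by rewrite !mem_comps.
Qed.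

Section GeneratingFunction.

Variable t : nat.

(** Compositions replace partitions because they can be split at the first part; up to sign,
    [cla la] counts the compositions that sort to la. *)
Definition comp_sum (n : nat) : sfam t :=
  \sum_(c <- comps_rec n n) (-1) ^+ (n - size c) * \prod_(p <- c) Zm t p.

Lemma comp_sum_partitions n :
  comp_sum n = \sum_(la : intpart n) cla la *: Zla t la.
Proof.
rewrite /comp_sum.
transitivity (\sum_(c <- comps_rec n n) \sum_(la : intpart n | perm_eq c (parts la))
     (-1) ^+ (n - ell la) * Zla t la).
  apply: eq_big_seq => c; rewrite mem_comps // => /andP[ac /eqP sc].
  have [la0 pla] := sort_intpart ac sc.
  rewrite (big_pred1 la0) => [|la].
    by rewrite Zla_prod (perm_big _ pla) (perm_size pla).
  by apply/idP/eqP => [h|->] //; apply: perm_parts_inj h pla.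
rewrite (exchange_big_dep xpredT) //=; apply: eq_bigr => la _.
rewrite big_const_seq iter_addr_0 claE -scalerA scaler_nat.
rewrite -[in LHS]signr_odd -[in RHS]signr_odd scaler_sign mulr_sign.
have -> : count (fun c => perm_eq c (parts la)) (comps_rec n n) = size (permutations (parts la)).
  rewrite -size_filter; apply: perm_size; apply: uniq_perm.
  - by rewrite filter_uniq // comps_uniq.
  - exact: permutations_uniq.
  move=> c; rewrite mem_filter mem_permutations mem_comps //; case: (boolP (perm_eq _ _)) => //= pc.
  by rewrite (perm_all _ pc) parts_gt0 (perm_sumn pc) sumn_parts eqxx.
by case: (odd _); rewrite ?mulNrn.
Qed.

Lemma Zm0 : Zm t 0 = 1.
Proof. by rewrite /Zm big1 // => j _; apply: hsym0. Qed.

Lemma comp_sumS n :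
  comp_sum n.+1 = \sum_(k < n.+1) (-1) ^+ k * Zm t k.+1 * comp_sum (n - k).
Proof.
rewrite /comp_sum comps_recE big_allpairs_dep /= -(big_mkord xpredT
  (fun k => (-1) ^+ k * Zm t k.+1 * \sum_(c <- comps_rec (n - k) (n - k))
      (-1) ^+ (n - k - size c) * \prod_(p <- c) Zm t p)).
rewrite -[1%N :: iota 2 n]/(iota (1 + 0) n.+1) iotaDl big_map /index_iota subn0; apply: eq_big_seq => k.
rewrite mem_iota add0n => /andP[_ kn].
rewrite add1n subSS (perm_big _ (comps_perm (leq_subr k n))) /= mulr_sumr.
apply: eq_big_seq => c; rewrite mem_comps // => /andP[ac /eqP sc].
have szc : (size c <= n - k)%N by rewrite -sc size_sumn.
rewrite big_cons subSS (_ : n - size c = k + (n - k - size c))%N; last by lia.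
by rewrite exprD mulrACA.
Qed.

(** Splitting off the first part, as in [comp_sumS], is exactly the vanishing of the positive
    coefficients of the product. *)
Lemma comp_sum_inverse : fps_is_inverse comp_sum (fun m => (-1) ^+ m * Zm t m).
Proof.
have c0 : comp_sum 0 = 1 by rewrite /comp_sum /= big_seq1 big_nil subnn expr0 mul1r.
have left : fps_mul (fun m => (-1) ^+ m * Zm t m) comp_sum =1 fps_one (sfam t).
  case=> [|m]; rewrite /fps_mul /fps_one /=.
    by rewrite big_ord1 subnn c0 expr0 Zm0 !mulr1.
  rewrite big_ord_recl /= expr0 Zm0 !mul1r subn0 comp_sumS -big_split big1 //= => k _.
  by rewrite /bump /= add1n subSS exprS mulN1r !mulNr subrr.
split=> // m; rewrite -left /fps_mul (reindex_inj rev_ord_inj) /=.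
by apply: eq_bigr => k _; rewrite subSS subKn 1?mulrC // -ltnS.
Qed.

End GeneratingFunction.

Lemma beta_partitions t n : (0 < t)%N -> (0 < n)%N ->
  beta t n = \sum_(la : intpart n) cla la *: Zla t la.
Proof.
case: n => // n t_gt0 n_gt0; rewrite /beta /product_frobenius.
under eq_bigr => mu _ do rewrite top_homology_multiplicity // scaler_suml.
rewrite exchange_big /=; apply: eq_bigr => la _; rewrite Zla_kostka scaler_sumr.
by apply: eq_bigr => mu _; rewrite scalerA.
Qed.

Lemma beta_comp_sum t n : (0 < t)%N -> beta t n = comp_sum t n.
Proof.
move=> t_gt0; case: n => [|n]; last by rewrite beta_partitions // comp_sum_partitions.
by rewrite /comp_sum /= big_seq1 big_nil subnn expr0 mul1r.
Qed.

Theorem theorem4p10 (t n : nat) (ht : (1 <= t)%N) (hn : (1 <= n)%N) :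
  [/\ beta t n = \sum_(la : intpart n) cla la *: Zla t la,
      fps_is_inverse (beta t) (fun m => (-1) ^+ m * Zm t m),
      (forall mu : {ffun 'I_t -> intpart n},
         '[top_homology_char n t, irrST mu] =
           \sum_(la : intpart n) cla la * \prod_(j < t) (kostka (mu j) (parts la))%:R)
    & (forall (Phi : sfam 1 -> sfam t) (la : intpart n), is_Phi Phi ->
         (exists2 phi, phi \in 'Z[irr [set: SnT n t]] &
            product_frobenius phi = Phi (schur ord0 la)) /\
         (forall phi, phi \in 'Z[irr [set: SnT n t]] ->
            product_frobenius phi = Phi (schur ord0 la) ->
            forall mu : {ffun 'I_t -> intpart n},
              '[phi, irrST mu] =
                \sum_(s : 'S_(ell la) | jt_admissible s)
                   (-1) ^+ s * \prod_(j < t) (kostka (mu j) (jt_part s))%:R /\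
              (forall M, is_transition_sh M ->
                 '[phi, irrST mu] =
                   \sum_(nu : intpart n)
                      M la nu * \prod_(j < t) (kostka (mu j) (parts nu))%:R)))].
Proof.
split.
- exact: beta_partitions.
- have [h1 h2] := comp_sum_inverse t; split=> m.
    by rewrite -h1; apply: eq_bigr => k _; rewrite beta_comp_sum.
  by rewrite -h2; apply: eq_bigr => k _; rewrite beta_comp_sum.
- exact: top_homology_multiplicity.
move=> Phi la hPhi.
(* The multiplicities to be found, in the form obtained by pushing the Jacobi-Trudi expansion of
   s_la through Phi. *)
pose A (mu : {ffun 'I_t -> intpart n}) : algC :=
  \sum_al (jtcoef la al)%:~R * \prod_j (kostka (mu j) (parts al))%:R.
have PhiE : Phi (schur ord0 la) = \sum_mu A mu *: \prod_j schur j (mu j).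
  by rewrite schur_jtcoef Phi_sum_kostka.
split.
  exists (\sum_mu A mu *: irrST mu); last by rewrite product_frobenius_sum PhiE.
  apply: rpred_sum => mu _.
  (* These multiplicities are integers because inverse Kostka numbers are, so the class function is
     a virtual character. *)
  have -> : A mu = (\sum_al jtcoef la al * \prod_j (kostka (mu j) (parts al))%:R)%:~R.
    rewrite rmorph_sum; apply: eq_bigr => al _; rewrite rmorphM rmorph_prod /=; congr (_ * _).
    by apply: eq_bigr => j _; rewrite rmorph_nat.
  by rewrite scaler_int rpredMz // char_vchar // irrST_char.
move=> phi _ phiE mu; split=> [|M hM].
  rewrite (jt_sum (fun s => \prod_(j < t) (kostka (mu j) s)%:R)).
  by apply: (schur_prod_free (a := fun mu => '[phi, irrST mu]) (b := A)); rewrite -PhiE.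
(* Any expansion of s_la in the h_nu can be pushed through Phi; freeness of the Schur products then
   compares the multiplicities. *)
apply: (schur_prod_free (a := fun mu => '[phi, irrST mu])
  (b := fun mu => \sum_nu M la nu * \prod_(j < t) (kostka (mu j) (parts nu))%:R)).
rewrite -[LHS]/(product_frobenius phi) phiE.
by rewrite hM (Phi_sum_kostka hPhi).
Qed.
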